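(* Fix $\alpha>0$, $\nu>0$ and an integer $k\ge 1$. Then, with probability tending to $1$ as $n\to\infty$, the nodes of the random hyperbolic graph $\mathcal{G}_{\alpha,\nu}(n)$, ordered by increasing radius as $X_{(1)}^n,\dots,X_{(n)}^n$, satisfy $$\forall i\in\{k+1,\dots,n\},\quad \deg(X_{(1)}^n)>\deg(X_{(2)}^n)>\dots>\deg(X_{(k)}^n)>\deg(X_{(i)}^n).$$
   Context: Hyperbolic plane: $\mathbb{H}$ is the Poincaré disc (open unit disc of $\mathbb{C}$ with metric $4\mathbf{g}_{\mathbb{C}}/(1-|w|^2)^2$, where $\mathbf{g}_{\mathbb{C}}$ is the Euclidean metric), with distance $d_{\mathbb{H}}$. A point $w$ has polar coordinates $(r(w),\theta(w))$, where $r(w)$ is its hyperbolic distance to the origin (its radius) and $\theta(w)$ its angle. For points $x=(r,\theta)$, $y=(s,\beta)$: $\cosh d_{\mathbb{H}}(x,y)=\cosh r\cosh s-\sinh r\sinh s\cos(\theta-\beta)$. Random hyperbolic graph $\mathcal{G}_{\alpha,\nu}(n)$: for $\alpha,\nu>0$ and $n\in\mathbb{N}^*$ (with $n>\nu$), set $R_n:=2\log(n/\nu)$. Let $\mu_n$ be the probability measure on $\mathbb{H}$ under which the polar coordinates $r,\theta$ are independent, $\theta$ is uniform on $(-\pi,\pi]$, and $r$ has density $\rho_n(r)=\frac{\alpha\sinh(\alpha r)}{\cosh(\alpha R_n)-1}\mathbf{1}_{\{r<R_n\}}$ on $\mathbb{R}_+$. The nodes $X_1^n,\dots,X_n^n$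 are i.i.d. with law $\mu_n$, and two distinct nodes are joined by an (undirected) edge if and only if their hyperbolic distance is at most $R_n$. $\deg(X)$ denotes the number of neighbours of the node $X$ in the graph. $X_{(1)}^n,\dots,X_{(n)}^n$ denotes a reordering of the nodes by increasing radius: $r(X_{(1)}^n)\le\dots\le r(X_{(n)}^n)$ (almost surely there are no ties). *)

(* Defs.v *)
From HB Require Import structures.
From mathcomp Require Import all_boot all_order all_algebra perm.
From mathcomp Require Import all_classical all_reals all_analysis measurable_realfun.
From mathcomp Require Import ring lra.

Set Implicit Arguments.
Unset Strict Implicit.
Unset Printing Implicit Defensive.

Import Order.TTheory GRing.Theory Num.Theory.
Import numFieldNormedType.Exports.

Local Open Scope classical_set_scope.
Local Open Scope ring_scope.

Section hyperbolic_functions.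
Context {R : realType}.
Implicit Types x : R.

Definition sinh x : R := (expR x - expR (- x)) / 2.
Definition cosh x : R := (expR x + expR (- x)) / 2.
Definition tanh x : R := sinh x / cosh x.
Definition arcosh x : R := ln (x + Num.sqrt (x ^+ 2 - 1)).

Lemma cosh_gt0 x : 0 < cosh x.
Proof. by rewrite divr_gt0// addr_gt0// expR_gt0. Qed.

Lemma cosh_sqr x : cosh x ^+ 2 = 1 + sinh x ^+ 2.
Proof.
have h : expR x * expR (- x) = 1 by rewrite -expRD subrr expR0.
rewrite /cosh /sinh; apply/eqP; rewrite -subr_eq0; apply/eqP.
rewrite [LHS](_ : _ = expR x * expR (- x) - 1); last by field.
by rewrite h subrr.
Qed.

Lemma expRE_cosh x : expR x = cosh x + sinh x.
Proof. by rewrite /cosh /sinh; field. Qed.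

Lemma expR_half2 x : expR x = expR (x / 2) ^+ 2.
Proof. by rewrite expr2 -expRD; congr expR; field. Qed.

Lemma cosh_half x : cosh x = 1 + 2 * sinh (x / 2) ^+ 2.
Proof.
have h : expR (x / 2) * expR (- (x / 2)) = 1 by rewrite -expRD subrr expR0.
rewrite /cosh /sinh expR_half2 (expR_half2 (- x)) mulNr.
apply/eqP; rewrite -subr_eq0; apply/eqP.
rewrite [LHS](_ : _ = expR (x / 2) * expR (- (x / 2)) - 1); last by field.
by rewrite h subrr.
Qed.

Lemma sinh_half x : sinh x = 2 * sinh (x / 2) * cosh (x / 2).
Proof.
by rewrite /cosh /sinh expR_half2 (expR_half2 (- x)) mulNr; field.
Qed.

Lemma sinh_ge0 x : 0 <= x -> 0 <= sinh x.
Proof.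
by move=> x0; rewrite divr_ge0// subr_ge0 ler_expR; lra.
Qed.

Lemma cosh_ge1 x : 1 <= cosh x.
Proof. by rewrite cosh_half lerDl mulr_ge0// sqr_ge0. Qed.

Lemma arcosh_cosh x : 0 <= x -> arcosh (cosh x) = x.
Proof.
move=> x0; rewrite /arcosh cosh_sqr addrAC subrr add0r sqrtr_sqr.
by rewrite ger0_norm ?sinh_ge0// -expRE_cosh expRK.
Qed.

Lemma cosh_arcosh x : 1 <= x -> cosh (arcosh x) = x.
Proof.
move=> x1; rewrite /cosh /arcosh.
set s := Num.sqrt _.
have s0 : 0 <= s by exact: sqrtr_ge0.
have s2 : s ^+ 2 = x ^+ 2 - 1 by rewrite sqr_sqrtr//; nra.
have xs0 : 0 < x + s by lra.
rewrite expRN lnK ?posrE//.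
have xs : (x + s) * (x - s) = 1.
  by rewrite mulrC -subr_sqr s2; ring.
suff -> : (x + s)^-1 = x - s by field.
by apply: (mulfI (lt0r_neq0 xs0)); rewrite mulfV ?gt_eqF.
Qed.

End hyperbolic_functions.

Section poincare_disc.
Context {R : realType}.
Implicit Types z w : R * R.

(* The point x + iy of the Poincare disc is the pair (x, y). *)
Definition sqnorm w : R := w.1 ^+ 2 + w.2 ^+ 2.

(* Distance of the metric 4 |dw|^2 / (1 - |w|^2)^2; only meaningful for z and w
   in the open unit disc. *)
Definition hdist z w : R :=
  arcosh (1 + 2 * sqnorm (z.1 - w.1, z.2 - w.2)
              / ((1 - sqnorm z) * (1 - sqnorm w))).

Definition hradius w : R := hdist (0, 0) w.

(* The point with polar coordinates (r, theta): r is the hyperbolic distance to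
   the origin, so the Euclidean modulus is tanh (r / 2). *)
Definition polar (p : R * R) : R * R :=
  (tanh (p.1 / 2) * cos p.2, tanh (p.1 / 2) * sin p.2).

Lemma sqnorm_polar r t : 1 - sqnorm (polar (r, t)) = (cosh (r / 2) ^+ 2)^-1.
Proof.
have c0 : cosh (r / 2) != 0 by rewrite gt_eqF// cosh_gt0.
have := cosh_sqr (r / 2); have := cos2Dsin2 t.
rewrite /sqnorm /polar /tanh /=.
move: (cosh (r / 2)) (sinh (r / 2)) c0 (cos t) (sin t) => C S C0 c i Ht HC.
rewrite [LHS](_ : _ = 1 - S ^+ 2 / C ^+ 2 * (c ^+ 2 + i ^+ 2)); last by field.
have -> : S ^+ 2 = C ^+ 2 - 1 by rewrite HC addrAC subrr add0r.
by rewrite Ht; field.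
Qed.

Lemma polar_disc p : sqnorm (polar p) < 1.
Proof.
case: p => r t; rewrite -subr_gt0 sqnorm_polar invr_gt0.
by rewrite exprn_gt0// cosh_gt0.
Qed.

Lemma hyperbolic_cosine_law r t s b :
  cosh (hdist (polar (r, t)) (polar (s, b))) =
  cosh r * cosh s - sinh r * sinh s * cos (t - b).
Proof.
have cr0 : cosh (r / 2) != 0 by rewrite gt_eqF// cosh_gt0.
have cs0 : cosh (s / 2) != 0 by rewrite gt_eqF// cosh_gt0.
rewrite /hdist cosh_arcosh; last first.
  rewrite lerDl divr_ge0// ?mulr_ge0// ?subr_ge0 ?(ltW (polar_disc _))//.
  by rewrite addr_ge0// sqr_ge0.
rewrite !sqnorm_polar (cosh_half r) (cosh_half s) (sinh_half r) (sinh_half s).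
rewrite cosB -invfM invrK.
have := cosh_sqr (r / 2); have := cosh_sqr (s / 2).
have := cos2Dsin2 t; have := cos2Dsin2 b.
rewrite /sqnorm /polar /tanh /=.
move: (cosh (r / 2)) (cosh (s / 2)) cr0 cs0 => C D C0 D0.
move: (sinh (r / 2)) (sinh (s / 2)) => S U.
move: (cos t) (sin t) (cos b) (sin b) => c i d j Hb Ht HU HS.
rewrite [LHS](_ : _ = 1 + 2 * (S ^+ 2 * D ^+ 2 * (c ^+ 2 + i ^+ 2)
  + U ^+ 2 * C ^+ 2 * (d ^+ 2 + j ^+ 2)
  - 2 * S * U * C * D * (c * d + i * j))); last by field; rewrite ?C0 ?D0.
by rewrite Hb Ht HU HS; ring.
Qed.

Lemma hradius_polar r t : 0 <= r -> hradius (polar (r, t)) = r.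
Proof.
move=> r0; rewrite /hradius.
have -> : (0, 0) = polar (0, 0).
  have t0 : tanh (0 / 2) = 0 :> R by rewrite /tanh /sinh mul0r oppr0 subrr !mul0r.
  by rewrite /polar /= t0 !mul0r.
have := hyperbolic_cosine_law 0 0 r t.
have cosh0 : cosh (0 : R) = 1 by rewrite /cosh oppr0 expR0; field.
have sinh0 : sinh (0 : R) = 0 by rewrite /sinh oppr0 subrr mul0r.
rewrite cosh0 sinh0 !mul0r mul1r subr0 => h.
have d0 : 0 <= hdist (polar (0, 0)) (polar (r, t)).
  rewrite ln_ge0// -[leLHS]addr0 lerD ?sqrtr_ge0//.
  rewrite lerDl divr_ge0// ?mulr_ge0// ?subr_ge0 ?(ltW (polar_disc _))//.
  by rewrite addr_ge0// sqr_ge0.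
by rewrite -(arcosh_cosh d0) h arcosh_cosh.
Qed.

End poincare_disc.

Section node_law.
Context {R : realType} (alpha : R).
Notation mu := (@lebesgue_measure R).

Definition disc_radius (nu : R) (n : nat) : R := 2 * ln (n%:R / nu).

Definition radial_pdf (rad : R) : R -> R :=
  (fun r => alpha * sinh (alpha * r) / (cosh (alpha * rad) - 1)) \_ `[0, rad[.

Definition radial_law (rad : R) (A : set R) : \bar R :=
  (\int[mu]_(r in A) (radial_pdf rad r)%:E)%E.

Lemma radial_pdf_ge0 rad r : 0 <= radial_pdf rad r.
Proof.
apply: restrict_ge0 => {}r; rewrite /= in_itv/= => /andP[r0 _].
rewrite divr_ge0// ?subr_ge0 ?cosh_ge1//.
have [a0|/ltW a0] := leP 0 alpha; first by rewrite mulr_ge0// sinh_ge0 ?mulr_ge0.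
have -> : sinh (alpha * r) = - sinh (- alpha * r).
  by rewrite /sinh mulNr opprK; field.
by rewrite mulrN -mulNr mulr_ge0 ?oppr_ge0// sinh_ge0// mulr_ge0// oppr_ge0.
Qed.

Lemma continuous_radial_density rad :
  continuous (fun r : R => alpha * sinh (alpha * r) / (cosh (alpha * rad) - 1)).
Proof.
move=> x; apply: cvgMl; apply: cvgMr; apply: cvgMl; apply: cvgB.
  by apply: continuous_comp; [exact: mulrl_continuous|exact: continuous_expR].
apply: continuous_comp; last exact: continuous_expR.
by apply: cvgN; exact: mulrl_continuous.
Qed.

Lemma measurable_radial_pdf rad : measurable_fun [set: R] (radial_pdf rad).
Proof.
apply/measurable_restrict => //; apply: measurable_funTS.
by apply: continuous_measurable_fun; exact: continuous_radial_density.
Qed.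

Let radial_law0 rad : radial_law rad set0 = 0%E.
Proof. by rewrite /radial_law integral_set0. Qed.

Let radial_law_ge0 rad A : (0 <= radial_law rad A)%E.
Proof. by apply: integral_ge0 => x _; rewrite lee_fin radial_pdf_ge0. Qed.

Let radial_law_sigma_additive rad : semi_sigma_additive (radial_law rad).
Proof.
move=> /= F mF tF mUF; rewrite /radial_law; apply: cvg_toP.
  apply: ereal_nondecreasing_is_cvgn => m n mn.
  apply: lee_sum_nneg_natr => // k _ _; exact: radial_law_ge0.
rewrite ge0_integral_bigcup//=.
- by apply/measurable_funTS/measurableT_comp => //; exact: measurable_radial_pdf.
- by move=> x _; rewrite lee_fin radial_pdf_ge0.
Qed.

HB.instance Definition _ rad := isMeasure.Build _ _ _
  (radial_law rad) (radial_law0 rad) (@radial_law_ge0 rad)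
  (@radial_law_sigma_additive rad).

Lemma radial_law_setT rad : 0 < alpha -> 0 < rad ->
  radial_law rad [set: R] = 1%E.
Proof.
move=> a0 rad0.
have c1 : 0 < cosh (alpha * rad) - 1.
  rewrite (cosh_half (alpha * rad)) addrAC subrr add0r mulr_gt0// exprn_gt0//.
  by rewrite divr_gt0// subr_gt0 ltr_expR; have := mulr_gt0 a0 rad0; lra.
pose f r : R := alpha * sinh (alpha * r) / (cosh (alpha * rad) - 1).
pose F r : R := cosh (alpha * r) / (cosh (alpha * rad) - 1).
have mf D : measurable_fun D (EFin \o f).
  apply/measurable_EFinP/measurable_funTS; apply: continuous_measurable_fun.
  exact: continuous_radial_density.
have dF (x : R) : is_derive x (1 : R) F (f x).
  rewrite /F /f; move: (cosh (alpha * rad) - 1) c1 => K K0.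
  rewrite /cosh; apply: is_derive_eq.
  by rewrite /sinh /GRing.scale/=; field; rewrite gt_eqF.
have cF : continuous F.
  by move=> x; apply: differentiable_continuous; apply/derivable1_diffP.
transitivity (\int[mu]_(r in `[0%R, rad[) (f r)%:E)%E.
  rewrite [RHS]integral_mkcond; apply: eq_integral => r _.
  by rewrite /radial_pdf !patchE; case: ifP.
rewrite integral_itv_bndo_bndc// (@continuous_FTC2 _ f F)//.
- rewrite -EFinB /F -mulrBl mulr0 (_ : cosh 0 = 1) ?mulfV ?gt_eqF//.
  by rewrite /cosh oppr0 expR0; field.
- apply: continuous_subspaceT; exact: continuous_radial_density.
- split; first by move=> x _; exact: ex_derive.
  + by apply: cvg_at_right_filter; exact: cF.
  + by apply: cvg_at_left_filter; exact: cF.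
- by move=> x _; rewrite derive1E; exact: derive_val.
Qed.

Lemma lt_Npi_pi : - pi < pi :> R.
Proof. by have := pi_gt0 R; lra. Qed.

(* [uniform_prob] is uniform on the closed interval [-pi, pi], which is the same
   measure as on (-pi, pi]. *)
Definition node_law (rad : R) : set (R * R) -> \bar R :=
  pushforward (radial_law rad \x uniform_prob lt_Npi_pi)%E polar.

End node_law.

Section random_hyperbolic_graph.
Context {R : realType}.

Definition mutually_independent {n d d'} {T : measurableType d}
    {T' : measurableType d'} (P : probability T R)
    (X : 'I_n -> {RV P >-> T'}) : Prop :=
  forall (J : {set 'I_n}) (A : 'I_n -> set T'),
    (forall i, measurable (A i)) ->
    P (\bigcap_(i in [set` J]) (X i @^-1` A i)) =
    (\prod_(i in J) P (X i @^-1` A i))%E.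

Definition iid_nodes (alpha nu : R) {n d} {T : measurableType d}
    (P : probability T R) (X : 'I_n -> {RV P >-> (R * R)%type}) : Prop :=
  mutually_independent X /\
  forall (i : 'I_n) (A : set (R * R)), measurable A ->
    distribution P (X i) A = node_law alpha (disc_radius nu n) A.

Definition adjacent (nu : R) {n} (x : 'I_n -> R * R) : rel 'I_n :=
  [rel i j | (i != j) && (hdist (x i) (x j) <= disc_radius nu n)].

Definition degree (nu : R) {n} (x : 'I_n -> R * R) (i : 'I_n) : nat :=
  #|[set j | adjacent nu x i j]%SET|.

Definition radius_ordering {n} (x : 'I_n -> R * R) (s : 'S_n) : Prop :=
  forall i j : 'I_n, (i <= j)%N -> hradius (x (s i)) <= hradius (x (s j)).

(* Ranks are 0-based: x (s j) is the node of rank j + 1, so "rank > k" is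
   k <= i and "rank at most k" is j < k. In case of ties (a null event for
   [iid_nodes]) the chain is required for every radius ordering. *)
Definition top_degrees_ordered (nu : R) (k : nat) {n} (x : 'I_n -> R * R) : Prop :=
  forall s : 'S_n, radius_ordering x s ->
  forall i : 'I_n, (k <= i)%N ->
    (forall j l : 'I_n, l = j.+1 :> nat -> (l < k)%N ->
       (degree nu x (s l) < degree nu x (s j))%N) /\
    (forall j : 'I_n, j.+1 = k -> (degree nu x (s i) < degree nu x (s j))%N).

End random_hyperbolic_graph.

(* Main.v *)
Require Import Defs.
From HB Require Import structures.
From mathcomp Require Import all_boot all_order all_algebra perm.
From mathcomp Require Import all_classical all_reals all_analysis measurable_realfun.
From mathcomp Require Import ring lra.

Set Implicit Arguments.
Unset Strict Implicit.
Unset Printing Implicit Defensive.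

Import Order.TTheory GRing.Theory Num.Theory.
Import numFieldNormedType.Exports.

Local Open Scope classical_set_scope.
Local Open Scope ring_scope.

(** Only the radius of a node matters for its expected degree. Let [conn r] be
    the probability that a random node lies within distance R_n of a point at
    radius r. Three facts give the theorem.
    - The k smallest radii live on the scale where the radial distribution
      function is of order 1/n. Cutting this scale into finitely many levels
      (the quantiles [m * delta / n]), no window of two consecutive cells
      contains two nodes, except with small probability: the k innermost nodes
      and all the others are then pairwise separated by a whole cell.
    - If r < r' are two consecutive levels then [n * (conn r - conn r')^2 / conn r]
      grows like a positive power of n, whatever [alpha > 0] is, so that a
      Chernoff bound beats any polynomial number of events.
    - For a point y of the disc of radius R_n, being at distance at most R_n from
      the point of Euclidean polar coordinates (t, theta) gets harder when t
      grows, at a speed which also absorbs a change of theta: it suffices to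
      compare t' and t when |theta - theta'| <= t' - t. Hence all nodes below
      (above) a level are controlled by the balls centred on a polynomially fine
      net of a circle. These balls are deterministic, so no conditioning on the
      position of a node is needed. *)

(** * Hyperbolic and trigonometric estimates *)

(** Since [n = nu * exp (R_n / 2)], every exponential in R_n is a power of n. A net of order exp (2
    * R_n), that is (n / nu)^4, is therefore affordable once a single deviation has probability at
    most exp (- c * exp (e * R_n)). The quantity n * (conn r - conn r')^2 / conn r is the squared
    difference of two expected counts over the variance scale n * conn r, hence the exponent of the
    Chernoff bound. Replacing a node by a net point costs some radius, so two auxiliary levels are
    inserted in each cell: the outer thirds pay for the change of direction, the middle third
    carries the gap in probability. The sign of alpha - 1/2 decides whether the innermost radii tend
    to infinity or to 0. Bounds in min (A, 1), where A = sinh (alpha * r / 2), treat both regimes at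
    once. Order of choice: the error eps, the expected number K of nodes below the last level, the
    number M of cells, and n last. *)

Section hyperbolic_estimates.
Context {R : realType}.
Implicit Types x y : R.

Lemma sinhB x y : sinh (x - y) = sinh x * cosh y - cosh x * sinh y.
Proof. by rewrite /sinh /cosh opprB !expRD; field. Qed.

Lemma sinhD x y : sinh (x + y) = sinh x * cosh y + cosh x * sinh y.
Proof. by rewrite /sinh /cosh opprD !expRD; field. Qed.

Lemma expR_shift_ge x y : expR x * (1 + (y - x)) <= expR y.
Proof.
have -> : expR y = expR x * expR (y - x) by rewrite -expRD; congr expR; ring.
by rewrite ler_pM2l ?expR_gt0// expR_ge1Dx.
Qed.

(** Convexity of [cosh], as half the sum of the tangent bounds of [expR] at [x] and at [- x]. *)
Lemma cosh_ge_tangent x y : cosh x + (y - x) * sinh x <= cosh y.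
Proof.
have h1 := expR_shift_ge x y; have h2 := expR_shift_ge (- x) (- y).
rewrite /cosh /sinh; lra.
Qed.

Lemma ler_cosh x y : 0 <= x -> x <= y -> cosh x <= cosh y.
Proof.
move=> x0 xy; apply: le_trans (cosh_ge_tangent x y).
by rewrite lerDl mulr_ge0 ?subr_ge0// sinh_ge0.
Qed.

Lemma sinh_gt0 x : 0 < x -> 0 < sinh x.
Proof. by move=> x0; rewrite divr_gt0// subr_gt0 ltr_expR; lra. Qed.

Lemma sinh_half_ge x : 0 <= x -> x / 2 <= sinh x.
Proof.
move=> x0; rewrite /sinh ler_pM2r//.
have e1 := expR_ge1Dx x.
have : expR (- x) <= (1 + x)^-1.
  by rewrite expRN lef_pV2 ?posrE ?expR_gt0//; lra.
have : (1 + x)^-1 <= 1 by rewrite invf_le1; lra.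
lra.
Qed.

Lemma ltr_sinh x y : x < y -> sinh x < sinh y.
Proof.
move=> xy; have h1 : expR x < expR y by rewrite ltr_expR.
have h2 : expR (- y) < expR (- x) by rewrite ltr_expR; lra.
rewrite /sinh; lra.
Qed.

Lemma ler_sinh x y : x <= y -> sinh x <= sinh y.
Proof. by rewrite le_eqVlt => /orP[/eqP->//|/ltr_sinh/ltW]. Qed.

Lemma ltr_cosh x y : 0 <= x -> x < y -> cosh x < cosh y.
Proof.
move=> x0 xy; rewrite (cosh_half x) (cosh_half y) ltrD2l ltr_pM2l//.
by rewrite ltrXn2r// ?sinh_ge0 ?ltr_sinh// ?divr_ge0; lra.
Qed.

Lemma cosh_le x y : 0 <= x -> 0 <= y -> (cosh x <= cosh y) = (x <= y).
Proof.
move=> x0 y0; apply/idP/idP => [|xy]; last exact: ler_cosh.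
by apply: contraTT; rewrite -!ltNge; exact: ltr_cosh.
Qed.

Lemma sinhB_le x y : 0 <= x -> x <= y -> sinh y - sinh x <= (y - x) * expR y.
Proof.
move=> x0 xy.
have h1 := expR_shift_ge y x; have h2 := expR_shift_ge (- x) (- y).
have h3 : expR (- x) <= expR y by rewrite ler_expR; lra.
have : (y - x) * expR (- x) <= (y - x) * expR y.
  by rewrite ler_wpM2l// subr_ge0.
rewrite /sinh; lra.
Qed.

Lemma expR_le_sinh x : 0 <= x -> expR x <= 1 + 2 * sinh x.
Proof.
move=> x0; have : expR (- x) <= 1 by rewrite -expR0 ler_expR; lra.
rewrite /sinh; lra.
Qed.

Lemma sinh_le_expR x : 2 * sinh x <= expR x.
Proof. by have := expR_gt0 (- x); rewrite /sinh; lra. Qed.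

Lemma expR_le_cosh x : expR x <= 2 * cosh x.
Proof. by have := expR_gt0 (- x); rewrite /cosh; lra. Qed.

Lemma cosh_le_expR x : 0 <= x -> cosh x <= expR x.
Proof.
move=> x0; have : expR (- x) <= expR x by rewrite ler_expR; lra.
rewrite /cosh; lra.
Qed.

Lemma sinh_lt_cosh x : sinh x < cosh x.
Proof. by have := expR_gt0 (- x); rewrite /sinh /cosh; lra. Qed.

Lemma tanh_lt1 x : tanh x < 1.
Proof. by rewrite /tanh ltr_pdivrMr ?cosh_gt0// mul1r sinh_lt_cosh. Qed.

Lemma tanh_ge0 x : 0 <= x -> 0 <= tanh x.
Proof. by move=> x0; rewrite divr_ge0 ?sinh_ge0// ltW ?cosh_gt0. Qed.

Lemma tanh_gt0 x : 0 < x -> 0 < tanh x.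
Proof. by move=> x0; rewrite divr_gt0 ?sinh_gt0// cosh_gt0. Qed.

Lemma tanhE x : tanh x = (1 - expR (- (2 * x))) / (1 + expR (- (2 * x))).
Proof.
rewrite /tanh /sinh /cosh.
have -> : expR (- (2 * x)) = expR (- x) * expR (- x).
  by rewrite -expRD; congr expR; ring.
have e0 := expR_gt0 x; have f0 := expR_gt0 (- x).
have h : expR (- x) = (expR x)^-1 by rewrite expRN.
have s0 : expR x + (expR x)^-1 != 0 by rewrite gt_eqF// addr_gt0// invr_gt0.
rewrite h; move: (expR x) e0 s0 => E E0 s0.
by field; rewrite ?gt_eqF// !addr_gt0// ?mulr_gt0.
Qed.

Lemma tanh_le x : 0 <= x -> tanh x <= 2 * x.
Proof.
move=> x0; rewrite tanhE; have := expR_gt0 (- (2 * x)) => e0.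
rewrite ler_pdivrMr; last by rewrite addr_gt0.
have := expR_ge1Dx (- (2 * x)); nra.
Qed.

Lemma tanhB x y : tanh y - tanh x = sinh (y - x) / (cosh x * cosh y).
Proof.
rewrite /tanh sinhB; have := cosh_gt0 x; have := cosh_gt0 y => h1 h2.
by field; rewrite !gt_eqF.
Qed.

Lemma ltr_tanh x y : x < y -> tanh x < tanh y.
Proof.
move=> xy; rewrite -subr_gt0 tanhB; apply: divr_gt0; last by rewrite mulr_gt0 ?cosh_gt0.
by rewrite sinh_gt0// subr_gt0.
Qed.

Lemma ler_tanh x y : x <= y -> tanh x <= tanh y.
Proof. by rewrite le_eqVlt => /orP[/eqP->//|/ltr_tanh/ltW]. Qed.

Lemma tanh_sqr x : 1 - tanh x ^+ 2 = (cosh x ^+ 2)^-1.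
Proof.
have := cosh_sqr x; have := cosh_gt0 x => c0 cs.
have -> : tanh x ^+ 2 = (cosh x ^+ 2 - 1) / cosh x ^+ 2.
  by rewrite cs addrAC subrr add0r -cs -expr_div_n.
by field; rewrite gt_eqF.
Qed.

Lemma tanh_half_lb x : 1 <= x -> 1 / 3 <= tanh (x / 2).
Proof.
move=> x1; rewrite tanhE (_ : 2 * (x / 2) = x); last by field.
have e0 := expR_gt0 (- x).
have : expR (- x) <= 1 / 2.
  rewrite expRN -[leRHS]invrK lef_pV2 ?posrE ?expR_gt0//.
  by have := expR_ge1Dx x; lra.
by move=> h; rewrite ler_pdivlMr; lra.
Qed.

End hyperbolic_estimates.

Section trigonometric_estimates.
Context {R : realType}.
Implicit Types x y : R.

Lemma sinB_MVT x y : x <= y -> exists2 z, x <= z <= y & sin y - sin x = cos z * (y - x).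
Proof.
move=> xy; have [|z zin ->] := @MVT_segment R sin cos x y xy.
  by apply: continuous_subspaceT; exact: continuous_sin.
by exists z; rewrite // -in_itv.
Qed.

Lemma cosB_MVT x y : x <= y -> exists2 z, x <= z <= y & cos x - cos y = sin z * (y - x).
Proof.
move=> xy; have [|z zin h] := @MVT_segment R cos (fun z => - sin z) x y xy.
  by apply: continuous_subspaceT; exact: continuous_cos.
by exists z; rewrite -?in_itv// -opprB h mulNr opprK.
Qed.

Lemma norm_sin_le x : `|sin x| <= `|x|.
Proof.
wlog x0 : x / 0 <= x.
  move=> H; have [/H//|x0] := leP 0 x.
  by rewrite -normrN -sinN -(normrN x) H; lra.
have [z _] := sinB_MVT x0; rewrite sin0 !subr0 => ->.
by rewrite normrM ler_piMl// cos_max.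
Qed.

Lemma oneBcos x : 1 - cos x = 2 * sin (x / 2) ^+ 2.
Proof.
rewrite {1}(_ : x = (x / 2) *+ 2); last by rewrite -mulr_natr divfK.
by rewrite cos_mulr2n cos2sin2 -mulr_natr; ring.
Qed.

Lemma oneBcos_le x : 1 - cos x <= x ^+ 2 / 2.
Proof.
rewrite oneBcos -[sin _ ^+ 2]real_normK ?num_real//.
have h : `|sin (x / 2)| ^+ 2 <= `|x / 2| ^+ 2.
  by rewrite lerXn2r ?nnegrE// norm_sin_le.
by move: h; rewrite [`|x / 2| ^+ 2]real_normK ?num_real// => h; lra.
Qed.

(** A weak Jordan inequality. On [0, 1] the derivative of [sin] is at least 1/2; beyond 1, [sin]
    increases while [x / 4] stays below 1/2 because pi / 2 < 2. *)
Lemma sin_ge_quarter x : 0 <= x -> x <= pi / 2 -> x / 4 <= sin x.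
Proof.
have small (z : R) : 0 <= z -> z <= 1 -> z / 2 <= sin z.
  move=> z0 z1; have [t /andP[t0 tz]] := sinB_MVT z0.
  rewrite sin0 !subr0 => ->; rewrite mulrC ler_wpM2r//.
  by have := oneBcos_le t; nra.
move=> x0 xpi; have [x1|/ltW x1] := leP x 1.
  by apply: le_trans (small _ x0 x1); lra.
have := small _ ler01 (lexx 1).
have : sin 1 <= sin x.
  have [->//|nx] := eqVneq 1 x.
  have pi2 := pihalf_ge1 R.
  rewrite ltW// ltr_sin ?in_itv/=; [by rewrite lt_neqAle nx| |]; apply/andP; split; lra.
by have := pihalf_lt2 R; lra.
Qed.

Lemma oneBcos_ge x : 0 <= x -> x <= pi -> x ^+ 2 / 32 <= 1 - cos x.
Proof.
move=> x0 xpi; rewrite oneBcos.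
have := @sin_ge_quarter (x / 2); nra.
Qed.

(** Mean value theorem for [cos] between the two angles: at the intermediate angle z one has cos z
    >= a, so sin z ^ 2 <= 2 * (1 - a). The square root is the gain when both cosines are close to
    1. *)
Lemma acosB_ge (a b : R) : -1 <= a -> a < b -> b <= 1 ->
  (b - a) / Num.sqrt (2 * (1 - a)) <= acos a - acos b.
Proof.
move=> a1 ab b1.
have ain : -1 <= a <= 1 by apply/andP; split; lra.
have bin : -1 <= b <= 1 by apply/andP; split; lra.
have Ka : cos (acos a) = a by rewrite acosK// in_itv.
have Kb : cos (acos b) = b by rewrite acosK// in_itv.
have pa : acos a \in `[0, pi] by rewrite in_itv/= acos_ge0// acos_lepi.
have pb : acos b \in `[0, pi] by rewrite in_itv/= acos_ge0// acos_lepi.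
have lt : acos b < acos a by rewrite -ltr_cos// Ka Kb.
have [z /andP[bz za]] := cosB_MVT (ltW lt); rewrite Ka Kb => e.
have za1 : a <= cos z.
  move: za; rewrite le_eqVlt => /orP[/eqP->|za]; first by rewrite Ka.
  rewrite -{1}Ka ltW// ltr_cos//.
  move: pa pb; rewrite !in_itv/= => /andP[? ?] /andP[? ?]; apply/andP; split; lra.
have s : sin z <= Num.sqrt (2 * (1 - a)).
  rewrite (le_trans (ler_norm _))// -sqrtr_sqr ler_wsqrtr// sin2cos2.
  have := cos_le1 z; nra.
rewrite ler_pdivrMr ?sqrtr_gt0 ?mulr_gt0 ?subr_gt0//; last by lra.
by rewrite e mulrC ler_wpM2l// subr_ge0 ltW.
Qed.

Lemma polar_angle (a b : R) : exists2 t, - pi <= t <= pi &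
  a = Num.sqrt (a ^+ 2 + b ^+ 2) * cos t /\ b = Num.sqrt (a ^+ 2 + b ^+ 2) * sin t.
Proof.
have [r0|r0] := eqVneq (a ^+ 2 + b ^+ 2) 0.
  have pi0 := pi_gt0 R.
  exists 0; first by apply/andP; split; lra.
  by rewrite r0 sqrtr0 !mul0r; nra.
set r := Num.sqrt _.
have rr : r ^+ 2 = a ^+ 2 + b ^+ 2 by rewrite sqr_sqrtr// addr_ge0 ?sqr_ge0.
have rp : 0 < r by rewrite sqrtr_gt0 lt_neqAle eq_sym r0 addr_ge0 ?sqr_ge0.
have ar : -1 <= a / r <= 1.
  rewrite ler_pdivrMr// ler_pdivlMr// mulN1r mul1r -ler_norml.
  by rewrite -ler_sqr ?nnegrE ?(ltW rp)// real_normK ?num_real// rr lerDl sqr_ge0.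
have sE : sin (acos (a / r)) = `|b| / r.
  rewrite sin_acos// (_ : 1 - _ = (b / r) ^+ 2).
    by rewrite sqrtr_sqr normrM (@gtr0_norm _ r^-1) ?invr_gt0.
  have bE : b ^+ 2 = r ^+ 2 - a ^+ 2 by rewrite rr; ring.
  by rewrite !expr_div_n bE; field; rewrite gt_eqF.
have h0 := acos_ge0 ar; have hpi := acos_lepi ar.
have [b0|/ltW b0] := leP 0 b.
  exists (acos (a / r)); first by apply/andP; split=> //; have := pi_gt0 R; lra.
  rewrite acosK ?in_itv//= sE ger0_norm//.
  by split; field; rewrite gt_eqF.
exists (- acos (a / r)); first by apply/andP; split; have := pi_gt0 R; lra.
rewrite cosN sinN acosK ?in_itv//= sE ler0_norm//.
by split; field; rewrite gt_eqF.
Qed.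

End trigonometric_estimates.

(** * Hyperbolic balls as polynomial inequalities *)

Section ball_geometry.
Context {R : realType}.
Implicit Types (z w y u : R * R) (rad : R).

Lemma sqnorm_ge0 w : 0 <= sqnorm w.
Proof. by rewrite addr_ge0 ?sqr_ge0. Qed.

Lemma hdist_ge0 z w : sqnorm z < 1 -> sqnorm w < 1 -> 0 <= hdist z w.
Proof.
move=> z1 w1; rewrite ln_ge0// -[leLHS]addr0 lerD ?sqrtr_ge0//.
by rewrite lerDl divr_ge0// ?mulr_ge0// ?subr_ge0 ?(ltW z1) ?(ltW w1) ?sqnorm_ge0.
Qed.

Lemma cosh_hdist z w : sqnorm z < 1 -> sqnorm w < 1 ->
  cosh (hdist z w) = 1 + 2 * sqnorm (z.1 - w.1, z.2 - w.2)
                         / ((1 - sqnorm z) * (1 - sqnorm w)).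
Proof.
move=> z1 w1; rewrite cosh_arcosh// lerDl divr_ge0// ?mulr_ge0// ?subr_ge0.
- exact: sqnorm_ge0.
- exact: ltW.
- exact: ltW.
Qed.

(** The condition [hdist z y <= rad] with [cosh rad - 1 = 2 * sinh (rad / 2) ^+ 2] inserted and
    denominators cleared: it is polynomial in the coordinates. *)
Definition in_hball rad z y :=
  sqnorm (z.1 - y.1, z.2 - y.2) <=
    sinh (rad / 2) ^+ 2 * ((1 - sqnorm z) * (1 - sqnorm y)).

Lemma hdist_le rad z w : 0 <= rad -> sqnorm z < 1 -> sqnorm w < 1 ->
  (hdist z w <= rad) = in_hball rad z w.
Proof.
move=> r0 z1 w1; rewrite -cosh_le ?hdist_ge0// cosh_hdist// (cosh_half rad).
rewrite lerD2l -mulrA ler_pM2l// ler_pdivrMr//.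
by rewrite mulr_gt0// subr_gt0.
Qed.

Lemma cosh_hradius w : sqnorm w < 1 ->
  cosh (hradius w) = 1 + 2 * (sqnorm w / (1 - sqnorm w)).
Proof.
move=> w1; rewrite /hradius cosh_hdist//; last first.
  by rewrite /sqnorm /= expr0n /= addr0.
rewrite /sqnorm /= !sub0r !sqrrN !expr0n /= !addr0 subr0 mul1r -mulrA //.
Qed.

Lemma hradius_le z w : sqnorm z < 1 -> sqnorm w < 1 ->
  (hradius z <= hradius w) = (sqnorm z <= sqnorm w).
Proof.
move=> z1 w1; have o1 : sqnorm (0, 0) < 1 :> R by rewrite /sqnorm /= expr0n /= addr0.
rewrite -cosh_le ?hdist_ge0// !cosh_hradius// lerD2l ler_pM2l//.
rewrite ler_pdivrMr ?subr_gt0// mulrAC ler_pdivlMr ?subr_gt0//.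
by rewrite !mulrBr !mulr1 (mulrC (sqnorm w)) lerD2r.
Qed.

(* The perturbation of the direction is absorbed by the change of modulus. *)
Lemma in_hball_dominated rad (t t' : R) u u' y :
  sqnorm u = 1 -> sqnorm u' = 1 -> 0 <= t ->
  sqnorm (u.1 - u'.1, u.2 - u'.2) <= (t' - t) ^+ 2 -> t <= t' ->
  sqnorm y <= 1 -> sqnorm y <= sinh (rad / 2) ^+ 2 * (1 - sqnorm y) ->
  in_hball rad (t' * u'.1, t' * u'.2) y -> in_hball rad (t * u.1, t * u.2) y.
Proof.
case: u => u1 u2; case: u' => v1 v2; case: y => y1 y2; rewrite /in_hball /sqnorm /=.
move: (sinh _ ^+ 2) => K hu hv t0 huv tt' hy hk.
set k := K * (1 - (y1 ^+ 2 + y2 ^+ 2)) in hk.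
set e := k - (y1 ^+ 2 + y2 ^+ 2).
(* This is the hypothesis that the origin lies within distance [rad] of [y]. *)
have e0 : 0 <= e by rewrite /e; lra.
set p := v1 * y1 + v2 * y2.
(* Along a fixed direction, membership is a quadratic inequality in the modulus [s]. *)
have hR (s a b : R) : a ^+ 2 + b ^+ 2 = 1 ->
  ((s * a - y1) ^+ 2 + (s * b - y2) ^+ 2 <=
   K * ((1 - ((s * a) ^+ 2 + (s * b) ^+ 2)) * (1 - (y1 ^+ 2 + y2 ^+ 2)))) =
  ((1 + k) * s ^+ 2 - 2 * s * (a * y1 + b * y2) <= e).
  move=> ab; rewrite -subr_ge0 -[RHS]subr_ge0; congr (_ <= _).
  rewrite /e /k.
  have -> : (s * a) ^+ 2 + (s * b) ^+ 2 = s ^+ 2 by rewrite !exprMn -mulrDr ab mulr1.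
  have -> : (s * a - y1) ^+ 2 + (s * b - y2) ^+ 2 =
    s ^+ 2 * (a ^+ 2 + b ^+ 2) - 2 * s * (a * y1 + b * y2) + (y1 ^+ 2 + y2 ^+ 2) by ring.
  by rewrite ab; ring.
rewrite (hR _ _ _ hu) (hR _ _ _ hv) -/p => h.
have [t00|tn0] := eqVneq t 0; first by rewrite t00; nra.
have t'0 : 0 < t' by rewrite (lt_le_trans _ tt')// lt_neqAle eq_sym tn0.
(* Scaling the inequality at t' by t / t' <= 1 is allowed since e >= 0, and leaves a slack of (1 +
   k) * t * (t' - t) over the quadratic at t. *)
have h1 : (1 + k) * t * t' - 2 * t * p <= e.
  have : ((1 + k) * t' ^+ 2 - 2 * t' * p) * (t / t') <= e * (t / t').
    by rewrite ler_wpM2r// divr_ge0// ltW.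
  have -> : ((1 + k) * t' ^+ 2 - 2 * t' * p) * (t / t') = (1 + k) * t * t' - 2 * t * p.
    by field; rewrite gt_eqF.
  move=> /le_trans; apply; rewrite ler_piMr// ler_pdivrMr// mul1r.
  by [].
set q := u1 * y1 + u2 * y2.
have cs : (p - q) ^+ 2 <= (t' - t) ^+ 2 * (y1 ^+ 2 + y2 ^+ 2).
  apply: (@le_trans _ _ (((u1 - v1) ^+ 2 + (u2 - v2) ^+ 2) * (y1 ^+ 2 + y2 ^+ 2))).
    rewrite -subr_ge0 (_ : _ - _ = ((u1 - v1) * y2 - (u2 - v2) * y1) ^+ 2).
      exact: sqr_ge0.
    by rewrite /p /q; ring.
  by rewrite ler_wpM2r// addr_ge0 ?sqr_ge0.
(* The change of direction fits in this slack: by Cauchy-Schwarz |p - q| <= (t' - t) * |y|, and 2 *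
   |y| <= 1 + |y|^2 <= 1 + k. *)
have pq : 2 * (p - q) <= (t' - t) * (1 + k).
  apply: (@le_trans _ _ `|2 * (p - q)|); first exact: ler_norm.
  have k0 : 0 <= 1 + k by have := sqr_ge0 y1; have := sqr_ge0 y2; lra.
  rewrite -ler_sqr ?nnegrE ?mulr_ge0 ?subr_ge0// real_normK ?num_real// !exprMn.
  apply: (@le_trans _ _ (2 ^+ 2 * ((t' - t) ^+ 2 * (y1 ^+ 2 + y2 ^+ 2)))).
    by rewrite ler_wpM2l// ?exprn_ge0.
  rewrite mulrCA ler_wpM2l ?sqr_ge0//.
  move: hk; rewrite -/k => hk; have := sqr_ge0 y1; have := sqr_ge0 y2.
  move: (y1 ^+ 2) (y2 ^+ 2) hk => a b hk a0 b0.
  apply: (@le_trans _ _ ((1 + (a + b)) ^+ 2)); last by rewrite ler_sqr ?nnegrE; lra.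
  by rewrite -subr_ge0 (_ : _ - _ = (1 - (a + b)) ^+ 2) ?sqr_ge0//; ring.
have : t * (2 * (p - q)) <= t * ((t' - t) * (1 + k)) by rewrite ler_wpM2l.
lra.
Qed.

End ball_geometry.

(** * Radial and angular parts of the node law *)

Lemma lebesgue_measure_translation {R : realType} (c : R) (A : set R) :
  measurable A ->
  pushforward lebesgue_measure ((fun x => x + c) : _ -> measurableTypeR R) A =
  lebesgue_measure A.
Proof.
have mc : measurable_fun setT ((fun x => x + c) : R -> measurableTypeR R).
  by apply: (@measurable_funD _ R R) => //.
move=> mA; apply/esym/lebesgue_measure_unique => //= _ [[a b]] _ <-.
rewrite /pushforward.
have -> : (fun x => x + c) @^-1` `]a, b] = `]a - c, b - c]%classic.
  by apply/seteqP; split => x /=; rewrite !in_itv/= ltrBlDr lerBrDr.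
rewrite !lebesgue_measure_itv /= !lte_fin ltrD2r; case: ifP => // _.
by rewrite -!EFinB; congr EFin; ring.
Qed.

Section uniform_angle.
Context {R : realType}.
Notation mu := (@lebesgue_measure R).
Notation unif := (uniform_prob (@lt_Npi_pi R)).

(** The half-open interval is what tiles the line under translation by 2 * pi; the endpoint is a
    null set. *)
Lemma uniform_angleE (A : set R) : measurable A ->
  unif A = (((2 * pi)^-1)%:E * mu (A `&` `[(- pi)%R, pi[%classic))%E.
Proof.
move=> mA; have pi0 := pi_gt0 R.
rewrite /uniform_prob integral_uniform_pdf.
rewrite (eq_integral (fun=> ((2 * pi)^-1)%:E)); last first.
  move=> x; rewrite inE /= in_itv /= => -[_ xp]; rewrite /uniform_pdf xp.
  by congr EFin; congr GRing.inv; ring.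
rewrite integral_cst; last exact: measurableI.
congr (_ * _)%E.
have e : A `&` `[- pi, pi] = (A `&` `[- pi, pi[) `|` (A `&` [set pi]).
  rewrite -setIUr; congr (_ `&` _); apply/seteqP; split => x /=.
    rewrite !in_itv/= => /andP[h1]; rewrite le_eqVlt => /orP[/eqP->|h2]; first by right.
    by left; rewrite h1.
  by rewrite !in_itv/= => -[/andP[-> /ltW]//|->]; apply/andP; split; lra.
rewrite e; apply: measureU0; [exact: measurableI|exact: measurableI|].
apply/eqP; rewrite eq_le measure_ge0 andbT.
rewrite -(lebesgue_measure_set1 (pi : R)) le_measure ?inE//; exact: measurableI.
Qed.

Lemma uniform_angle_ge (A : set R) (a b : R) : measurable A ->
  - pi <= a -> a <= b -> b <= pi -> (forall x, a < x < b -> A x) ->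
  (((b - a) / (2 * pi))%:E <= unif A)%E.
Proof.
move=> mA pa ab bp abA; have pi0 := pi_gt0 R; rewrite uniform_angleE//.
rewrite mulrC EFinM lee_pmul2l ?lte_fin ?invr_gt0 ?mulr_gt0//.
apply: (@le_trans _ _ (mu `]a, b[%classic)).
  rewrite lebesgue_measure_itv /= lte_fin.
  have [ab'|ba] := ltP a b; first by rewrite -EFinB.
  by rewrite lee_fin; lra.
rewrite le_measure ?inE//; first exact: measurableI.
move=> x /=; rewrite !in_itv/= => /andP[h1 h2]; split; first by apply: abA; rewrite h1.
by apply/andP; split; lra.
Qed.

Lemma uniform_angle_le (A : set R) (a b : R) : measurable A -> a <= b ->
  (forall x, - pi <= x <= pi -> A x -> a <= x <= b) ->
  (unif A <= ((b - a) / (2 * pi))%:E)%E.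
Proof.
move=> mA ab abA; have pi0 := pi_gt0 R; rewrite uniform_angleE//.
rewrite [(_ - _) / _]mulrC EFinM lee_pmul2l ?lte_fin ?invr_gt0 ?mulr_gt0//.
apply: (@le_trans _ _ (mu `[a, b]%classic)); last first.
  rewrite lebesgue_measure_itv /= lte_fin.
  have [ab'|ba] := ltP a b; first by rewrite -EFinB.
  by rewrite lee_fin; lra.
rewrite le_measure ?inE//; first exact: measurableI.
move=> x /= [Ax]; rewrite !in_itv/= => /andP[h1 h2]; apply: abA => //.
by apply/andP; split; lra.
Qed.

(** Translating by -r moves the interval [-pi, pi[ to [-pi - r, pi - r[; its part left of -pi is
    brought back to [pi - r, pi[ by one period. *)
Lemma uniform_angle_rotation (t : R) (S : set R) : measurable S ->
  (forall x, S (x + 2 * pi) = S x) -> - pi <= t <= pi ->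
  unif [set b | S (b - t)] = unif S.
Proof.
move=> mS perS /andP[t1 t2]; have pi0 := pi_gt0 R.
suff H (r : R) : 0 <= r -> r <= 2 * pi -> unif [set b | S (b - r)] = unif S.
  have [|tn] := leP 0 t; first by move=> /H -> //; lra.
  rewrite -(H (t + 2 * pi)); [|lra|lra].
  congr (unif _); apply/funext => b /=; rewrite -(perS (b - (t + 2 * pi))).
  by congr S; lra.
move=> t0 tpi.
have mSt : measurable [set b | S (b - r)].
  have : measurable_fun [set: R] (fun x : R => x - r) by apply: measurable_funB.
  by move=> /(_ measurableT S mS); rewrite setTI.
rewrite !uniform_angleE//; congr (_ * _)%E.
rewrite -(@lebesgue_measure_translation _ r) /pushforward; last exact: measurableI.
have -> : (fun x => x + r) @^-1` ([set b | S (b - r)] `&` `[- pi, pi[) =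
  (S `&` `[- pi - r, - pi[) `|` (S `&` `[- pi, pi - r[).
  rewrite -setIUr; apply/seteqP; split => x /=; rewrite !in_itv/= addrK.
    move=> [Sx /andP[h1 h2]]; split => //.
    by have [h|h] := ltP x (- pi); [left|right]; apply/andP; split; lra.
  by move=> [Sx [/andP[h1 h2]|/andP[h1 h2]]]; split => //; apply/andP; split; lra.
have -> : S `&` `[- pi, pi[ = (S `&` `[pi - r, pi[) `|` (S `&` `[- pi, pi - r[).
  rewrite -setIUr; congr (_ `&` _); apply/seteqP; split => x /=; rewrite !in_itv/=.
    by move=> /andP[h1 h2]; have [h|h] := ltP x (pi - r); [right|left]; apply/andP; split; lra.
  by move=> [/andP[h1 h2]|/andP[h1 h2]]; apply/andP; split; lra.
rewrite !measureU; try exact: measurableI; last first.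
- apply/seteqP; split => x //= [[_ ]] + [_]; rewrite !in_itv/= => /andP[h1 h2] /andP[h3 h4]; lra.
- apply/seteqP; split => x //= [[_ ]] + [_]; rewrite !in_itv/= => /andP[h1 h2] /andP[h3 h4]; lra.
congr (_ + _)%E.
rewrite -[RHS](@lebesgue_measure_translation _ (2 * pi)) /pushforward; last exact: measurableI.
congr (mu _); apply/seteqP; split => x /=; rewrite !in_itv/= perS.
  by move=> [Sx /andP[h1 h2]]; split => //; apply/andP; split; lra.
by move=> [Sx /andP[h1 h2]]; split => //; apply/andP; split; lra.
Qed.

End uniform_angle.

Section radial_law_values.
Context {R : realType} (alpha : R).
Hypothesis a0 : 0 < alpha.
Notation mu := (@lebesgue_measure R).

Lemma cosh_sub1_gt0 (x : R) : 0 < x -> 0 < cosh x - 1.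
Proof.
move=> x0; rewrite (cosh_half x) addrAC subrr add0r mulr_gt0// exprn_gt0//.
by rewrite sinh_gt0// divr_gt0.
Qed.

Lemma radial_law_itv (rad x y : R) : 0 < rad -> 0 <= x -> x <= y -> y <= rad ->
  radial_law alpha rad `[x, y[ =
  ((cosh (alpha * y) - cosh (alpha * x)) / (cosh (alpha * rad) - 1))%:E.
Proof.
move=> rad0 x0; rewrite le_eqVlt => /orP[/eqP-> _|xy yr].
  by rewrite set_itvco0 subrr mul0r measure0.
have c1 : 0 < cosh (alpha * rad) - 1 by rewrite cosh_sub1_gt0// mulr_gt0.
pose f r : R := alpha * sinh (alpha * r) / (cosh (alpha * rad) - 1).
pose F r : R := cosh (alpha * r) / (cosh (alpha * rad) - 1).
have mf D : measurable_fun D (EFin \o f).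
  apply/measurable_EFinP/measurable_funTS; apply: continuous_measurable_fun.
  exact: continuous_radial_density.
have dF (z : R) : is_derive z (1 : R) F (f z).
  rewrite /F /f; move: (cosh (alpha * rad) - 1) c1 => K K0.
  rewrite /cosh; apply: is_derive_eq.
  by rewrite /sinh /GRing.scale/=; field; rewrite gt_eqF.
have cF : continuous F.
  by move=> z; apply: differentiable_continuous; apply/derivable1_diffP.
transitivity (\int[mu]_(r in `[x, y[) (f r)%:E)%E.
  rewrite /radial_law; apply: eq_integral => r; rewrite inE/= in_itv/= => /andP[xr ry].
  by rewrite /radial_pdf patchE ifT// inE/= in_itv/=; apply/andP; split; lra.
rewrite integral_itv_bndo_bndc// (@continuous_FTC2 _ f F)//.
- by rewrite -EFinB /F -mulrBl.
- apply: continuous_subspaceT; exact: continuous_radial_density.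
- split; first by move=> z _; exact: ex_derive.
  + by apply: cvg_at_right_filter; exact: cF.
  + by apply: cvg_at_left_filter; exact: cF.
- by move=> z _; rewrite derive1E; exact: derive_val.
Qed.

Lemma radial_law_out (rad : R) (A : set R) : A `&` `[0, rad[ = set0 ->
  radial_law alpha rad A = 0%E.
Proof.
move=> A0; rewrite /radial_law (eq_integral (fun=> 0%E)) ?integral0// => r.
rewrite inE => Ar; rewrite /radial_pdf patchE; case: ifPn => //.
by rewrite inE => rr; have : (A `&` `[0, rad[) r by []; rewrite A0.
Qed.

Lemma radial_law_restr (rad : R) (A : set R) : measurable A ->
  radial_law alpha rad A = radial_law alpha rad (A `&` `[0, rad[).
Proof.
move=> mA; rewrite -{1}(setDUK (@subIsetl _ A `[0, rad[%classic)).
rewrite measureU//; [|exact: measurableI|by apply: measurableD => //; exact: measurableI|].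
  rewrite [X in (_ + X)%E]radial_law_out ?adde0//.
  by apply/seteqP; split => x //= [[Ax nA] xr]; case: nA.
by rewrite setDIK.
Qed.

End radial_law_values.

Section polar_measurability.
Context {R : realType}.

Lemma measurable_preimage d d' (T : measurableType d) (T' : measurableType d')
    (f : T -> T') (A : set T') :
  measurable_fun setT f -> measurable A -> measurable [set x | A (f x)].
Proof. by move=> /(_ measurableT A) h /h; rewrite setTI. Qed.

Lemma continuous_tanh : continuous (@tanh R).
Proof.
move=> x; apply: cvgM; last first.
  apply: cvgV; first by rewrite gt_eqF// cosh_gt0.
  apply: cvgMl; apply: cvgD; first exact: continuous_expR.
  by apply: continuous_comp; [exact: cvgN|exact: continuous_expR].
apply: cvgMl; apply: cvgB; first exact: continuous_expR.
by apply: continuous_comp; [exact: cvgN|exact: continuous_expR].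
Qed.

Lemma measurable_polar : measurable_fun setT (@polar R).
Proof.
have mt : measurable_fun setT (fun p : R * R => tanh (p.1 / 2)).
  apply: (measurableT_comp (f := @tanh R)).
    by apply: continuous_measurable_fun; exact: continuous_tanh.
  by apply: measurable_funM.
apply: measurable_fun_pair; apply: measurable_funM => //.
  apply: (measurableT_comp (f := @cos R)) => //.
  by apply: continuous_measurable_fun; exact: continuous_cos.
apply: (measurableT_comp (f := @sin R)) => //.
by apply: continuous_measurable_fun; exact: continuous_sin.
Qed.

Lemma measurable_sqnorm : measurable_fun setT (@sqnorm R).
Proof. by apply: measurable_funD; apply: measurable_funX. Qed.

Definition hdisc (rad : R) := [set y : R * R | sqnorm y < tanh (rad / 2) ^+ 2].

(** The intersection with [hdisc] supplies the conditions on [y] in [in_hball_dominated], and costs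
    nothing by [node_law_out]. *)
Definition hball (rad : R) (c : R * R) :=
  [set y | hdisc rad y /\ in_hball rad c y].

Lemma measurable_hdisc rad : measurable (hdisc rad).
Proof.
rewrite (_ : hdisc rad = [set y | `]-oo, tanh (rad / 2) ^+ 2[%classic (sqnorm y)]).
  by apply: measurable_preimage => //; exact: measurable_sqnorm.
by apply/seteqP; split => y /=; rewrite in_itv.
Qed.

Lemma measurable_hball rad c : measurable (hball rad c).
Proof.
apply: measurableI; first exact: measurable_hdisc.
rewrite -[X in measurable X]setTI; apply: measurable_fun_le => //.
  apply: (measurableT_comp (f := @sqnorm R)); first exact: measurable_sqnorm.
  by apply: measurable_fun_pair; apply: measurable_funB.
apply: measurable_funM => //; apply: measurable_funM => //; apply: measurable_funB => //.
exact: measurable_sqnorm.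
Qed.

End polar_measurability.

Section node_law_sections.
Context {R : realType} (alpha rad : R).
Hypotheses (a0 : 0 < alpha) (r0 : 0 < rad).
Notation rl := (radial_law alpha rad).
Notation unif := (uniform_prob (@lt_Npi_pi R)).
Notation nl := (node_law alpha rad).

Let mpolar (A : set (R * R)) : measurable A -> measurable (polar @^-1` A).
Proof. by move=> mA; apply: measurable_preimage => //; exact: measurable_polar. Qed.

Let node_law0 : nl set0 = 0%E.
Proof. by rewrite /node_law /pushforward preimage_set0 measure0. Qed.

Let node_law_ge0 A : (0 <= nl A)%E.
Proof. by rewrite /node_law /pushforward measure_ge0. Qed.

Let node_law_sigma_additive : semi_sigma_additive nl.
Proof.
move=> F mF tF mUF; rewrite /node_law /pushforward preimage_bigcup.
apply: measure_semi_sigma_additive.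
- by move=> n; exact: mpolar.
- by apply/trivIsetP => /= i j _ _ ij; rewrite -preimage_setI (trivIsetP.1 tF)// preimage_set0.
- by rewrite -preimage_bigcup; exact: mpolar.
Qed.

HB.instance Definition _ := isMeasure.Build _ _ _
  nl node_law0 node_law_ge0 node_law_sigma_additive.

Lemma node_lawE A : nl A = (\int[rl]_s unif [set b | A (polar (s, b))])%E.
Proof.
rewrite /node_law /pushforward /product_measure1; apply: eq_integral => s _ /=.
by congr (unif _); apply/seteqP; split => b; rewrite /xsection /= inE.
Qed.

Lemma measurable_section (A : set (R * R)) s : measurable A ->
  measurable [set b | A (polar (s, b))].
Proof.
move=> mA; apply: (measurable_preimage (f := fun b => polar (s, b))) => //.
apply: (measurableT_comp (f := @polar R)); first exact: measurable_polar.
by apply: measurable_fun_pair.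
Qed.

Lemma measurable_fun_section (A : set (R * R)) : measurable A ->
  measurable_fun setT (fun s => unif [set b | A (polar (s, b))]).
Proof.
move=> mA; have := measurable_fun_xsection (uniform_prob (@lt_Npi_pi R)) (mpolar mA).
congr measurable_fun; apply/funext => s /=.
by congr (unif _); apply/seteqP; split => b; rewrite /xsection /= inE.
Qed.

Lemma node_law_ge (A : set (R * R)) (W : set R) (c : R) :
  measurable A -> measurable W -> 0 <= c ->
  (forall s, W s -> (c%:E <= unif [set b | A (polar (s, b))])%E) ->
  (c%:E * rl W <= nl A)%E.
Proof.
move=> mA mW c0 cW; rewrite node_lawE.
apply: (@le_trans _ _ (\int[rl]_s (c%:E * (\1_W s)%:E))%E).
  rewrite ge0_integralZl//; last by apply/measurable_EFinP.
  by rewrite integral_indic// setIT.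
apply: ge0_le_integral => //.
- by move=> s _; rewrite mule_ge0 ?lee_fin.
- by apply: measurable_funeM; apply/measurable_EFinP.
- exact: measurable_fun_section.
- move=> s _; rewrite indicE; have [sW|sW] := boolP (s \in W).
    by rewrite mule1; apply: cW; rewrite inE in sW.
  by rewrite mule0 measure_ge0.
Qed.

(** Radii in [V] are charged in full, all others contribute at most the angular probability [c]. *)
Lemma node_law_le (A : set (R * R)) (V : set R) (c : R) :
  measurable A -> measurable V -> 0 <= c ->
  (forall s, 0 <= s < rad -> ~ V s -> (unif [set b | A (polar (s, b))] <= c%:E)%E) ->
  (nl A <= rl V + c%:E)%E.
Proof.
move=> mA mV c0 cV; rewrite node_lawE.
(* The section bound is assumed only on [0, rad[; the radii added here are not charged by the radial
   law. *)
pose V' := V `|` ~` `[0, rad[.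
have mV' : measurable V' by apply: measurableU => //; apply: measurableC.
apply: (@le_trans _ _ (\int[rl]_s ((\1_V' s)%:E + c%:E))%E).
  apply: ge0_le_integral => //.
  - exact: measurable_fun_section.
  - by apply: emeasurable_funD => //; apply/measurable_EFinP.
  - move=> s _; rewrite indicE; have [sW|sW] := boolP (s \in V').
      apply: (@le_trans _ _ 1%E).
        by apply: probability_le1; exact: measurable_section.
      by rewrite -EFinD lee_fin lerDl.
    rewrite add0e; apply: cV.
      by apply: contrapT => h; move: sW; rewrite notin_setE; apply; right; rewrite /= in_itv.
    by move=> h; move: sW; rewrite notin_setE; apply; left.
rewrite ge0_integralD//; last by apply/measurable_EFinP.
rewrite integral_indic// setIT integral_cst//.
rewrite [X in (_ + _ * X)%E](radial_law_setT a0 r0) mule1.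
rewrite leeD2r// [leLHS](radial_law_restr _ _ mV') [leRHS](radial_law_restr _ _ mV) le_measure ?inE//.
- exact: measurableI.
- exact: measurableI.
by move=> s [[Vs|ns] rs].
Qed.

Lemma sqnorm_polarE (s b : R) : sqnorm (polar (s, b)) = tanh (s / 2) ^+ 2.
Proof. by rewrite /sqnorm /= !exprMn -mulrDr cos2Dsin2 mulr1. Qed.

Lemma node_law_radial (S : set R) : measurable S ->
  nl [set y | S (sqnorm y)] = rl [set s | S (tanh (s / 2) ^+ 2)].
Proof.
move=> mS; rewrite node_lawE.
have mS' : measurable [set s | S (tanh (s / 2) ^+ 2)].
  apply: (measurable_preimage (f := fun s : R => tanh (s / 2) ^+ 2)) => //.
  apply: measurable_funX; apply: (measurableT_comp (f := @tanh R)).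
    by apply: continuous_measurable_fun; exact: continuous_tanh.
  by apply: measurable_funM.
rewrite -[in RHS](setIT [set s | S _]) -integral_indic//; apply: eq_integral => s _.
rewrite indicE; have [sW|sW] := boolP (s \in _).
  rewrite inE in sW; rewrite (_ : [set b | _] = setT) ?probability_setT//.
  by apply/seteqP; split => b //= _; rewrite sqnorm_polarE.
rewrite notin_setE in sW; rewrite (_ : [set b | _] = set0) ?measure0//.
by apply/seteqP; split => b //=; rewrite sqnorm_polarE.
Qed.

Lemma node_law_out : nl (~` hdisc rad) = 0%E.
Proof.
have -> : ~` hdisc rad = [set y | `[tanh (rad / 2) ^+ 2, +oo[%classic (sqnorm y)].
  by apply/seteqP; split => y; rewrite /hdisc /= in_itv/= andbT leNgt => /negP.
rewrite node_law_radial//; apply: radial_law_out.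
apply/seteqP; split => s //= [].
rewrite !in_itv/= andbT leNgt => /negP h /andP[s0 sr]; apply: h.
by rewrite ltrXn2r// ?tanh_ge0 ?ltr_tanh ?divr_ge0// ?ltr_pM2r// ltW.
Qed.

(** The angles enter only through [cos (b - th)], which gives rotation invariance and, for [th = 0],
    a critical cosine. *)
Lemma hball_polarE t th s b :
  hball rad (t * cos th, t * sin th) (polar (s, b)) =
  (tanh (s / 2) ^+ 2 < tanh (rad / 2) ^+ 2 /\
   t ^+ 2 + tanh (s / 2) ^+ 2 - sinh (rad / 2) ^+ 2 * ((1 - t ^+ 2) * (1 - tanh (s / 2) ^+ 2))
     <= 2 * t * tanh (s / 2) * cos (b - th)).
Proof.
rewrite /hball /hdisc /in_hball /= !sqnorm_polarE; congr (_ /\ _).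
rewrite cosB /sqnorm /=; have := cos2Dsin2 th; have := cos2Dsin2 b.
move: (tanh (s / 2)) (sinh (rad / 2) ^+ 2) (cos th) (sin th) (cos b) (sin b).
move=> S K ct st cb sb hb ht.
have -> : (t * ct) ^+ 2 + (t * st) ^+ 2 = t ^+ 2 by rewrite !exprMn -mulrDr ht mulr1.
have -> : (t * ct - S * cb) ^+ 2 + (t * st - S * sb) ^+ 2 =
  t ^+ 2 * (ct ^+ 2 + st ^+ 2) + S ^+ 2 * (cb ^+ 2 + sb ^+ 2) -
  2 * t * S * (cb * ct + sb * st) by ring.
by rewrite ht hb !mulr1; congr is_true; apply/idP/idP => h; lra.
Qed.

Lemma node_law_hball_rotation t th : - pi <= th <= pi ->
  nl (hball rad (t * cos th, t * sin th)) = nl (hball rad (t, 0)).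
Proof.
move=> thpi; have -> : (t, 0) = (t * cos 0, t * sin 0) by rewrite cos0 sin0 mulr1 mulr0.
rewrite !node_lawE; apply: eq_integral => s _.
pose S := [set b | hball rad (t * cos 0, t * sin 0) (polar (s, b))].
rewrite -/S -(@uniform_angle_rotation _ th S)//.
- congr (unif _); apply/funext => b /=; rewrite /S /=.
  by rewrite !hball_polarE subr0.
- by apply: measurable_section; exact: measurable_hball.
- move=> x; rewrite /S /= !hball_polarE !subr0.
  by rewrite (_ : 2 * pi = pi *+ 2) ?cosD2pi// mulr2n; ring.
Qed.

End node_law_sections.

(** * Counting independent points in a set *)

Section finite_unions.
Context d {T : measurableType d} {R : realType} (P : probability T R).

Lemma measurable_fin_exists (I : finType) (F : I -> set T) :
  (forall i, measurable (F i)) -> measurable [set w | exists i, F i w].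
Proof.
move=> mF; rewrite (_ : [set w | _] = \bigcup_(i in [set: I]) F i).
  by apply: fin_bigcup_measurable => //; exact: finite_finset.
by apply/seteqP; split => w [i]; [exists i|move=> ?; exists i].
Qed.

Lemma measurable_fin_forall (I : finType) (F : I -> set T) :
  (forall i, measurable (F i)) -> measurable [set w | forall i, F i w].
Proof.
move=> mF; rewrite (_ : [set w | _] = ~` [set w | exists i, (~` F i) w]).
  by apply: measurableC; apply: measurable_fin_exists => i; apply: measurableC.
apply/seteqP; split => w /= h; first by move=> [i]; apply.
by move=> i; apply: contrapT => hi; apply: h; exists i.
Qed.

Lemma measurable_finite_image (I : finType) (f : T -> I) (S : set I) :
  (forall v, measurable [set w | f w = v]) -> measurable [set w | S (f w)].
Proof.
move=> mf; rewrite (_ : [set w | S (f w)] =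
    [set w | exists v, (if `[< S v >] then [set w | f w = v] else set0) w]).
  by apply: measurable_fin_exists => v; case: ifP.
apply/seteqP; split => w /=; first by move=> Sw; exists (f w); rewrite asboolT.
by move=> [v]; case: ifPn => // /asboolP Sv /= ->.
Qed.

Lemma union_bound (I : finType) (F : I -> set T) (c : I -> R) :
  (forall i, measurable (F i)) -> (forall i, P (F i) <= (c i)%:E)%E ->
  (P [set w | exists i, F i w] <= (\sum_i c i)%:E)%E.
Proof.
move=> mF cF.
have H (s : seq I) : measurable [set w | exists2 i, i \in s & F i w] /\
    (P [set w | exists2 i, i \in s & F i w] <= (\sum_(i <- s) c i)%:E)%E.
  elim: s => [|i s [ms Ps]].
    rewrite (_ : [set w | _] = set0) ?measure0 ?big_nil//.
    by apply/seteqP; split => w //= [].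
  have -> : [set w | exists2 j, j \in i :: s & F j w] =
      F i `|` [set w | exists2 i, i \in s & F i w].
    apply/seteqP; split => w /=.
      by move=> [j]; rewrite inE => /orP[/eqP->|js Fj]; [left|right; exists j].
    by move=> [Fi|[j js Fj]]; [exists i; rewrite ?mem_head|exists j; rewrite // inE js orbT].
  split; first exact: measurableU.
  rewrite big_cons EFinD; apply: (le_trans (measureU2 _ _ _)) => //.
  exact: leeD (cF i) Ps.
have [_ h] := H (index_enum I).
rewrite (_ : [set w | _] = [set w | exists2 i, i \in index_enum I & F i w])//.
by apply/seteqP; split => w /=; [move=> [i Fi]; exists i; rewrite ?mem_index_enum|move=> [i _ Fi]; exists i].
Qed.

Lemma probability_setU_le (A B : set T) (x y : R) : measurable A -> measurable B ->
  (P A <= x%:E)%E -> (P B <= y%:E)%E -> (P (A `|` B) <= (x + y)%:E)%E.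
Proof.
move=> mA mB Ax By; apply: (le_trans (measureU2 _ mA mB)).
by rewrite EFinD leeD.
Qed.

End finite_unions.

Section hit_counts.
Context {R : realType} d d' {T : measurableType d} {T' : measurableType d'}
  (P : probability T R) (n : nat) (X : 'I_n -> {RV P >-> T'}).

Definition hits (A : set T') (w : T) : {set 'I_n} := [set i | `[< A (X i w) >]]%SET.

Hypothesis indX : mutually_independent X.
Variables (A : set T') (p : R).
Hypothesis mA : measurable A.
Hypothesis pA : forall i, P (X i @^-1` A) = p%:E.

Let mXA i : measurable (X i @^-1` A).
Proof. exact: measurable_funPTI. Qed.

Lemma measurable_hits (S : set {set 'I_n}) : measurable [set w | S (hits A w)].
Proof.
apply: measurable_finite_image => J.
rewrite (_ : [set w | _] =
    [set w | forall i, (if i \in J then X i @^-1` A else ~` (X i @^-1` A)) w]).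
  by apply: measurable_fin_forall => i; case: ifP => // _; apply: measurableC.
apply/seteqP; split => w /=.
  by move=> <- i; rewrite inE; case: asboolP.
move=> h; apply/setP => i; rewrite inE.
by have := h i; case: ifP => _ /= hi; [rewrite asboolT|apply/negbTE/asboolPn].
Qed.

Lemma hits_eq_prob (J : {set 'I_n}) :
  P [set w | hits A w = J] = (\prod_i (if i \in J then p else 1 - p))%:E.
Proof.
(* An exact hit set prescribes [A] or its complement at every index, so independence is applied to
   the full index set. *)
pose B i : set T' := if i \in J then A else ~` A.
have mB i : measurable (B i) by rewrite /B; case: ifP => // _; apply: measurableC.
have -> : [set w | hits A w = J] =
    \bigcap_(i in [set` [set: 'I_n]%SET]) (X i @^-1` B i).
  apply/seteqP; split => w /=.
    by move=> hJ i _; rewrite /B -hJ inE /=; case: asboolP.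
  move=> h; apply/setP => i; rewrite inE.
  have := h i; rewrite /= inE /B => /(_ isT).
  by case: ifP => _ /= hi; [rewrite asboolT|apply/negbTE/asboolPn].
rewrite indX// -prodEFin; apply: eq_big => i; first by rewrite inE.
move=> _; rewrite /B; case: ifP => // _.
rewrite preimage_setC probability_setC; last exact: mXA.
by rewrite EFinB; congr (_ - _)%E; exact: pA.
Qed.

Lemma hits_prob_le (Q : pred {set 'I_n}) :
  (P [set w | Q (hits A w)] <=
   (\sum_(J : {set 'I_n} | Q J) \prod_i (if i \in J then p else 1 - p))%:E)%E.
Proof.
rewrite (_ : [set w | _] =
  [set w | exists J, (if Q J then [set w | hits A w = J] else set0) w]).
  rewrite big_mkcond; apply: union_bound => J; case: ifP => // _.
  - exact: (measurable_hits [set J]).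
  - by rewrite hits_eq_prob.
  - by rewrite measure0.
apply/seteqP; split => w /=; first by move=> Qw; exists (hits A w); rewrite Qw.
by move=> [J]; case: ifPn => // QJ /= ->.
Qed.

Let p01 : (0 < n)%N -> 0 <= p <= 1.
Proof.
move=> n0; rewrite -!lee_fin -(pA (Ordinal n0)) measure_ge0/=.
by apply: probability_le1.
Qed.

(* The sign of [l] selects the tail: upper if [l > 0], lower if [l < 0]. *)
Lemma hits_chernoff (l t : R) : (0 < n)%N ->
  (P [set w | (l * t <= l * #|hits A w|%:R)%R] <=
   (expR (n%:R * p * (expR l - 1) - l * t))%:E)%E.
Proof.
move=> n0; apply: (le_trans (hits_prob_le (fun J => l * t <= l * #|J|%:R))).
rewrite lee_fin.
have /andP[p0 p1] := p01 n0.
(* Markov's inequality for [expR (l * #|J|)], as a sum over all possible hit sets. *)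
pose pr (J : {set 'I_n}) := \prod_i (if i \in J then p else 1 - p).
have pr0 J : 0 <= pr J by apply: prodr_ge0 => i _; case: ifP => _ //; rewrite subr_ge0.
apply: (@le_trans _ _ (\sum_(J : {set 'I_n}) expR (- (l * t)) *
    \prod_i (if i \in J then p * expR l else 1 - p))).
  rewrite big_mkcond; apply: ler_sum => J _.
  have -> : \prod_i (if i \in J then p * expR l else 1 - p) = pr J * expR (l * #|J|%:R).
    rewrite /pr expRM_natr -prodr_const [X in _ = _ * X]big_mkcond /= -big_split.
    by apply: eq_bigr => i _ /=; case: ifP => _; rewrite ?mulr1.
  rewrite mulrCA -expRD -/(pr J); case: ifPn => h; last by rewrite mulr_ge0 ?expR_ge0.
  have h1 : 1 <= expR (- (l * t) + l * #|J|%:R) by rewrite -[leLHS]expR0 ler_expR; lra.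
  exact: ler_peMr.
(* Sum over subsets against product over indices: the moment generating function (1 - p + p * exp
   l)^n of a binomial law. *)
rewrite -mulr_sumr -bigA_distr/= prodr_const card_ord.
rewrite expRD mulrC ler_pM2r ?expR_gt0//.
rewrite -mulrA expRM_natl lerXn2r ?nnegrE ?expR_ge0//.
  by rewrite addr_ge0 ?mulr_ge0 ?expR_ge0 ?subr_ge0.
by have := expR_ge1Dx (p * (expR l - 1)); lra.
Qed.

Lemma two_hits_prob_le :
  (P [set w | (1 < #|hits A w|)%N] <= (n%:R ^+ 2 * p ^+ 2)%:E)%E.
Proof.
apply: (@le_trans _ _ (P [set w | exists ij : 'I_n * 'I_n,
    (if ij.1 == ij.2 then set0 else X ij.1 @^-1` A `&` X ij.2 @^-1` A) w])).
  rewrite le_measure ?inE//.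
  - exact: (measurable_hits [set J : {set 'I_n} | (1 < #|J|)%N]).
  - by apply: measurable_fin_exists => ij; case: ifP => // _; apply: measurableI.
  - move=> w /= /card_gt1P[i [j [iJ jJ ij]]]; exists (i, j) => /=.
    rewrite (negbTE ij); move: iJ jJ; rewrite /hits !inE => /asboolP hi /asboolP hj.
    by split; [exact: asboolW hi|exact: asboolW hj].
apply: (@le_trans _ _ (\sum_(ij : 'I_n * 'I_n) p ^+ 2)%:E).
  apply: union_bound => -[i j] /=; case: ifPn => // ij.
  - exact: measurableI.
  - by rewrite measure0 lee_fin sqr_ge0.
  - have := @indX [set i; j]%SET (fun=> A) (fun=> mA).
    rewrite (_ : \bigcap_(k in _) _ = X i @^-1` A `&` X j @^-1` A).
      by move=> ->; rewrite big_setU1 ?inE//= big_set1 !pA.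
    apply/seteqP; split => w /=.
      by move=> h; split; apply: h; rewrite /= !inE eqxx ?orbT.
    by move=> [hi hj] k /=; rewrite !inE => /orP[]/eqP->.
by rewrite lee_fin sumr_const card_prod card_ord -[leLHS]mulr_natl natrM expr2.
Qed.

End hit_counts.

(** Squaring 1 - l / 2 <= exp (- l / 2) gives exp l <= (1 - l / 2)^-2, and for |l| <= 1/4 a
    polynomial inequality bounds this by 1 + l + l^2. *)
Lemma expR_le_quadratic {R : realType} (l : R) : `|l| <= 1 / 4 ->
  expR l - 1 <= l + l ^+ 2.
Proof.
rewrite ler_norml => /andP[l1 l2].
have e0 := expR_gt0 l.
have h := expR_ge1Dx (- (l / 2)).
have E : expR l * expR (- (l / 2)) ^+ 2 = 1.
  by rewrite expr2 -!expRD (_ : _ + _ = 0) ?expR0//; field.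
have h1 : (1 - l / 2) ^+ 2 <= expR (- (l / 2)) ^+ 2.
  by rewrite lerXn2r ?nnegrE ?expR_ge0//; lra.
have h2 : expR l * (1 - l / 2) ^+ 2 <= 1 by rewrite -[leRHS]E ler_pM2l.
have h3 : 1 <= (1 + l + l ^+ 2) * (1 - l / 2) ^+ 2.
  rewrite -subr_ge0 (_ : _ - 1 = l ^+ 2 * (1 - 3 * l + l ^+ 2) / 4); last by field.
  by rewrite divr_ge0// mulr_ge0 ?sqr_ge0//; nra.
have h4 : 0 < (1 - l / 2) ^+ 2 by rewrite exprn_gt0//; lra.
rewrite lerBlDr -(ler_pM2r h4) (le_trans h2)// (le_trans h3)//.
by rewrite le_eqVlt; apply/orP; left; apply/eqP; ring.
Qed.

(** * Connection probabilities *)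

Section critical_angle.
Context {R : realType} (rad : R).
Implicit Types r s : R.

(* Two points at radii r and s are at distance at most rad exactly when the
   cosine of the angle between them is at least [hcos r s]. *)
Definition hcos r s : R :=
  (tanh (r / 2) ^+ 2 + tanh (s / 2) ^+ 2
   - sinh (rad / 2) ^+ 2 * ((1 - tanh (r / 2) ^+ 2) * (1 - tanh (s / 2) ^+ 2)))
  / (2 * tanh (r / 2) * tanh (s / 2)).

(** Half-angle form of the law of cosines: the factored expression keeps its precision when the
    critical angle is exponentially small. *)
Lemma oneBhcos r s : 0 < r -> 0 < s ->
  1 - hcos r s = (sinh (rad / 2) ^+ 2 - sinh ((r - s) / 2) ^+ 2) /
    (2 * sinh (r / 2) * cosh (r / 2) * sinh (s / 2) * cosh (s / 2)).
Proof.
move=> r0 s0; have -> : (r - s) / 2 = r / 2 - s / 2 by field.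
rewrite /hcos !tanh_sqr sinhB /tanh.
have := cosh_sqr (r / 2); have := cosh_sqr (s / 2).
have := @sinh_gt0 R (r / 2); have := @sinh_gt0 R (s / 2).
have := cosh_gt0 (r / 2); have := cosh_gt0 (s / 2).
move: (sinh (r / 2)) (sinh (s / 2)) (cosh (r / 2)) (cosh (s / 2)).
move=> x y c d d0 c0 y0 x0 hd hc; have {}x0 : 0 < x by apply: x0; lra.
have {}y0 : 0 < y by apply: y0; lra.
by field; rewrite !gt_eqF.
Qed.

Lemma oneDhcos r s : 0 < r -> 0 < s ->
  1 + hcos r s = (sinh ((r + s) / 2) ^+ 2 - sinh (rad / 2) ^+ 2) /
    (2 * sinh (r / 2) * cosh (r / 2) * sinh (s / 2) * cosh (s / 2)).
Proof.
move=> r0 s0; have -> : (r + s) / 2 = r / 2 + s / 2 by field.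
rewrite /hcos !tanh_sqr sinhD /tanh.
have := @sinh_gt0 R (r / 2); have := @sinh_gt0 R (s / 2).
have := cosh_gt0 (r / 2); have := cosh_gt0 (s / 2).
move: (sinh (r / 2)) (sinh (s / 2)) (cosh (r / 2)) (cosh (s / 2)).
move=> x y c d d0 c0 y0 x0; have {}x0 : 0 < x by apply: x0; lra.
have {}y0 : 0 < y by apply: y0; lra.
by field; rewrite !gt_eqF.
Qed.

Let den_gt0 r s : 0 < r -> 0 < s ->
  0 < 2 * sinh (r / 2) * cosh (r / 2) * sinh (s / 2) * cosh (s / 2).
Proof.
move=> r0 s0; have x0 : 0 < sinh (r / 2) by apply: sinh_gt0; lra.
have y0 : 0 < sinh (s / 2) by apply: sinh_gt0; lra.
move: (sinh (r / 2)) (sinh (s / 2)) x0 y0 (cosh_gt0 (r / 2)) (cosh_gt0 (s / 2)).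
by move: (cosh (r / 2)) (cosh (s / 2)) => c d x y x0 y0 c0 d0; rewrite !mulr_gt0.
Qed.

Lemma hcos_le1 r s : 0 < r -> 0 < s -> r <= rad -> s <= rad -> hcos r s <= 1.
Proof.
move=> r0 s0 rr sr; rewrite -subr_ge0 oneBhcos// divr_ge0 ?(ltW (den_gt0 _ _))//.
rewrite subr_ge0 -[leLHS]real_normK ?num_real// lerXn2r ?nnegrE ?sinh_ge0 ?divr_ge0//; try lra.
rewrite ler_norml; apply/andP; split; last by apply: ler_sinh; lra.
rewrite (_ : - sinh (rad / 2) = sinh (- (rad / 2))); last by rewrite /sinh opprK; field.
by apply: ler_sinh; lra.
Qed.

Lemma hcos_geN1 r s : 0 < r -> 0 < s -> 0 <= rad -> rad <= r + s -> -1 <= hcos r s.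
Proof.
move=> r0 s0 rad0 rrs; rewrite -subr_ge0 opprK addrC oneDhcos// divr_ge0 ?(ltW (den_gt0 _ _))//.
rewrite subr_ge0 lerXn2r ?nnegrE ?sinh_ge0 ?divr_ge0//; try lra.
by apply: ler_sinh; lra.
Qed.

Lemma oneBhcos_le r s : 1 <= r -> 1 <= s -> 0 <= rad ->
  1 - hcos r s <= 18 * expR (rad - r - s).
Proof.
move=> r1 s1 rad0; rewrite oneBhcos; [|lra|lra].
have D0 : 0 < 2 * sinh (r / 2) * cosh (r / 2) * sinh (s / 2) * cosh (s / 2).
  by apply: den_gt0; lra.
rewrite ler_pdivrMr//.
have tr := tanh_half_lb r1; have ts := tanh_half_lb s1.
move: tr; rewrite /tanh ler_pdivlMr ?cosh_gt0// => tr.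
move: ts; rewrite /tanh ler_pdivlMr ?cosh_gt0// => ts.
have cr := expR_le_cosh (r / 2); have cs := expR_le_cosh (s / 2).
have S0 : 0 <= sinh (rad / 2) by rewrite sinh_ge0// divr_ge0.
have S1 := sinh_le_expR (rad / 2).
have e : expR (rad - r - s) * (expR (r / 2) ^+ 2 * expR (s / 2) ^+ 2) = expR (rad / 2) ^+ 2.
  by rewrite -!expR_half2 -!expRD; congr expR; ring.
have er := expR_gt0 (r / 2); have es := expR_gt0 (s / 2).
have E0 := expR_gt0 (rad - r - s).
move: (expR (rad - r - s)) (expR (r / 2)) (expR (s / 2)) (expR (rad / 2)) e E0 er es cr cs S1.
move: D0 tr ts S0; have := sqr_ge0 (sinh ((r - s) / 2)).
move: (sinh (rad / 2)) (sinh (r / 2)) (sinh (s / 2)) (cosh (r / 2)) (cosh (s / 2)).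
move: (sinh ((r - s) / 2) ^+ 2).
move=> z S x y c d z0 D0 xc yd S0 E er es eR e E0 er0 es0 cr cs S1.
(* At radii at least 1, sinh >= cosh / 3 at half the radius, so each product sinh * cosh is at least
   exp / 12. Hence 18 = 144 / (2 * 4). *)
have h1 : S ^+ 2 <= eR ^+ 2 / 4 by nra.
have h2 : er ^+ 2 / 12 <= x * c by nra.
have h3 : es ^+ 2 / 12 <= y * d by nra.
have h4 : er ^+ 2 / 12 * (es ^+ 2 / 12) <= x * c * (y * d).
  by apply: ler_pM => //; rewrite divr_ge0// sqr_ge0.
have h5 : E * (er ^+ 2 / 12 * (es ^+ 2 / 12)) <= E * (x * c * (y * d)) by rewrite ler_wpM2l// ltW.
have h6 : E * (er ^+ 2 / 12 * (es ^+ 2 / 12)) = eR ^+ 2 / 144 by rewrite -e; field.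
have -> : 18 * E * (2 * x * c * y * d) = 36 * (E * (x * c * (y * d))) by ring.
rewrite h6 in h5; lra.
Qed.

(** In t = tanh (r / 2), with S = tanh (s / 2) and k = (sinh (rad / 2) / cosh (s / 2))^2, the
    critical cosine is ((1 + k) * t - (k - S^2) / t) / (2 * S). Its increase comes from the second
    term, as k - S^2 >= w / 6 when s stays w / 2 away from [rad]. *)
Lemma hcosB_ge r1 r2 s w : 0 < w -> w <= 1 -> 4 <= rad ->
  0 < r1 -> r1 < r2 -> tanh (r1 / 2) <= w -> rad - w <= s -> s <= rad - w / 2 ->
  (tanh (r2 / 2) - tanh (r1 / 2)) / (12 * tanh (r2 / 2)) <= hcos r2 s - hcos r1 s.
Proof.
move=> w0 w1 rad4 r10 r12 tw sw1 sw2; rewrite /hcos !tanh_sqr.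
have s1 : 1 <= s by lra.
have ts := tanh_half_lb s1; have ts1 := tanh_lt1 (s / 2).
have t10 : 0 < tanh (r1 / 2) by rewrite tanh_gt0// divr_gt0.
have t12 : tanh (r1 / 2) < tanh (r2 / 2) by rewrite ltr_tanh// ltr_pM2r.
have key : w / 6 <= sinh (rad / 2) ^+ 2 * (cosh (s / 2) ^+ 2)^-1 - tanh (s / 2) ^+ 2.
  have := cosh_ge_tangent s rad; rewrite (cosh_half rad) (cosh_half s) (sinh_half s).
  move: ts; rewrite /tanh; have := cosh_gt0 (s / 2); have := @sinh_gt0 R (s / 2).
  move: (sinh (s / 2)) (cosh (s / 2)) (sinh (rad / 2)) => x c S x0 c0.
  have {}x0 : 0 < x by apply: x0; lra.
  rewrite ler_pdivlMr// => xc h; rewrite expr_div_n -mulrBl ler_pdivlMr ?exprn_gt0//.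
  have h1 : w / 2 * (2 * x * c) <= (rad - s) * (2 * x * c).
    by rewrite ler_wpM2r ?mulr_ge0 ?(ltW x0) ?(ltW c0)//; lra.
  have h2 : w * c * (1 / 3 * c) <= w * c * x by rewrite ler_wpM2l ?mulr_ge0 ?(ltW c0) ?(ltW w0).
  by nra.
have K0 : 0 <= sinh (rad / 2) ^+ 2 * (cosh (s / 2) ^+ 2)^-1.
  by rewrite mulr_ge0 ?invr_ge0 ?sqr_ge0.
have e1 : (cosh (r1 / 2) ^+ 2)^-1 = 1 - tanh (r1 / 2) ^+ 2 by rewrite tanh_sqr.
have e2 : (cosh (r2 / 2) ^+ 2)^-1 = 1 - tanh (r2 / 2) ^+ 2 by rewrite tanh_sqr.
rewrite e1 e2 {e1 e2}.
rewrite ![sinh (rad / 2) ^+ 2 * (_ * (cosh (s / 2) ^+ 2)^-1)]mulrCA.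
move: (sinh (rad / 2) ^+ 2 * (cosh (s / 2) ^+ 2)^-1) K0 key => k k0 key.
move: (tanh (r1 / 2)) (tanh (r2 / 2)) (tanh (s / 2)) tw t10 t12 ts ts1 key.
move=> t u S tw t0 tu S1 S2 key; have u0 : 0 < u by lra.
have -> : (u ^+ 2 + S ^+ 2 - (1 - u ^+ 2) * k) / (2 * u * S) -
  (t ^+ 2 + S ^+ 2 - (1 - t ^+ 2) * k) / (2 * t * S) =
  (u - t) * ((1 + k) + (k - S ^+ 2) / (t * u)) / (2 * S).
  by field; rewrite !gt_eqF//; lra.
rewrite ler_pdivrMr ?mulr_gt0// mulrAC ler_pdivlMr; last by lra.
have h1 : 1 / 6 / u <= (k - S ^+ 2) / (t * u).
  rewrite invfM mulrA ler_pM2r ?invr_gt0// ler_pdivlMr//; lra.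
have h2 : 1 / 6 <= ((1 + k) + (k - S ^+ 2) / (t * u)) * u.
  have {}h1 : 1 / 6 <= (k - S ^+ 2) / (t * u) * u by rewrite -ler_pdivrMr.
  by rewrite mulrDl; have := mulr_ge0 k0 (ltW u0); nra.
have ut0 : 0 <= u - t by lra.
have := ler_wpM2l ut0 h2; nra.
Qed.

End critical_angle.

Section connection_probability.
Context {R : realType} (alpha rad : R).
Hypotheses (a0 : 0 < alpha) (r0 : 0 < rad).
Notation rl := (radial_law alpha rad).
Notation unif := (uniform_prob (@lt_Npi_pi R)).
Notation nl := (node_law alpha rad).

Definition conn (r : R) : \bar R := nl (hball rad (tanh (r / 2), 0)).

Lemma hdisc_sqnorm y : hdisc rad y ->
  sqnorm y < 1 /\ sqnorm y <= sinh (rad / 2) ^+ 2 * (1 - sqnorm y).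
Proof.
rewrite /hdisc /= => h; have := tanh_sqr (rad / 2); have := cosh_sqr (rad / 2).
have := cosh_gt0 (rad / 2); move: h; rewrite /tanh expr_div_n.
move: (sinh (rad / 2)) (cosh (rad / 2)) (sqnorm y) => S C q.
move=> h C0 hC e; have C2 : 0 < C ^+ 2 by rewrite exprn_gt0.
move: h; rewrite ltr_pdivlMr// => h; split; first by nra.
by move: h; rewrite hC; nra.
Qed.

Lemma hball_subset (t t' : R) (u u' : R * R) :
  sqnorm u = 1 -> sqnorm u' = 1 -> 0 <= t ->
  sqnorm (u.1 - u'.1, u.2 - u'.2) <= (t' - t) ^+ 2 -> t <= t' ->
  hball rad (t' * u'.1, t' * u'.2) `<=` hball rad (t * u.1, t * u.2).
Proof.
move=> u1 u1' t0 uu tt y [yd yb]; split => //.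
have [y1 yK] := hdisc_sqnorm yd.
exact: (in_hball_dominated u1 u1' t0 uu tt (ltW y1) yK yb).
Qed.

Lemma hball0_subset (t t' : R) : 0 <= t -> t <= t' ->
  hball rad (t', 0) `<=` hball rad (t, 0).
Proof.
move=> t0 tt; have := @hball_subset t t' (1, 0) (1, 0).
rewrite /sqnorm /= !subrr expr1n expr0n /= !addr0 !mulr1 !mulr0.
by apply => //; exact: sqr_ge0.
Qed.

Lemma hball_section r s b : 0 < r -> 0 < s -> s < rad ->
  hball rad (tanh (r / 2), 0) (polar (s, b)) = (hcos rad r s <= cos b) :> Prop.
Proof.
move=> rp sp sr; have := hball_polarE rad (tanh (r / 2)) 0 s b.
rewrite cos0 sin0 mulr1 mulr0 subr0 => ->.
have ts : tanh (s / 2) ^+ 2 < tanh (rad / 2) ^+ 2.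
  by rewrite ltrXn2r// ?tanh_ge0 ?ltr_tanh//; lra.
have t0 : 0 < 2 * tanh (r / 2) * tanh (s / 2).
  have hr : 0 < tanh (r / 2) by apply: tanh_gt0; lra.
  have hs : 0 < tanh (s / 2) by apply: tanh_gt0; lra.
  by move: (tanh (r / 2)) (tanh (s / 2)) hr hs => ? ? ? ?; rewrite !mulr_gt0.
rewrite /hcos ler_pdivrMr// [cos b * _]mulrC.
by apply/propext; split => [[]//|h]; split.
Qed.

Lemma radial_law_window (w : R) : 0 < w -> w <= 1 -> 1 <= alpha * (rad - 1) ->
  ((alpha / 8 * expR (- alpha) * w)%:E <= rl `[(rad - w)%R, (rad - w / 2)%R[%classic)%E.
Proof.
move=> w0 w1 a1; have rad1 : 1 < rad.
  by rewrite -subr_gt0 -(pmulr_rgt0 _ a0); lra.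
rewrite radial_law_itv//; [|lra|lra|lra].
rewrite lee_fin; have c1 : 0 < cosh (alpha * rad) - 1 by rewrite cosh_sub1_gt0// mulr_gt0.
rewrite ler_pdivlMr//.
have h1 := cosh_ge_tangent (alpha * (rad - w)) (alpha * (rad - w / 2)).
have h2 : sinh (alpha * (rad - 1)) <= sinh (alpha * (rad - w)).
  by apply: ler_sinh; rewrite ler_pM2l//; lra.
have h3 : expR (alpha * (rad - 1)) / 4 <= sinh (alpha * (rad - 1)).
  rewrite /sinh; move: a1; move: (alpha * (rad - 1)) => z z1.
  have : expR (- z) <= 1 by rewrite -expR0 ler_expR; lra.
  have := expR_ge1Dx z; lra.
have h4 : cosh (alpha * rad) <= expR (alpha * rad) by rewrite cosh_le_expR// mulr_ge0// ltW.
have h5 : expR (- alpha) * expR (alpha * rad) = expR (alpha * (rad - 1)).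
  by rewrite -expRD; congr expR; ring.
have aw : 0 < alpha * w / 2 by rewrite divr_gt0// mulr_gt0.
have h6 : alpha * w / 2 * (expR (alpha * (rad - 1)) / 4) <=
    alpha * w / 2 * sinh (alpha * (rad - w)).
  by rewrite ler_pM2l// (le_trans h3).
have h7 : alpha / 8 * expR (- alpha) * w * (cosh (alpha * rad) - 1) <=
    alpha / 8 * expR (- alpha) * w * expR (alpha * rad).
  by rewrite ler_wpM2l ?mulr_ge0 ?expR_ge0 ?divr_ge0 ?(ltW a0) ?(ltW w0)//; lra.
have h8 : alpha / 8 * expR (- alpha) * w * expR (alpha * rad) =
   alpha * w / 2 * (expR (alpha * (rad - 1)) / 4) by rewrite -h5; field.
have h9 : (alpha * (rad - w / 2) - alpha * (rad - w)) * sinh (alpha * (rad - w)) =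
  alpha * w / 2 * sinh (alpha * (rad - w)) by field.
lra.
Qed.

Lemma pi_le4 : pi <= 4 :> R.
Proof. by have := pihalf_lt2 R; lra. Qed.

(** Only nodes with radius in [rad - w, rad - w / 2[ are counted, where w = min (r1, 1). Since w <=
    r1, both critical cosines lie in [-1, 1] there, so the section of the difference of the two
    balls contains the angles between the two critical angles. The three factors are the mass of the
    window, the gap of cosines, and the gain of [acosB_ge]. *)
Lemma conn_gap r1 r2 : 4 <= rad -> 1 <= alpha * (rad - 1) ->
  0 < r1 -> r1 < r2 -> r2 <= rad ->
  (conn r2 + (alpha / 8 * expR (- alpha) * Num.min r1 1 *
    ((tanh (r2 / 2) - tanh (r1 / 2)) / (12 * tanh (r2 / 2)) *
      expR ((r1 - 1) / 2) / 48))%:E <= conn r1)%E.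
Proof.
move=> rad4 a1 r10 r12 r2r.
set w := Num.min r1 1; set D := _ / (12 * _).
have w0 : 0 < w by rewrite lt_min r10 ltr01.
have w1 : w <= 1 by rewrite ge_min lexx orbT.
have wr : w <= r1 by rewrite ge_min lexx.
have t10 : 0 < tanh (r1 / 2) by rewrite tanh_gt0// divr_gt0.
have t12 : tanh (r1 / 2) < tanh (r2 / 2) by rewrite ltr_tanh// ltr_pM2r.
have D0 : 0 < D.
  by apply: divr_gt0; [rewrite subr_gt0|apply: mulr_gt0 => //; exact: lt_trans t12].
set H1 := hball rad (tanh (r1 / 2), 0); set H2 := hball rad (tanh (r2 / 2), 0).
have mH1 : measurable H1 by exact: measurable_hball.
have mH2 : measurable H2 by exact: measurable_hball.
have H21 : H2 `<=` H1 by apply: hball0_subset; lra.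
rewrite /conn -/H1 -/H2 -(setDUK H21) [leRHS]measureU//; last 2 first.
- exact: measurableD.
- by rewrite setDIK.
rewrite leeD2l//.
have mD : measurable (H1 `\` H2) by exact: measurableD.
apply: (@le_trans _ _ ((D * expR ((r1 - 1) / 2) / 48)%:E * rl `[(rad - w)%R, (rad - w / 2)%R[%classic)%E).
  rewrite mulrC EFinM lee_wpmul2l ?lee_fin ?radial_law_window//.
  by rewrite divr_ge0// mulr_ge0 ?expR_ge0 ?(ltW D0).
apply: node_law_ge => //; first by rewrite divr_ge0// mulr_ge0 ?expR_ge0 ?(ltW D0).
move=> s /=; rewrite in_itv/= => /andP[s1 s2].
have sp : 0 < s by lra.
have sr : s < rad by lra.
have F1 : -1 <= hcos rad r1 s by apply: hcos_geN1; lra.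
have F2 : hcos rad r2 s <= 1 by apply: hcos_le1; lra.
have FD : D <= hcos rad r2 s - hcos rad r1 s.
  apply: (@hcosB_ge _ _ _ _ _ w) => //; last exact: ltW.
  rewrite le_min; apply/andP; split; last by rewrite ltW// tanh_lt1.
  by apply: (le_trans (tanh_le _)); lra.
have hS : (fun b => (H1 `\` H2) (polar (s, b))) =
    (fun b => hcos rad r1 s <= cos b /\ ~ hcos rad r2 s <= cos b).
  by apply/funext => b /=; rewrite /H1 /H2 /= !hball_section//; lra.
have F12 : hcos rad r1 s < hcos rad r2 s by lra.
have in1 : -1 <= hcos rad r1 s <= 1 by apply/andP; split; lra.
have in2 : -1 <= hcos rad r2 s <= 1 by apply/andP; split; lra.
have aB := acosB_ge F1 F12 F2.
have K1 : cos (acos (hcos rad r1 s)) = hcos rad r1 s by rewrite acosK// in_itv.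
have K2 : cos (acos (hcos rad r2 s)) = hcos rad r2 s by rewrite acosK// in_itv.
have G1 := acos_ge0 in1; have G2 := acos_ge0 in2.
have L1 := acos_lepi in1; have L2 := acos_lepi in2.
(* For r1 <= 1 the right side exceeds 2; for r1 >= 1 use s >= rad - 1. *)
have F1' : 1 - hcos rad r1 s <= 18 * expR (1 - r1).
  have [r11|/ltW r11] := leP r1 1.
    by have := expR_ge1Dx (1 - r1); lra.
  apply: (le_trans (oneBhcos_le _ _ _)) => //; [lra|lra|].
  by rewrite ler_pM2l// ler_expR; lra.
(* 6 is the square root of 2 * 18; the division by 2 * pi <= 8 then yields the 48 of the
   statement. *)
have s36 : Num.sqrt (2 * (1 - hcos rad r1 s)) <= 6 * expR ((1 - r1) / 2).
  rewrite -[leRHS]ger0_norm ?mulr_ge0 ?expR_ge0// -sqrtr_sqr ler_wsqrtr// exprMn.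
  by rewrite -expR_half2; lra.
have aB' : D * expR ((r1 - 1) / 2) / 6 <= acos (hcos rad r1 s) - acos (hcos rad r2 s).
  apply: le_trans aB; rewrite ler_pdivlMr ?sqrtr_gt0; last by lra.
  apply: (@le_trans _ _ (D * expR ((r1 - 1) / 2) / 6 * (6 * expR ((1 - r1) / 2)))).
    by rewrite ler_wpM2l// divr_ge0// mulr_ge0 ?expR_ge0 ?(ltW D0).
  have : expR ((r1 - 1) / 2) * expR ((1 - r1) / 2) = 1.
    by rewrite -expRD (_ : (r1 - 1) / 2 + (1 - r1) / 2 = 0) ?expR0//; field.
  move: (expR ((r1 - 1) / 2)) (expR ((1 - r1) / 2)) => x y xy.
  have -> : D * x / 6 * (6 * y) = D * (x * y) by field.
  by rewrite xy mulr1; lra.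
have mS := measurable_section s mD; rewrite hS in mS *.
have pi0 := pi_gt0 R; have pi4 := pi_le4.
have z0 : 0 <= D * expR ((r1 - 1) / 2) by rewrite mulr_ge0 ?expR_ge0 ?(ltW D0).
apply: le_trans (@uniform_angle_ge _ _ (acos (hcos rad r2 s)) (acos (hcos rad r1 s)) mS _ _ _ _) => //.
- rewrite lee_fin ler_pdivlMr ?mulr_gt0//.
  move: z0 aB'; move: (D * _) => z z0 aB'; nra.
- by rewrite (le_trans _ G2)// oppr_le0 ltW.
- by rewrite -subr_ge0 (le_trans _ aB')// divr_ge0.
- move=> b /andP[b1 b2] /=.
  have b0 : 0 <= b by exact: ltW (le_lt_trans G2 b1).
  have bp : b <= pi by exact: le_trans (ltW b2) L1.
  split; first by rewrite -{1}K1 ltW// ltr_cos// in_itv/= ?b0 ?bp ?G1 ?L1.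
  apply/negP; rewrite -ltNge -{1}K2 ltr_cos// in_itv/= ?b0 ?bp ?G2 ?L2//.
Qed.

Lemma conn_le r x : 1 <= r -> 1 <= x ->
  (conn r <= rl `]-oo, x[ + (24 * expR ((rad - r - x) / 2))%:E)%E.
Proof.
move=> r1 x1; have mH := measurable_hball rad (tanh (r / 2), 0).
rewrite /conn; apply: node_law_le => //.
move=> s /andP[s0 sr] /= /negP; rewrite in_itv/= -leNgt => xs.
have F1 := @oneBhcos_le _ rad r s r1 (le_trans x1 xs) (ltW r0).
have e1 : expR (rad - r - s) <= expR ((rad - r - x) / 2) ^+ 2.
  by rewrite -expR_half2 ler_expR; lra.
have E0 := expR_gt0 ((rad - r - x) / 2).
have hS : (fun b => hball rad (tanh (r / 2), 0) (polar (s, b))) =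
    (fun b => hcos rad r s <= cos b).
  by apply/funext => b /=; rewrite hball_section//; lra.
have mS := measurable_section s mH; rewrite hS in mS *.
move: (expR ((rad - r - x) / 2)) e1 E0 => E e1 E0.
(* Below -1 every angle is allowed, but then 2 < 18 * E^2 and the bound 24 * E exceeds 1. *)
have [Fm|Fm] := ltP (hcos rad r s) (-1).
  apply: (@le_trans _ _ 1%E); first by apply: probability_le1.
  by rewrite lee_fin; nra.
have [F2|F2] := ltP 1 (hcos rad r s).
  rewrite (_ : [set b | _] = set0) ?measure0 ?lee_fin ?mulr_ge0 ?(ltW E0)//.
  by apply/seteqP; split => b //= h; have := cos_le1 b; lra.
have in1 : -1 <= hcos rad r s <= 1 by rewrite Fm F2.
have K1 : cos (acos (hcos rad r s)) = hcos rad r s by rewrite acosK// in_itv.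
have G1 := acos_ge0 in1; have L1 := acos_lepi in1.
have ub := oneBcos_ge G1 L1; rewrite K1 in ub.
set f := acos _ in K1 G1 L1 ub *.
have pi0 := pi_gt0 R.
(* From f^2 / 32 <= 1 - cos f <= 18 * E^2, with 32 * 18 = 24^2. *)
have fE : f <= 24 * E.
  rewrite -ler_sqr ?nnegrE ?mulr_ge0 ?(ltW E0)//; rewrite exprMn; lra.
apply: (le_trans (@uniform_angle_le _ _ (- f) f mS _ _)) => //; first lra.
  move=> b /andP[b1 b2] /= hb; rewrite -ler_norml.
  rewrite leNgt; apply/negP => fb; move: hb; apply/negP; rewrite -ltNge -K1 -(cos_norm b).
  rewrite ltr_cos// in_itv/= ?G1 ?L1// normr_ge0/= ler_norml; apply/andP; split; lra.
rewrite lee_fin ler_pdivrMr ?mulr_gt0//; have := pi_ge2 R; nra.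
Qed.

End connection_probability.

(** * Quantiles of the radial law *)

Section radial_quantiles.
Context {R : realType} (alpha rad : R).
Hypotheses (a0 : 0 < alpha) (r0 : 0 < rad).

(* The radius below which a node lies with probability u. *)
Definition quantile (u : R) : R := arcosh (1 + u * (cosh (alpha * rad) - 1)) / alpha.

Let c1 : 0 < cosh (alpha * rad) - 1.
Proof. by rewrite cosh_sub1_gt0// mulr_gt0. Qed.

Lemma arcosh_ge0 (x : R) : 1 <= x -> 0 <= arcosh x.
Proof. by move=> x1; rewrite ln_ge0// -[leLHS]addr0 lerD ?sqrtr_ge0. Qed.

Let arg_ge1 u : 0 <= u -> 1 <= 1 + u * (cosh (alpha * rad) - 1).
Proof. by move=> u0; rewrite lerDl mulr_ge0// ltW. Qed.

Lemma quantile_ge0 u : 0 <= u -> 0 <= quantile u.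
Proof. by move=> u0; rewrite divr_ge0 ?(ltW a0)// arcosh_ge0// arg_ge1. Qed.

Lemma cosh_quantile u : 0 <= u ->
  cosh (alpha * quantile u) = 1 + u * (cosh (alpha * rad) - 1).
Proof.
move=> u0; rewrite /quantile mulrC divfK ?gt_eqF// cosh_arcosh//; exact: arg_ge1.
Qed.

Lemma quantile_lt u v : 0 <= u -> u < v -> quantile u < quantile v.
Proof.
move=> u0 uv; have v0 : 0 <= v by lra.
have q0 z : 0 <= z -> 0 <= alpha * quantile z.
  by move=> z0; apply: mulr_ge0; [exact: ltW|exact: quantile_ge0].
rewrite ltNge -(ler_pM2l a0) -cosh_le ?q0//.
by rewrite !cosh_quantile// lerD2l ler_pM2r// -ltNge.
Qed.

Lemma quantile_le u v : 0 <= u -> u <= v -> quantile u <= quantile v.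
Proof. by move=> u0; rewrite le_eqVlt => /orP[/eqP->//|/(quantile_lt u0)/ltW]. Qed.

Lemma quantile1 : quantile 1 = rad.
Proof.
rewrite /quantile mul1r addrC subrK arcosh_cosh ?mulr_ge0 ?(ltW a0) ?(ltW r0)//.
by rewrite mulrC mulKf// gt_eqF.
Qed.

Lemma quantile_gt0 u : 0 < u -> 0 < quantile u.
Proof. by move=> u0; apply: le_lt_trans (quantile_lt (lexx 0) u0); exact: quantile_ge0. Qed.

Lemma quantile_le_rad u : 0 <= u -> u <= 1 -> quantile u <= rad.
Proof. by move=> u0 u1; rewrite -[leRHS]quantile1 quantile_le. Qed.

Lemma radial_law_quantile u v : 0 <= u -> u <= v -> v <= 1 ->
  radial_law alpha rad `[quantile u, quantile v[ = (v - u)%:E.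
Proof.
move=> u0 uv v1; have v0 : 0 <= v by lra.
rewrite radial_law_itv ?quantile_ge0 ?quantile_le ?quantile_le_rad//.
rewrite !cosh_quantile//; congr EFin; have := c1; move: (cosh _ - 1) => c c0.
by field; rewrite gt_eqF.
Qed.

(** In this half-angle form the additive 1 disappears: the values of [sinh (alpha * r / 2)] at the
    levels a / n and b / n have the ratio sqrt (b / a), whatever n is. *)
Lemma sinh_quantile u : 0 <= u ->
  sinh (alpha * quantile u / 2) ^+ 2 = u * sinh (alpha * rad / 2) ^+ 2.
Proof.
move=> u0; have := cosh_quantile u0.
rewrite (cosh_half (alpha * quantile u)) (cosh_half (alpha * rad)); lra.
Qed.

Lemma radial_law_below (x : R) : 0 <= x -> x <= rad -> 3 <= alpha * rad ->
  (radial_law alpha rad `]-oo, x[ <= (4 * expR (alpha * (x - rad)))%:E)%E.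
Proof.
move=> x0 xr ar; rewrite radial_law_restr//.
have -> : `]-oo, x[ `&` `[0, rad[ = `[0, x[%classic.
  apply/seteqP; split => z /=; rewrite !in_itv/=; first by move=> [-> /andP[->]].
  by move=> /andP[h1 h2]; split => //; apply/andP; split; lra.
rewrite radial_law_itv// lee_fin ler_pdivrMr// mulr0.
have c0 : cosh 0 = 1 :> R by rewrite /cosh oppr0 expR0; field.
rewrite c0; have h1 : cosh (alpha * x) <= expR (alpha * x).
  by rewrite cosh_le_expR// mulr_ge0// ltW.
have h2 := expR_le_cosh (alpha * rad); have h3 := expR_ge1Dx (alpha * rad).
have h4 : expR (alpha * (x - rad)) * expR (alpha * rad) = expR (alpha * x).
  by rewrite -expRD; congr expR; ring.
have e0 := expR_gt0 (alpha * (x - rad)); nra.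
Qed.

End radial_quantiles.

(** * Growth of the gap between connection probabilities *)

Section connection_asymptotics.
Context {R : realType} (alpha : R).
Hypothesis a0 : 0 < alpha.

(* Nodes at radius below [rad - r / (2 alpha)] are bounded by the tail of the
   radial law, the others by the angle they allow. The exponent is not optimal,
   but it is valid for every [alpha > 0] at once (it is trivial when
   [alpha <= 1/2]). *)
Lemma conn_decay (rad r : R) : 4 <= rad -> 3 <= alpha * rad ->
  (1 / 2 < alpha -> 1 <= rad * (1 - (2 * alpha)^-1)) ->
  0 <= r -> r <= rad ->
  (conn alpha rad r <= (56 * expR (- ((1 - (2 * alpha)^-1) / 2 * r)))%:E)%E.
Proof.
move=> rad4 ar3 ahalf r_ge0 rrad; set k := (1 - _) / 2.
have rad0 : 0 < rad by lra.
have conn1 : (conn alpha rad r <= 1)%E.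
  have := @node_law_le _ _ _ a0 rad0 (hball rad (tanh (r / 2), 0)) set0 1
    (measurable_hball _ _) measurable0 ler01.
  rewrite measure0 add0e; apply => s _ _; apply: probability_le1.
  by apply: measurable_section; exact: measurable_hball.
have i0 : 0 < (2 * alpha)^-1 by rewrite invr_gt0 mulr_gt0.
have k2 : k <= 1 / 2 by rewrite /k; lra.
have [ah|ah] := leP alpha (1 / 2).
  apply: (le_trans conn1); rewrite lee_fin.
  have i1 : 1 <= (2 * alpha)^-1 by rewrite -[leLHS]invr1 lef_pV2 ?posrE ?mulr_gt0//; lra.
  have : 1 <= expR (- (k * r)).
    rewrite -[leLHS]expR0 ler_expR; have : k <= 0 by rewrite /k; lra.
    by move=> k0; nra.
  lra.
have [r1|r1] := ltP r 1.
  apply: (le_trans conn1); rewrite lee_fin.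
  have := expR_ge1Dx (- (k * r)).
  have : k * r <= 1 / 2 * r by rewrite ler_wpM2r.
  lra.
have i1 : (2 * alpha)^-1 < 1 by rewrite -[ltRHS]invr1 ltf_pV2 ?posrE ?mulr_gt0//; lra.
(* This cut makes the radial tail exactly of order exp (- r / 2), which is below exp (- k * r)
   because k <= 1/2. *)
pose x := rad - r * (2 * alpha)^-1.
have x1 : 1 <= x.
  apply: (le_trans (ahalf ah)); rewrite /x mulrBr mulr1 lerB// ler_wpM2r// ltW//.
have xr : x <= rad by rewrite /x gerBl mulr_ge0// ltW.
apply: (le_trans (conn_le a0 rad0 r1 x1)).
apply: (@le_trans _ _ ((4 * expR (alpha * (x - rad)))%:E + (24 * expR ((rad - r - x) / 2))%:E)%E).
  by rewrite leeD2r// radial_law_below//; lra.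
have -> : (rad - r - x) / 2 = - (k * r) by rewrite /x /k; field; rewrite gt_eqF.
have -> : alpha * (x - rad) = - (r / 2) by rewrite /x; field; rewrite gt_eqF.
rewrite -EFinD lee_fin.
have : expR (- (r / 2)) <= expR (- (k * r)).
  rewrite ler_expR lerN2; have : k * r <= 1 / 2 * r by rewrite ler_wpM2r.
  lra.
have := expR_gt0 (- (k * r)); lra.
Qed.

Lemma sinh_quantileE (a rad n : R) : 0 < a -> 0 < n -> 0 < rad ->
  sinh (alpha * quantile alpha rad (a / n) / 2) =
  Num.sqrt (a / n) * sinh (alpha * rad / 2).
Proof.
move=> ap np rad0; have u0 : 0 < a / n by rewrite divr_gt0.
have S0 : 0 < sinh (alpha * rad / 2) by apply: sinh_gt0; rewrite divr_gt0// mulr_gt0.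
have x0 : 0 < sinh (alpha * quantile alpha rad (a / n) / 2).
  by apply: sinh_gt0; rewrite divr_gt0// mulr_gt0// quantile_gt0.
have := sinh_quantile a0 rad0 (ltW u0); move: x0 S0.
move: (sinh (alpha * rad / 2)) (sinh _) => S x x0 S0 xS.
apply: (@pexpIrn _ 2) => //; rewrite ?nnegrE ?mulr_ge0 ?sqrtr_ge0 ?(ltW x0) ?(ltW S0)//.
by rewrite exprMn sqr_sqrtr ?(ltW u0).
Qed.

(** [m] is the common scale of min (r1, 1) and tanh (r2 / 2) in both regimes, A small or large, and
    [l] bounds r2 - r1 by a constant depending on [q] and [alpha] only. *)
Lemma sinh_ratio_estimates (r1 r2 A q m l : R) : 0 < r1 -> r1 < r2 -> 1 < q ->
  sinh (alpha * r1 / 2) = A -> sinh (alpha * r2 / 2) = q * A ->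
  m = Num.min A 1 -> l = 2 / alpha * ln (1 + q) ->
  [/\ 0 < m,
      alpha * r1 / 2 <= ln (1 + 2 * A),
      Num.min (2 / (3 * alpha)) 1 * m <= Num.min r1 1,
      tanh (r2 / 2) <= (4 * q / alpha + 1) * m &
      (2 / alpha * ((q - 1) / (1 + 2 * q))) * m / 4 * expR (- r1 - l / 2)
        <= tanh (r2 / 2) - tanh (r1 / 2)].
Proof.
move=> r1p r12 q1; have r2p : 0 < r2 by lra.
have [x xE] : exists x, x = alpha * r1 / 2 by exists (alpha * r1 / 2).
have [y yE] : exists y, y = alpha * r2 / 2 by exists (alpha * r2 / 2).
rewrite -xE -yE => sx sy mE lE.
have x0 : 0 < x by rewrite xE divr_gt0// mulr_gt0.
have xy : x < y by rewrite xE yE ltr_pM2r// ltr_pM2l.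
have y0 : 0 < y by lra.
have A0 : 0 < A by rewrite -sx sinh_gt0.
have m0 : 0 < m by rewrite mE lt_min A0 ltr01.
have m1 : m <= 1 by rewrite mE ge_min lexx orbT.
have mA : m <= A by rewrite mE ge_min lexx.
have ex1 := expR_le_sinh (ltW x0); rewrite sx in ex1.
have ey1 := expR_le_sinh (ltW y0); rewrite sy in ey1.
have ex2 := sinh_le_expR x; rewrite sx in ex2.
have ex3 := expR_ge1Dx x.
have ye : y - x <= ln (1 + q).
  rewrite -ler_expR lnK ?posrE; last by lra.
  rewrite expRB ler_pdivrMr ?expR_gt0//.
  apply: (le_trans ey1); have : 0 < q by lra.
  by move=> q0; nra.
have B1 := sinhB_le (ltW x0) (ltW xy); rewrite sx sy in B1.
have B2 := sinhB_le (lexx 0) (ltW x0).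
have sinh0 : sinh 0 = 0 :> R by rewrite /sinh oppr0 subrr mul0r.
rewrite sinh0 !subr0 sx in B2.
have mAA : m * A <= A by rewrite ler_piMl// ltW.
(* The mean value bound gives y - x >= (q - 1) * A / (1 + 2 * q * A); then use m <= A and m * A <=
   A. *)
have gap : (q - 1) / (1 + 2 * q) * m <= y - x.
  rewrite mulrAC ler_pdivrMr; last by lra.
  have h : (q - 1) * m * (1 + 2 * q * A) <= (y - x) * (1 + 2 * q) * (1 + 2 * q * A).
    apply: (@le_trans _ _ ((q - 1) * A * (1 + 2 * q))).
      rewrite -!mulrA ler_pM2l; last by lra.
      have : 2 * q * (m * A) <= 2 * q * A by rewrite ler_pM2l//; lra.
      lra.
    have -> : (y - x) * (1 + 2 * q) * (1 + 2 * q * A) = (y - x) * (1 + 2 * q * A) * (1 + 2 * q) by ring.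
    rewrite ler_pM2r; last by lra.
    have : (y - x) * expR y <= (y - x) * (1 + 2 * (q * A)) by rewrite ler_pM2l//; lra.
    lra.
  by move: h; rewrite ler_pM2r//; have := mulr_gt0 (lt_trans ltr01 q1) A0; lra.
have r1E : r1 = 2 / alpha * x by rewrite xE; field; rewrite gt_eqF.
have r2E : r2 = 2 / alpha * y by rewrite yE; field; rewrite gt_eqF.
have ai : 0 < 2 / alpha by rewrite divr_gt0.
split => //.
- by rewrite -ler_expR lnK ?posrE//; lra.
- have m3 : m <= 3 * x.
    have h : m * (1 + 2 * A) <= 3 * x * (1 + 2 * A).
      have : x * expR x <= x * (1 + 2 * A) by rewrite ler_pM2l.
      lra.
    by move: h; rewrite ler_pM2r//; lra.
  rewrite le_min; apply/andP; split.
    apply: (@le_trans _ _ (2 / (3 * alpha) * m)).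
      by rewrite ler_pM2r// ge_min lexx.
    rewrite r1E (_ : 2 / (3 * alpha) = 2 / alpha / 3); last by field; rewrite gt_eqF.
    by rewrite -!mulrA ler_pM2l// ler_pM2l ?invr_gt0//; lra.
  by rewrite mulr_ile1 ?ge_min ?lexx ?orbT// ?(ltW m0)// le_min ler01 andbT ltW// divr_gt0// mulr_gt0.
- have t1 := tanh_lt1 (r2 / 2).
  have t2 : tanh (r2 / 2) <= 4 * q / alpha * A.
    apply: (le_trans (tanh_le _)); first by lra.
    have := sinh_half_ge (ltW y0); rewrite sy => h.
    have -> : 2 * (r2 / 2) = 2 / alpha * y by rewrite -r2E; field.
    have -> : 4 * q / alpha * A = 2 / alpha * (2 * (q * A)) by field; rewrite gt_eqF.
    by rewrite ler_pM2l//; lra.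
  rewrite mulrDl mul1r mE; case: (leP A 1) => h.
    by rewrite (le_trans t2)// lerDl ltW.
  by rewrite mulr1 (le_trans (ltW t1))// lerDr divr_ge0 ?mulr_ge0 ?(ltW a0)//; lra.
rewrite tanhB.
have d0 : 0 <= (r2 - r1) / 2 by lra.
have h1 := sinh_half_ge d0.
have -> : r2 / 2 - r1 / 2 = (r2 - r1) / 2 by field.
have c1 := cosh_le_expR (_ : 0 <= r1 / 2); have c2 := cosh_le_expR (_ : 0 <= r2 / 2).
have {}c1 : cosh (r1 / 2) <= expR (r1 / 2) by apply: c1; lra.
have {}c2 : cosh (r2 / 2) <= expR (r2 / 2) by apply: c2; lra.
have cp1 := cosh_gt0 (r1 / 2); have cp2 := cosh_gt0 (r2 / 2).
have cc : cosh (r1 / 2) * cosh (r2 / 2) <= expR (r1 + l / 2).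
  apply: (@le_trans _ _ (expR (r1 / 2) * expR (r2 / 2))).
    by apply: ler_pM => //; exact: ltW.
  rewrite -expRD ler_expR.
  have : r2 - r1 <= l by rewrite r1E r2E lE -mulrBr ler_pM2l.
  lra.
have cc0 : 0 < cosh (r1 / 2) * cosh (r2 / 2) by rewrite mulr_gt0.
rewrite ler_pdivlMr//.
have -> : - r1 - l / 2 = - (r1 + l / 2) by ring.
rewrite expRN; apply: (@le_trans _ _ (2 / alpha * ((q - 1) / (1 + 2 * q)) * m / 4)).
  rewrite -[leLHS]mulrA ler_piMr//.
    rewrite divr_ge0// mulr_ge0 ?(ltW m0)// mulr_ge0 ?(ltW ai)// divr_ge0//; lra.
  by rewrite mulrC ler_pdivrMr ?expR_gt0// mul1r.
have : 2 / alpha * ((q - 1) / (1 + 2 * q)) * m <= r2 - r1.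
  by rewrite r1E r2E -mulrBr -mulrA ler_pM2l.
lra.
Qed.

End connection_asymptotics.

Section connection_asymptotics_bounds.
Context {R : realType} (alpha : R).
Hypothesis a0 : 0 < alpha.

(** The factor exp (- rad / 4) of sqrt (a / n) meets exp (alpha * rad / 2), hence the exponent [be],
    whose sign changes at alpha = 1/2. *)
Lemma amplitude_bounds (nu a rad : R) : 0 < nu -> 0 < a -> 2 <= alpha * rad ->
  let A := Num.sqrt (a / (nu * expR (rad / 2))) * sinh (alpha * rad / 2) in
  let g := Num.sqrt (a / nu) in
  let be := (alpha - 1 / 2) / 2 in
  g / 4 * expR (be * rad) <= A /\ 2 * A <= g * expR (be * rad).
Proof.
move=> nu0 ap ar A g be.
have gp : 0 < g by rewrite sqrtr_gt0 divr_gt0.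
have E4 : Num.sqrt (a / (nu * expR (rad / 2))) = g * expR (- (rad / 4)).
  have -> : a / (nu * expR (rad / 2)) = (a / nu) * expR (- (rad / 4)) ^+ 2.
    rewrite expR_half2 (_ : rad / 2 / 2 = rad / 4); last by field.
    have := expR_gt0 (rad / 4); rewrite expRN; move: (expR _) => z z0.
    by field; rewrite !gt_eqF.
  by rewrite sqrtrM ?divr_ge0 ?(ltW ap) ?(ltW nu0)// sqrtr_sqr ger0_norm ?expR_ge0.
have eb : expR (- (rad / 4)) * expR (alpha * rad / 2) = expR (be * rad).
  by rewrite -expRD; congr expR; rewrite /be; field.
have S1 : expR (alpha * rad / 2) / 4 <= sinh (alpha * rad / 2).
  rewrite /sinh; have h : expR (- (alpha * rad / 2)) <= 1 by rewrite -[leRHS]expR0 ler_expR; clear -ar; lra.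
  have := expR_ge1Dx (alpha * rad / 2); lra.
have S2 := sinh_le_expR (alpha * rad / 2).
rewrite /A E4 -eb; have := expR_gt0 (- (rad / 4)).
move: S1 S2; move: (expR (- (rad / 4))) (expR (alpha * rad / 2)) (sinh (alpha * rad / 2)).
move=> z w S S1 S2 z0; have gz : 0 < g * z by rewrite mulr_gt0.
have H1 : g * z * (w / 4) <= g * z * S by rewrite ler_pM2l.
have H2 : g * z * (2 * S) <= g * z * w by rewrite ler_pM2l.
clear -H1 H2; lra.
Qed.

(** [b1] and [b2] are the positive and negative parts of the exponent of A. The terms come from n,
    from m^2, and from exp (- r1) / exp (- k * r1) with r1 of order (2 / alpha) * b1 * rad. *)
Lemma exponent_gt0 (b1 b2 k : R) : b1 = Num.max ((alpha - 1 / 2) / 2) 0 ->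
  b2 = Num.max (- ((alpha - 1 / 2) / 2)) 0 -> k = (1 - (2 * alpha)^-1) / 2 ->
  0 < 1 / 2 - 2 * b2 - (1 - k) * (2 / alpha) * b1.
Proof.
move=> -> -> ->; have [be0|be0] := leP 0 ((alpha - 1 / 2) / 2).
  have -> : Num.max (- ((alpha - 1 / 2) / 2)) 0 = 0.
    by apply/max_idPr; clear -be0; lra.
  rewrite (_ : _ - _ = (8 * alpha ^+ 2)^-1); last by field; rewrite gt_eqF.
  by rewrite invr_gt0 mulr_gt0 ?exprn_gt0.
have -> : Num.max (- ((alpha - 1 / 2) / 2)) 0 = - ((alpha - 1 / 2) / 2).
  by apply/max_idPl; clear -be0; lra.
by rewrite mulr0; have := a0; clear; lra.
Qed.

(** The factor m in t2 - t1 cancels against t2 <= C4 * m; the m that remains is the width of the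
    radial window, and exp (- r1) * exp (r1 / 2) leaves exp (- r1 / 2). *)
Lemma gap_lower_bound (K c1 c3 C4 r1 l m t1 t2 : R) :
  0 < K -> 0 < c1 -> 0 < c3 -> 0 < C4 -> 0 < m -> 0 < t2 ->
  c3 * m <= Num.min r1 1 -> t2 <= C4 * m ->
  c1 * m / 4 * expR (- r1 - l / 2) <= t2 - t1 ->
  K * c3 * (c1 / (48 * C4) * expR (- l / 2 - 1 / 2) / 48) * (m * expR (- (r1 / 2))) <=
  K * Num.min r1 1 * ((t2 - t1) / (12 * t2) * expR ((r1 - 1) / 2) / 48).
Proof.
move=> Kp c1p c3p C4p m0 t2p mr1 tle tgap.
have h5 : c1 / (48 * C4) * expR (- r1 - l / 2) <= (t2 - t1) / (12 * t2).
  move: tgap; move: (expR (- r1 - l / 2)) (expR_gt0 (- r1 - l / 2)) => E E0 tgap.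
  rewrite ler_pdivlMr ?mulr_gt0//; apply: le_trans tgap.
  have -> : c1 * m / 4 * E = c1 / (48 * C4) * E * (12 * (C4 * m)) by field; rewrite gt_eqF.
  by rewrite ler_pM2l ?ler_pM2l// !mulr_gt0 ?invr_gt0 ?mulr_gt0.
have ee : expR (- r1 - l / 2) * expR ((r1 - 1) / 2) = expR (- l / 2 - 1 / 2) * expR (- (r1 / 2)).
  by rewrite -!expRD; congr expR; field.
have -> : K * c3 * (c1 / (48 * C4) * expR (- l / 2 - 1 / 2) / 48) * (m * expR (- (r1 / 2))) =
   K * (c3 * m) * (c1 / (48 * C4) * (expR (- l / 2 - 1 / 2) * expR (- (r1 / 2))) / 48) by ring.
rewrite -ee; apply: ler_pM.
- by rewrite !mulr_ge0 ?(ltW Kp) ?(ltW c3p) ?(ltW m0).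
- by rewrite !mulr_ge0 ?expR_ge0 ?(ltW c1p) ?invr_ge0 ?mulr_ge0 ?(ltW C4p).
- by rewrite ler_pM2l.
- by rewrite ler_pM2r ?invr_gt0// mulrA ler_pM2r ?expR_gt0.
Qed.

Lemma quantile_upper (g b1 be rad A r1 : R) : 0 < g -> 0 < rad -> 0 <= b1 -> be <= b1 ->
  0 < A -> 2 * A <= g * expR (be * rad) -> alpha * r1 / 2 <= ln (1 + 2 * A) ->
  r1 <= 2 / alpha * ln (1 + g) + 2 / alpha * b1 * rad.
Proof.
move=> gp radp b10 b1be A0 Ahi xle.
have eb1 : expR (be * rad) <= expR (b1 * rad) by rewrite ler_expR ler_pM2r.
have eb1' : 1 <= expR (b1 * rad) by rewrite -[leLHS]expR0 ler_expR mulr_ge0// ltW.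
have H : alpha * r1 / 2 <= ln (1 + g) + b1 * rad.
  apply: (le_trans xle); rewrite -[leRHS]expRK ler_ln ?posrE ?expR_gt0//; last by lra.
  rewrite expRD lnK ?posrE; last by lra.
  have : g * expR (be * rad) <= g * expR (b1 * rad) by rewrite ler_pM2l.
  clear -Ahi eb1'; lra.
have H2 : 2 / alpha * (alpha * r1 / 2) <= 2 / alpha * (ln (1 + g) + b1 * rad).
  by rewrite ler_pM2l// mulr_gt0 ?invr_gt0.
move: H2; have -> : 2 / alpha * (alpha * r1 / 2) = r1 by field; rewrite gt_eqF.
by clear; lra.
Qed.

Lemma fin_conn (rad r : R) : 0 < rad -> conn alpha rad r = (fine (conn alpha rad r))%:E.
Proof.
move=> radp; rewrite fineK// ge0_fin_numE; last by rewrite /conn measure_ge0.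
have := @node_law_le _ _ _ a0 radp (hball rad (tanh (r / 2), 0)) set0 1
  (measurable_hball _ _) measurable0 ler01.
rewrite measure0 add0e => H; apply: le_lt_trans (H _) (ltry _).
by move=> s _ _; apply: probability_le1; apply: measurable_section; exact: measurable_hball.
Qed.

(* With [A := sinh (alpha * r1 / 2)], of order [expR (be * rad)] where
   [be := (alpha - 1 / 2) / 2], the gap D is at least of order
   [min A 1 * expR (- r1 / 2)] and [conn_decay] bounds [p1]. In [n * D ^+ 2 / p1]
   this leaves the exponent [1 / (8 * alpha ^+ 2)] of [expR rad] if
   [alpha >= 1/2], and [alpha] otherwise. *)
Lemma conn_asymptotics (nu a b : R) : 0 < nu -> 0 < a -> a < b ->
  exists c e rad0 : R, [/\ 0 < c, 0 < e, 0 < rad0 & forall rad, rad0 <= rad ->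
    let n := nu * expR (rad / 2) in
    let r1 := quantile alpha rad (a / n) in
    let r2 := quantile alpha rad (b / n) in
    [/\ b <= n,
        c * expR (- (2 * rad)) <= tanh (r2 / 2) - tanh (r1 / 2) &
        exists p1 p2 D, [/\ conn alpha rad r1 = p1%:E, conn alpha rad r2 = p2%:E,
          0 < D, p2 + D <= p1 & c * expR (e * rad) * p1 <= n * D ^+ 2]]].
Proof.
move=> nu0 ap ab; have bp : 0 < b by lra.
have [q qE] := ex_intro (fun z => z = Num.sqrt (b / a)) _ erefl.
have q1 : 1 < q.
  by rewrite qE -sqrtr1 ltr_sqrt ?divr_gt0// ltr_pdivlMr// mul1r.
have [l lE] := ex_intro (fun z => z = 2 / alpha * ln (1 + q)) _ erefl.
have [c1 c1E] := ex_intro (fun z => z = 2 / alpha * ((q - 1) / (1 + 2 * q))) _ erefl.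
have ai : 0 < alpha^-1 by rewrite invr_gt0.
have c1p : 0 < c1.
  by rewrite c1E mulr_gt0 ?divr_gt0// ?subr_gt0//; lra.
have [c3 c3E] := ex_intro (fun z => z = Num.min (2 / (3 * alpha)) 1) _ erefl.
have c3p : 0 < c3 by rewrite c3E lt_min ltr01 andbT divr_gt0// mulr_gt0.
have [C4 C4E] := ex_intro (fun z => z = 4 * q / alpha + 1) _ erefl.
have C4p : 0 < C4.
  by rewrite C4E addr_gt0// divr_gt0// mulr_gt0//; lra.
have [K KE] := ex_intro (fun z => z = alpha / 8 * expR (- alpha)) _ erefl.
have Kp : 0 < K by rewrite KE mulr_gt0 ?expR_gt0// divr_gt0.
have [k kE] := ex_intro (fun z => z = (1 - (2 * alpha)^-1) / 2) _ erefl.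
have [g gE] := ex_intro (fun z => z = Num.sqrt (a / nu)) _ erefl.
have gp : 0 < g by rewrite gE sqrtr_gt0 divr_gt0.
have [be beE] := ex_intro (fun z => z = (alpha - 1 / 2) / 2) _ erefl.
have [b1 b1E] := ex_intro (fun z => z = Num.max be 0) _ erefl.
have [b2 b2E] := ex_intro (fun z => z = Num.max (- be) 0) _ erefl.
have b1be : be <= b1 by rewrite b1E le_max lexx.
have b10 : 0 <= b1 by rewrite b1E le_max lexx orbT.
have b2be : - be <= b2 by rewrite b2E le_max lexx.
have b20 : 0 <= b2 by rewrite b2E le_max lexx orbT.
have be1 : - be <= 1 by rewrite beE; have := a0; clear; lra.
have b21 : b2 <= 1 by rewrite b2E ge_max be1 ler01.
have [c6 c6E] := ex_intro (fun z => z = Num.min (g / 4) 1) _ erefl.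
have c6p : 0 < c6 by rewrite c6E lt_min ltr01 andbT divr_gt0.
have c6g : c6 <= g / 4 by rewrite c6E ge_min lexx.
have c61 : c6 <= 1 by rewrite c6E ge_min lexx orbT.
have [c5 c5E] := ex_intro (fun z => z = K * c3 * (c1 / (48 * C4) * expR (- l / 2 - 1 / 2) / 48)) _ erefl.
have c5p : 0 < c5.
  by rewrite c5E !mulr_gt0 ?expR_gt0 ?invr_gt0 ?mulr_gt0.
have k1 : 0 < 1 - k.
  have : 0 < (2 * alpha)^-1 by rewrite invr_gt0 mulr_gt0.
  by rewrite kE; clear; lra.
have [e eE] := ex_intro (fun z => z = 1 / 2 - 2 * b2 - (1 - k) * (2 / alpha) * b1) _ erefl.
have ep : 0 < e by rewrite eE; apply: exponent_gt0 => //; rewrite -beE.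
have [G GE] := ex_intro (fun z => z = 2 / alpha * ln (1 + g)) _ erefl.
have [c7 c7E] := ex_intro (fun z => z = nu * c5 ^+ 2 * c6 ^+ 2 * expR (- ((1 - k) * G)) / 56) _ erefl.
have c7p : 0 < c7 by rewrite c7E !mulr_gt0 ?exprn_gt0 ?expR_gt0 ?invr_gt0.
have [c8 c8E] := ex_intro (fun z => z = c1 * c6 / 4 * expR (- l / 2)) _ erefl.
have c8p : 0 < c8 by rewrite c8E !mulr_gt0 ?expR_gt0 ?invr_gt0.
(* Each summand secures one requirement on [rad]. The norm keeps the fourth one nonnegative for
   alpha <= 1/2, where it is not called for; at alpha = 1/2 it is the inverse of 0, that is 0. *)
exists (Num.min c7 c8), e, (4 + (1 / alpha + 1) + 3 / alpha + `|(1 - (2 * alpha)^-1)^-1| + 2 * b / nu).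
have z1 : 0 < 1 / alpha by rewrite mul1r.
have z2 : 0 < 3 / alpha by rewrite mulr_gt0.
have z3 : 0 <= `|(1 - (2 * alpha)^-1)^-1| by [].
have z4 : 0 < 2 * b / nu by rewrite divr_gt0// mulr_gt0.
split => //; first by rewrite lt_min c7p c8p.
  clear -z1 z2 z3 z4; lra.
move=> rad hrad n r1 r2.
have rad4 : 4 <= rad by clear -hrad z1 z2 z3 z4; lra.
have radp : 0 < rad by clear -rad4; lra.
have h1 : 1 <= alpha * (rad - 1).
  by rewrite mulrC -ler_pdivrMr//; clear -hrad z1 z2 z3 z4; lra.
have h3 : 3 <= alpha * rad by rewrite mulrC -ler_pdivrMr//; clear -hrad z1 z2 z3 z4; lra.
have hhalf : 1 / 2 < alpha -> 1 <= rad * (1 - (2 * alpha)^-1).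
  move=> ah; have i1 : (2 * alpha)^-1 < 1.
    by rewrite -[ltRHS]invr1 ltf_pV2 ?posrE ?mulr_gt0//; clear -ah; lra.
  have i2 : 0 < 1 - (2 * alpha)^-1 by rewrite subr_gt0.
  rewrite -ler_pdivrMr// mul1r.
  by move: hrad; rewrite ger0_norm ?invr_ge0 ?(ltW i2)//; clear -z1 z2 z4; lra.
have bn : b <= n.
  have : 1 + rad / 2 <= expR (rad / 2) by exact: expR_ge1Dx.
  have : b / nu <= rad / 2 by clear -hrad z1 z2 z3; lra.
  move=> H1 H2; rewrite /n.
  have H5 : nu * (rad / 2) <= nu * expR (rad / 2) by rewrite ler_pM2l//; clear -H2; lra.
  have : nu * (b / nu) <= nu * (rad / 2) by rewrite ler_pM2l.
  rewrite (mulrC nu (b / nu)) divfK ?gt_eqF//.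
  by move=> H3; exact: le_trans H5.
have np : 0 < n by rewrite mulr_gt0// expR_gt0.
have un0 : 0 < a / n by rewrite divr_gt0.
have uv : a / n < b / n by rewrite ltr_pM2r// invr_gt0.
have v1 : b / n <= 1 by rewrite ler_pdivrMr// mul1r.
have r1p : 0 < r1 by exact: quantile_gt0.
have r12 : r1 < r2 by apply: quantile_lt => //; exact: ltW.
have r2r : r2 <= rad by apply: quantile_le_rad => //; exact: ltW (lt_trans un0 uv).
have r1r : r1 <= rad by exact: ltW (lt_le_trans r12 r2r).
have [A AE] := ex_intro (fun z => z = Num.sqrt (a / n) * sinh (alpha * rad / 2)) _ erefl.
have s1 : sinh (alpha * r1 / 2) = A by rewrite AE; exact: sinh_quantileE.
have s2 : sinh (alpha * r2 / 2) = q * A.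
  rewrite /r2 sinh_quantileE// AE mulrA; congr (_ * _).
  rewrite qE -sqrtrM ?divr_ge0 ?(ltW bp) ?(ltW ap)//; congr Num.sqrt.
  by field; rewrite !gt_eqF.
clearbody r1 r2.
have [m mE] := ex_intro (fun z => z = Num.min A 1) _ erefl.
have [m0 xle mr1 tle tgap] := sinh_ratio_estimates a0 r1p r12 q1 s1 s2 mE lE.
rewrite -c3E in mr1; rewrite -C4E in tle; rewrite -c1E in tgap.
have h2 : 2 <= alpha * rad by clear -h3; lra.
have [Alo Ahi] := amplitude_bounds nu0 ap h2; rewrite -/n -AE -gE -beE in Alo Ahi.
have A0 : 0 < A by apply: lt_le_trans Alo; rewrite mulr_gt0 ?expR_gt0 ?divr_gt0.
have eb2 : expR (- (b2 * rad)) <= expR (be * rad).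
  by rewrite ler_expR -mulNr ler_pM2r// lerNl.
have eb2' : expR (- (b2 * rad)) <= 1 by rewrite -[leRHS]expR0 ler_expR oppr_le0 mulr_ge0// ltW.
have mlo : c6 * expR (- (b2 * rad)) <= m.
  have e0 := expR_gt0 (- (b2 * rad)).
  rewrite mE le_min; apply/andP; split.
    by apply: le_trans Alo; apply: ler_pM => //; exact: ltW.
  by rewrite mulr_ile1// ltW.
have r1hi : r1 <= G + 2 / alpha * b1 * rad.
  by rewrite GE; exact: quantile_upper gp radp b10 b1be A0 Ahi xle.
have t1p : 0 < tanh (r1 / 2) by rewrite tanh_gt0// divr_gt0.
have t12 : tanh (r1 / 2) < tanh (r2 / 2) by rewrite ltr_tanh// ltr_pM2r.
split => //.
  apply: le_trans tgap.
  have ea : expR (- r1 - l / 2) = expR (- r1) * expR (- l / 2) by rewrite -expRD; congr expR; ring.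
  (* A crude bound, from b2 <= 1 and r1 <= rad: it only fixes the degree of the polynomial size of
     the net. *)
  have eb3 : expR (- (2 * rad)) <= expR (- (b2 * rad)) * expR (- r1).
    rewrite -expRD ler_expR; have : b2 * rad <= 1 * rad by rewrite ler_pM2r.
    clear -r1r; lra.
  apply: (@le_trans _ _ (c8 * (expR (- (b2 * rad)) * expR (- r1)))).
    apply: ler_pM; rewrite ?expR_ge0 ?ge_min ?lexx ?orbT//.
    by rewrite le_min ltW// ltW.
  rewrite ea c8E.
  have : c1 * expR (- l / 2) * expR (- r1) * (c6 * expR (- (b2 * rad))) <=
         c1 * expR (- l / 2) * expR (- r1) * m.
    by rewrite ler_pM2l// !mulr_gt0 ?expR_gt0.
  clear; lra.
have cfin r := fin_conn r radp.
have [p1 p1E] := ex_intro (fun z => z = fine (conn alpha rad r1)) _ erefl.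
have [p2 p2E] := ex_intro (fun z => z = fine (conn alpha rad r2)) _ erefl.
have [D DE] := ex_intro (fun z => z = K * Num.min r1 1 *
   ((tanh (r2 / 2) - tanh (r1 / 2)) / (12 * tanh (r2 / 2)) * expR ((r1 - 1) / 2) / 48)) _ erefl.
have gap : p2 + D <= p1.
  have := conn_gap a0 radp rad4 h1 r1p r12 r2r.
  rewrite (cfin r1).
  rewrite (cfin r2).
  rewrite -EFinD lee_fin.
  rewrite p1E p2E DE KE.
  exact.
have dec : p1 <= 56 * expR (- (k * r1)).
  have := conn_decay a0 rad4 h3 hhalf (ltW r1p) r1r.
  rewrite (cfin r1) lee_fin p1E kE.
  exact.
have t2p : 0 < tanh (r2 / 2) by exact: lt_trans t12.
have Dlo : c5 * (m * expR (- (r1 / 2))) <= D.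
  by rewrite c5E DE; exact: gap_lower_bound.
have Dp : 0 < D by apply: lt_le_trans Dlo; rewrite !mulr_gt0 ?expR_gt0.
exists p1, p2, D; split => //; [by rewrite p1E -cfin|by rewrite p2E -cfin|].
have D2 : c5 ^+ 2 * (c6 ^+ 2 * expR (- (2 * b2 * rad)) * expR (- r1)) <= D ^+ 2.
  apply: (@le_trans _ _ ((c5 * (m * expR (- (r1 / 2)))) ^+ 2)).
    rewrite !exprMn ler_pM2l ?exprn_gt0//.
    have -> : expR (- (r1 / 2)) ^+ 2 = expR (- r1).
      by rewrite expr2 -expRD; congr expR; field.
    rewrite ler_pM2r ?expR_gt0//.
    have -> : expR (- (2 * b2 * rad)) = expR (- (b2 * rad)) ^+ 2.
      by rewrite expr2 -expRD; congr expR; ring.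
    by rewrite -exprMn lerXn2r ?nnegrE ?mulr_ge0 ?expR_ge0 ?(ltW c6p) ?(ltW m0).
  by rewrite lerXn2r ?nnegrE ?(ltW Dp)// !mulr_ge0 ?expR_ge0 ?(ltW c5p) ?(ltW m0).
have p10 : 0 <= p1 by rewrite p1E fine_ge0// /conn measure_ge0.
apply: (@le_trans _ _ (c7 * expR (e * rad) * (56 * expR (- (k * r1))))).
  rewrite ler_pM ?mulr_ge0 ?expR_ge0 ?le_min ?(ltW c7p) ?(ltW c8p)//.
  by rewrite ler_pM2r ?expR_gt0// ge_min lexx.
apply: (@le_trans _ _ (n * (c5 ^+ 2 * (c6 ^+ 2 * expR (- (2 * b2 * rad)) * expR (- r1))))); last first.
  by rewrite ler_pM2l.
rewrite /n c7E.
have -> : nu * expR (rad / 2) * (c5 ^+ 2 * (c6 ^+ 2 * expR (- (2 * b2 * rad)) * expR (- r1))) =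
  nu * c5 ^+ 2 * c6 ^+ 2 * (expR (rad / 2) * expR (- (2 * b2 * rad)) * expR (- r1)) by ring.
have -> : nu * c5 ^+ 2 * c6 ^+ 2 * expR (- ((1 - k) * G)) / 56 * expR (e * rad) * (56 * expR (- (k * r1))) =
  nu * c5 ^+ 2 * c6 ^+ 2 * (expR (- ((1 - k) * G)) * expR (e * rad) * expR (- (k * r1))) by field.
rewrite ler_pM2l ?mulr_gt0 ?exprn_gt0// -!expRD ler_expR eE.
have : (1 - k) * r1 <= (1 - k) * (G + 2 / alpha * b1 * rad) by rewrite ler_pM2l.
clear; lra.
Qed.

End connection_asymptotics_bounds.

(** * Degrees of a fixed configuration *)

Section top_degrees_measurability.
Context {R : realType}.

(** On nonnegative reals the inverse is the power of exponent -1, including the value 0 at 0;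
    oddness gives the negative side. *)
Lemma measurable_invr : measurable_fun setT (@GRing.inv R).
Proof.
rewrite (_ : GRing.inv = fun x : R => if 0 <= x then x `^ (-1) else - ((- x) `^ (-1))).
  apply: measurable_fun_if => //.
  - by apply: measurable_fun_ler.
  - by apply: measurable_funTS; exact: measurable_powR.
  - apply: measurable_funTS; apply: measurableT_comp => //.
    by apply: (measurableT_comp (measurable_powR _)).
apply/funext => x; case: (leP 0 x) => x0; first by rewrite powR_inv1.
by rewrite powR_inv1 ?invrN ?opprK// oppr_ge0 ltW.
Qed.

Lemma measurable_arcosh : measurable_fun setT (@arcosh R).
Proof.
apply: measurableT_comp; first exact: measurable_ln.
apply: measurable_funD => //; apply: measurableT_comp.
  by apply: continuous_measurable_fun; exact: sqrt_continuous.
by apply: measurable_funB => //; exact: measurable_funX.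
Qed.

Lemma measurable_hdist d (T : measurableType d) (f g : T -> R * R) :
  measurable_fun setT f -> measurable_fun setT g ->
  measurable_fun setT (fun w => hdist (f w) (g w)).
Proof.
move=> mf mg; apply: (measurableT_comp measurable_arcosh).
have m1 (h : T -> R * R) : measurable_fun setT h -> measurable_fun setT (fun w => (h w).1).
  by move=> mh; exact: (measurableT_comp measurable_fst mh).
have m2 (h : T -> R * R) : measurable_fun setT h -> measurable_fun setT (fun w => (h w).2).
  by move=> mh; exact: (measurableT_comp measurable_snd mh).
have ms (h : T -> R * R) : measurable_fun setT h -> measurable_fun setT (fun w => sqnorm (h w) : R).
  by move=> mh; exact: (measurableT_comp measurable_sqnorm mh).
apply: measurable_funD => //; apply: measurable_funM.
  apply: measurable_funM => //; apply: ms; apply: measurable_fun_pair.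
  - by apply: measurable_funB; exact: m1.
  - by apply: measurable_funB; exact: m2.
apply: (measurableT_comp measurable_invr); apply: measurable_funM.
- by apply: measurable_funB => //; exact: ms.
- by apply: measurable_funB => //; exact: ms.
Qed.

(** The event depends only on finitely many bits: for each pair of nodes, adjacency and the
    comparison of radii. *)
Lemma measurable_top_degrees_ordered (nu : R) (k n : nat) d (T : measurableType d)
    (P : probability T R) (X : 'I_n -> {RV P >-> (R * R)%type}) :
  measurable [set w | top_degrees_ordered nu k (fun i => X i w)].
Proof.
have mX i : measurable_fun setT (X i) by exact: measurable_funPT.
pose f w : {ffun 'I_n * 'I_n -> bool * bool} :=
  [ffun p => (Defs.adjacent nu (fun i => X i w) p.1 p.2, hradius (X p.1 w) <= hradius (X p.2 w))].
pose deg (v : {ffun 'I_n * 'I_n -> bool * bool}) i := #|[set j | (v (i, j)).1]%SET|.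
pose S (v : {ffun 'I_n * 'I_n -> bool * bool}) : Prop :=
  forall s : 'S_n, (forall i j : 'I_n, (i <= j)%N -> (v (s i, s j)).2) ->
  forall i : 'I_n, (k <= i)%N ->
    (forall j l : 'I_n, l = j.+1 :> nat -> (l < k)%N -> (deg v (s l) < deg v (s j))%N) /\
    (forall j : 'I_n, j.+1 = k -> (deg v (s i) < deg v (s j))%N).
have degE w i : deg (f w) i = degree nu (fun i => X i w) i.
  by apply: eq_card => j; rewrite !inE ffunE.
rewrite (_ : [set w | _] = [set w | S (f w)]).
  apply: measurable_finite_image => v.
  have adjm p : measurable [set w | Defs.adjacent nu (fun i => X i w) p.1 p.2].
    rewrite /Defs.adjacent /=; case: (p.1 != p.2) => /=; last first.
      rewrite (_ : [set w | _] = set0)//.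
      by apply/seteqP; split.
    rewrite -[X in measurable X]setTI; apply: measurable_fun_le => //.
    exact: measurable_hdist.
  have radm p : measurable [set w | hradius (X p.1 w) <= hradius (X p.2 w)].
    rewrite -[X in measurable X]setTI; apply: measurable_fun_le => //.
    - by apply: measurable_hdist.
    - by apply: measurable_hdist.
  rewrite (_ : [set w | _] = [set w | forall p,
     ((if (v p).1 then [set w | Defs.adjacent nu (fun i => X i w) p.1 p.2]
      else ~` [set w | Defs.adjacent nu (fun i => X i w) p.1 p.2]) `&`
     (if (v p).2 then [set w | hradius (X p.1 w) <= hradius (X p.2 w)]
      else ~` [set w | hradius (X p.1 w) <= hradius (X p.2 w)])) w]).
    apply: measurable_fin_forall => p; apply: measurableI; case: ifP => _ //.
    - by apply: measurableC.
    - by apply: measurableC.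
  apply/seteqP; split => w /=.
    move=> <- p; rewrite ffunE /=; split; case: ifPn => //= /negP //.
  move=> h; apply/ffunP => p; have := h p; rewrite ffunE; case: (v p) => [[] []] /= [h1 h2].
  - by rewrite h1 h2.
  - by rewrite h1; congr pair; apply/negP.
  - by rewrite h2; congr pair; apply/negP.
  - by congr pair; apply/negP.
apply/seteqP; split => w /=.
  move=> h s hs i ki; have rs : radius_ordering (fun i => X i w) s.
    by move=> a b ab; have := hs a b ab; rewrite ffunE.
  by have [h1 h2] := h s rs i ki; split => [j l lj lk|j jk]; rewrite !degE; [exact: h1|exact: h2].
move=> h s hs i ki; have [|h1 h2] := h s _ i ki.
  by move=> a b ab; rewrite ffunE /=; exact: hs.
by split => [j l lj lk|j jk]; rewrite -!degE; [exact: h1|exact: h2].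
Qed.

End top_degrees_measurability.

(** * Deterministic comparison of degrees through a net *)

Section degree_comparison.
Context {R : realType} (nu : R) (n : nat) (x : 'I_n -> R * R).
Let rad := disc_radius nu n.
Hypothesis rad0 : 0 <= rad.
Hypothesis xdisc : forall i, hdisc rad (x i).

Lemma hballE i j : hball rad (x i) (x j) = (hdist (x i) (x j) <= rad) :> Prop.
Proof.
have [i1 _] := hdisc_sqnorm (xdisc i); have [j1 _] := hdisc_sqnorm (xdisc j).
by rewrite hdist_le// /hball /=; apply/propext; split => [[]//|h]; split => //.
Qed.

Definition ball_count (c : R * R) := #|[set j | `[< hball rad c (x j) >]]%SET|.

(** The successor accounts for the node [i] itself, which may be counted in the ball but never in
    its degree. *)
Lemma degree_ge i c : hball rad c `<=` hball rad (x i) ->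
  (ball_count c <= (degree nu x i).+1)%N.
Proof.
move=> cx; rewrite /degree /ball_count -add1n -(cards1 i).
apply: (@leq_trans #|(i |: [set j | Defs.adjacent nu x i j])%SET|); last exact: leq_card_setU.
apply: subset_leq_card; apply/fintype.subsetP => j; rewrite !inE => /asboolP hc.
have := cx _ (asboolW hc); rewrite hballE => h; case: eqVneq => //= ij; rewrite /Defs.adjacent /= eq_sym ij /=.
exact: h.
Qed.

Lemma degree_le i c : hball rad (x i) `<=` hball rad c ->
  (degree nu x i <= ball_count c)%N.
Proof.
move=> xc; rewrite /degree /ball_count; apply: subset_leq_card; apply/fintype.subsetP => j; rewrite !inE /Defs.adjacent /= => /andP[_ h].
have h' : hball rad (x i) (x j) by rewrite hballE.
exact: (xc _ h').
Qed.

Lemma polar_decomposition (y : R * R) : exists r t, [/\ r = Num.sqrt (sqnorm y),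
  - pi <= t <= pi & y = (r * cos t, r * sin t)].
Proof.
case: y => a b; have [t tpi [h1 h2]] := polar_angle a b.
by exists (Num.sqrt (a ^+ 2 + b ^+ 2)), t; split; rewrite // -h1 -h2.
Qed.

Lemma sqnorm_circle (t : R) : sqnorm (cos t, sin t) = 1.
Proof. by rewrite /sqnorm /= cos2Dsin2. Qed.

Lemma sqnorm_circleB (s t : R) :
  sqnorm (cos s - cos t, sin s - sin t) <= (s - t) ^+ 2.
Proof.
have := oneBcos_le (s - t); rewrite cosB /sqnorm /=.
by have := cos2Dsin2 s; have := cos2Dsin2 t; lra.
Qed.

Definition net_angle (N : nat) (i : nat) : R := - pi + i%:R * (2 * pi / N%:R).

Definition net_point (N i : nat) (t : R) : R * R :=
  (t * cos (net_angle N i), t * sin (net_angle N i)).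

Lemma net_angle_itv N i : (0 < N)%N -> (i <= N)%N -> - pi <= net_angle N i <= pi.
Proof.
move=> N0 iN; have pi0 := pi_gt0 R.
have NR : 0 < N%:R :> R by rewrite ltr0n.
have : 0 <= i%:R / N%:R :> R by rewrite divr_ge0.
have : i%:R / N%:R <= 1 :> R by rewrite ler_pdivrMr// mul1r ler_nat.
rewrite /net_angle; have -> : i%:R * (2 * pi / N%:R) = 2 * pi * (i%:R / N%:R) :> R by ring.
by move: (i%:R / N%:R) => z z1 z0; apply/andP; split; nra.
Qed.

Lemma net_angle_close N (t : R) : (0 < N)%N -> - pi <= t <= pi ->
  exists i : 'I_N.+1, `|t - net_angle N i| <= 2 * pi / N%:R.
Proof.
move=> N0 /andP[t1 t2]; have pi0 := pi_gt0 R.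
have NR : 0 < N%:R :> R by rewrite ltr0n.
have e0 : 0 < 2 * pi / N%:R :> R by rewrite divr_gt0// mulr_gt0.
pose z := (t + pi) / (2 * pi / N%:R).
have z0 : 0 <= z by rewrite divr_ge0 ?(ltW e0)//; lra.
have /andP[h1 h2] := truncn_itv z0.
have iN : (Num.truncn z < N.+1)%N.
  rewrite ltnS -(ler_nat R) (le_trans h1)// ler_pdivrMr//.
  have -> : N%:R * (2 * pi / N%:R) = 2 * pi :> R by field; rewrite gt_eqF.
  lra.
exists (Ordinal iN); rewrite /net_angle /=.
have zE : t + pi = z * (2 * pi / N%:R) by rewrite /z divfK ?gt_eqF.
have g1 : (Num.truncn z)%:R * (2 * pi / N%:R) <= z * (2 * pi / N%:R) by rewrite ler_pM2r.
have g2 : z * (2 * pi / N%:R) < (Num.truncn z).+1%:R * (2 * pi / N%:R) by rewrite ltr_pM2r.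
rewrite -natr1 mulrDl mul1r in g2.
by rewrite ler_norml; apply/andP; split; lra.
Qed.

(** Node [i] is compared with a net point further out, whose ball its own contains, and node [j]
    with a net point further in, whose ball contains its own. The threshold [t + 1] compensates for
    the self-count in [degree_ge]. *)
Lemma degree_separation (N : nat) (t ta ta' tb' tb : R) : (0 < N)%N ->
  0 <= ta -> 2 * pi / N%:R <= ta' - ta -> 0 <= tb' -> 2 * pi / N%:R <= tb - tb' ->
  (forall i : 'I_N.+1, t + 1 <=
     (ball_count (net_point N i ta'))%:R) ->
  (forall i : 'I_N.+1,
     (ball_count (net_point N i tb'))%:R < t) ->
  forall i j, sqnorm (x i) <= ta ^+ 2 -> tb ^+ 2 <= sqnorm (x j) ->
    (degree nu x j < degree nu x i)%N.
Proof.
move=> N0 ta0 haa tb0 hbb hL hU i j xi xj.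
have pi0 := pi_gt0 R.
have e0 : 0 < 2 * pi / N%:R :> R by rewrite divr_gt0 ?mulr_gt0// ltr0n.
have sqr_close (u s : R) : `|u| <= 2 * pi / N%:R -> 2 * pi / N%:R <= s -> u ^+ 2 <= s ^+ 2.
  move=> h1 h2; rewrite -[leLHS]real_normK ?num_real//.
  by rewrite lerXn2r ?nnegrE//; [lra|exact: le_trans h2].
have [ri [ti [riE tipi xiE]]] := polar_decomposition (x i).
have [rj [tj [rjE tjpi xjE]]] := polar_decomposition (x j).
have rile : ri <= ta.
  by rewrite riE -[leRHS]ger0_norm// -sqrtr_sqr ler_wsqrtr.
have rjge : tb <= rj.
  rewrite -[leLHS]ger0_norm; last by lra.
  by rewrite rjE -sqrtr_sqr ler_wsqrtr.
have [a aclose] := net_angle_close N0 tipi.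
have [b bclose] := net_angle_close N0 tjpi.
have di : t <= (degree nu x i)%:R.
  have := hL a; have : (ball_count (net_point N a ta')
      <= (degree nu x i).+1)%N.
    apply: degree_ge; rewrite xiE.
    have := @hball_subset _ rad ri ta' (cos ti, sin ti)
      (cos (net_angle N a), sin (net_angle N a)).
    apply; rewrite ?sqnorm_circle ?riE ?sqrtr_ge0//= -?riE; last by lra.
    by apply: (le_trans (sqnorm_circleB _ _)); apply: sqr_close => //; lra.
  by rewrite -(ler_nat R) -natr1; lra.
have dj : (degree nu x j)%:R < t.
  apply: le_lt_trans (hU b); rewrite ler_nat; apply: degree_le; rewrite xjE.
  have := @hball_subset _ rad tb' rj
    (cos (net_angle N b), sin (net_angle N b)) (cos tj, sin tj).
  apply; rewrite ?sqnorm_circle//=; last by lra.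
  apply: (le_trans (sqnorm_circleB _ _)).
  by apply: sqr_close => //; [rewrite distrC|lra].
by rewrite -(ltr_nat R); exact: lt_le_trans dj di.
Qed.

(** For ranks p < q with p < k, take the first level above the node of rank p. The two-cell window
    starting one level below contains no second node, so the node of rank q lies beyond the next
    level, and a whole cell separates the two. *)
Lemma top_degrees_ordered_of_levels (k M : nat) (tau : nat -> R) :
  tau 0%N = 0 -> (forall m, 0 <= tau m) -> (forall m, tau m <= tau m.+1) ->
  (k <= #|[set i | (sqnorm (x i) < tau M ^+ 2)%R]%SET|)%N ->
  (forall m, (m < M)%N ->
    (#|[set i | (tau m ^+ 2 <= sqnorm (x i) < tau m.+2 ^+ 2)%R]%SET| <= 1)%N) ->
  (forall m, (0 < m <= M)%N -> forall i j, sqnorm (x i) <= tau m ^+ 2 ->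
     tau m.+1 ^+ 2 <= sqnorm (x j) -> (degree nu x j < degree nu x i)%N) ->
  top_degrees_ordered nu k x.
Proof.
move=> tau0 taup taum hk hM hdeg s hs.
have tau2 m : tau m ^+ 2 <= tau m.+1 ^+ 2 by rewrite lerXn2r ?nnegrE.
have sq (a b : 'I_n) : (a <= b)%N -> sqnorm (x (s a)) <= sqnorm (x (s b)).
  move=> ab; rewrite -hradius_le; first exact: hs.
  - by have [] := hdisc_sqnorm (xdisc (s a)).
  - by have [] := hdisc_sqnorm (xdisc (s b)).
suff main (p q : 'I_n) : (p < q)%N -> (p < k)%N ->
    (degree nu x (s q) < degree nu x (s p))%N.
  move=> i ki; split => [j l lj lk|j jk]; apply: main; rewrite ?lj -?jk//.
  - by rewrite (leq_trans _ lk)// lj.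
  - by rewrite jk.
move=> pq pk.
have vM : sqnorm (x (s p)) < tau M ^+ 2.
  (* Otherwise all nodes below the last level have rank less than p, leaving at most p < k of
     them. *)
  rewrite ltNge; apply/negP => h.
  have : (#|[set i | (sqnorm (x i) < tau M ^+ 2)%R]%SET| <= p)%N.
    apply: (@leq_trans #|[set s a | a in [set a : 'I_n | (a < p)%N]]%SET|).
      apply: subset_leq_card; apply/fintype.subsetP => i; rewrite inE => hi.
      apply/imsetP; exists ((s^-1)%g i); last by rewrite permKV.
      rewrite inE ltnNge; apply/negP => hp; move: hi; apply/negP; rewrite -leNgt.
      by apply: (le_trans h); have := sq _ _ hp; rewrite permKV.
    apply: (leq_trans (leq_imset_card _ _)).
    rewrite cardsE -[leqRHS](card_ord p).
    rewrite -(card_imset (mem 'I_p) (f := widen_ord (ltnW (ltn_ord p)))); last first.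
      by move=> a b /(congr1 val) /= /val_inj.
    apply: subset_leq_card; apply/fintype.subsetP => a ap; apply/imsetP.
    by exists (Ordinal ap) => //; apply: val_inj.
  by move=> /(leq_trans hk); rewrite leqNgt pk.
have exm : exists m, sqnorm (x (s p)) < tau m ^+ 2 by exists M.
case: (ex_minnP exm) => -[|m] hm mmin.
  by move: hm; rewrite tau0 expr0n /= ltNge sqnorm_ge0.
have mM : (m < M)%N by exact: mmin.
have lo : tau m ^+ 2 <= sqnorm (x (s p)).
  by rewrite leNgt; apply/negP => /mmin; rewrite ltnn.
have hi : tau m.+2 ^+ 2 <= sqnorm (x (s q)).
  rewrite leNgt; apply/negP => hq.
  have := hM m mM; rewrite leqNgt => /negP; apply; apply/card_gt1P.
  exists (s p), (s q); split; rewrite ?inE.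
  - by rewrite lo (lt_le_trans hm).
  - by rewrite hq andbT (le_trans lo)// sq// ltnW.
  - by apply: contraTneq pq => /perm_inj ->; rewrite ltnn.
by apply: (hdeg m.+1) => //; exact: ltW.
Qed.

End degree_comparison.

(** * Probability of the separation events *)

Section annuli.
Context {R : realType} (alpha rad : R).
Hypotheses (a0 : 0 < alpha) (r0 : 0 < rad).

Lemma quantile0 : quantile alpha rad 0 = 0.
Proof.
rewrite /quantile mul0r addr0 (_ : 1 = cosh 0) ?arcosh_cosh ?mul0r//.
by rewrite /cosh oppr0 expR0; field.
Qed.

Definition annulus (u v : R) : set (R * R) :=
  [set y | tanh (quantile alpha rad u / 2) ^+ 2 <= sqnorm y <
           tanh (quantile alpha rad v / 2) ^+ 2].

Let annulusE (u v : R) : annulus u v =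
  [set y | `[tanh (quantile alpha rad u / 2) ^+ 2,
             tanh (quantile alpha rad v / 2) ^+ 2[%classic (sqnorm y)].
Proof. by apply/seteqP; split => y /=; rewrite in_itv. Qed.

Lemma measurable_annulus u v : measurable (annulus u v).
Proof.
by rewrite annulusE; apply: measurable_preimage => //; exact: measurable_sqnorm.
Qed.

Lemma tanh_sqr_le (x y : R) : 0 <= x -> 0 <= y ->
  (tanh (x / 2) ^+ 2 <= tanh (y / 2) ^+ 2) = (x <= y).
Proof.
move=> x0 y0; have tx : 0 <= tanh (x / 2) by rewrite tanh_ge0// divr_ge0.
have ty : 0 <= tanh (y / 2) by rewrite tanh_ge0// divr_ge0.
rewrite ler_sqr ?nnegrE//; apply/idP/idP => [|xy]; last by rewrite ler_tanh// ler_pM2r.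
by apply: contraTT; rewrite -!ltNge => yx; rewrite ltr_tanh// ltr_pM2r.
Qed.

Lemma node_law_annulus u v : 0 <= u -> u <= v -> v <= 1 ->
  node_law alpha rad (annulus u v) = (v - u)%:E.
Proof.
move=> u0 uv v1; have v0 : 0 <= v by lra.
rewrite annulusE node_law_radial//.
rewrite -(radial_law_quantile a0 r0 u0 uv v1) [RHS]radial_law_restr// radial_law_restr; last first.
  apply: (measurable_preimage (f := fun s : R => tanh (s / 2) ^+ 2)) => //.
  apply: measurable_funX; apply: (measurableT_comp (f := @tanh R)).
    by apply: continuous_measurable_fun; exact: continuous_tanh.
  by apply: measurable_funM.
congr (radial_law _ _ _); apply/seteqP; split => s /=; rewrite !in_itv/=.
  move=> [/andP[h1 h2] /andP[s0 sr]]; rewrite s0 sr; split => //.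
  move: h2; rewrite ltNge tanh_sqr_le ?quantile_ge0// -ltNge => ->; rewrite andbT.
  by move: h1; rewrite tanh_sqr_le ?quantile_ge0.
move=> [/andP[h1 h2] /andP[s0 sr]]; rewrite s0 sr; split => //.
by rewrite ltNge !tanh_sqr_le ?quantile_ge0// -ltNge h1 h2.
Qed.

End annuli.

(** * Deviations of hit counts *)

Section deviations.
Context {R : realType} d d' {T : measurableType d} {T' : measurableType d'}
  (P : probability T R) (n : nat) (X : 'I_n -> {RV P >-> T'}).
Hypotheses (indX : mutually_independent X) (n0 : (0 < n)%N).

(** The value l = D / (4 * p1) minimises p1 * l^2 - l * D / 2. Using p1 >= p gives the same exponent
    as for the lower tail. *)
Lemma deviation_above (A : set T') (p p1 D t : R) : measurable A ->
  (forall i, P (X i @^-1` A) = p%:E) -> 0 < D -> D <= p1 -> p <= p1 ->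
  n%:R * (p + D / 2) <= t ->
  (P [set w | (t <= #|hits X A w|%:R)%R] <= (expR (- (n%:R * D ^+ 2 / p1 / 16)))%:E)%E.
Proof.
move=> mA pA D0 Dp1 pp1 ht; have p10 : 0 < p1 by exact: lt_le_trans Dp1.
have [l lE] := ex_intro (fun z => z = D / (4 * p1)) _ erefl.
have l0 : 0 < l by rewrite lE divr_gt0// mulr_gt0.
have l1 : l <= 1 / 4 by rewrite lE ler_pdivrMr ?mulr_gt0//; lra.
have lp : l * p1 = D / 4 by rewrite lE; field; rewrite gt_eqF.
rewrite (_ : [set w | _] = [set w | l * t <= l * #|hits X A w|%:R]%R); last first.
  by apply/seteqP; split => w /=; rewrite ler_pM2l.
apply: (le_trans (hits_chernoff indX mA pA l t n0)); rewrite lee_fin ler_expR.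
have p0 : 0 <= p by rewrite -lee_fin -(pA (Ordinal n0)) measure_ge0.
have q : expR l - 1 <= l + l ^+ 2 by apply: expR_le_quadratic; rewrite ger0_norm ?(ltW l0).
have nR : 0 <= n%:R :> R by [].
have h1 : n%:R * p * (expR l - 1) <= n%:R * p * (l + l ^+ 2) by rewrite ler_wpM2l// mulr_ge0.
have h2 : l * (n%:R * (p + D / 2)) <= l * t by rewrite ler_pM2l.
have h3 : n%:R * p * l ^+ 2 <= n%:R * p1 * l ^+ 2 by rewrite ler_wpM2r ?sqr_ge0// ler_wpM2l.
have h4 : n%:R * p1 * l ^+ 2 = n%:R * l * D / 4 by rewrite expr2 -mulrA (mulrA p1) (mulrC p1) lp; ring.
have h5 : n%:R * D ^+ 2 / p1 / 16 = n%:R * l * D / 4 by rewrite lE; field; rewrite gt_eqF.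
rewrite h5; clear -h1 h2 h3 h4; lra.
Qed.

Lemma deviation_below (A : set T') (p D t : R) : measurable A ->
  (forall i, P (X i @^-1` A) = p%:E) -> 0 < D -> D <= p ->
  t <= n%:R * (p - D / 2) + 1 ->
  (P [set w | (#|hits X A w|%:R <= t)%R] <=
   (expR (- (n%:R * D ^+ 2 / p / 16) + 1 / 4))%:E)%E.
Proof.
move=> mA pA D0 Dp ht; have p0 : 0 < p by exact: lt_le_trans Dp.
have [l lE] := ex_intro (fun z => z = D / (4 * p)) _ erefl.
have l0 : 0 < l by rewrite lE divr_gt0// mulr_gt0.
have l1 : l <= 1 / 4 by rewrite lE ler_pdivrMr ?mulr_gt0//; lra.
have lp : l * p = D / 4 by rewrite lE; field; rewrite gt_eqF.
rewrite (_ : [set w | _] = [set w | - l * t <= - l * #|hits X A w|%:R]%R); last first.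
  by apply/seteqP; split => w /=; rewrite !mulNr lerN2 ler_pM2l.
apply: (le_trans (hits_chernoff indX mA pA (- l) t n0)); rewrite lee_fin ler_expR.
have q : expR (- l) - 1 <= - l + (- l) ^+ 2.
  by apply: expR_le_quadratic; rewrite normrN ger0_norm ?(ltW l0).
have nR : 0 <= n%:R :> R by [].
have h1 : n%:R * p * (expR (- l) - 1) <= n%:R * p * (- l + (- l) ^+ 2).
  by rewrite ler_wpM2l// mulr_ge0// ltW.
have h2 : l * t <= l * (n%:R * (p - D / 2) + 1) by rewrite ler_pM2l.
have h4 : n%:R * p * l ^+ 2 = n%:R * l * D / 4 by rewrite expr2 -mulrA (mulrA p) (mulrC p) lp; ring.
have h5 : n%:R * D ^+ 2 / p / 16 = n%:R * l * D / 4 by rewrite lE; field; rewrite gt_eqF.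
rewrite sqrrN in h1; rewrite h5; clear -h1 h2 h4 l1; lra.
Qed.

End deviations.

Section degree_separation_probability.
Context {R : realType}.

(** The quadratic bound on [expR (e * rad)] gives c * exp (e * rad) >= 3 * rad, which leaves C * exp
    (- rad). *)
Lemma double_exponential_decay (C c e eps : R) : 0 < C -> 0 < c -> 0 < e -> 0 < eps ->
  exists2 rad0 : R, 0 < rad0 & forall rad, rad0 <= rad ->
    C * expR (2 * rad) * expR (- (c * expR (e * rad))) <= eps.
Proof.
move=> C0 c0 e0 eps0; have c2 : 0 < c * e ^+ 2 / 2 by rewrite divr_gt0// mulr_gt0 ?exprn_gt0.
have h1 : 0 < 3 / (c * e ^+ 2 / 2) by rewrite divr_gt0.
have h2 : 0 < C / eps by rewrite divr_gt0.
exists (3 / (c * e ^+ 2 / 2) + C / eps); first by rewrite addr_gt0.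
move=> rad hrad.
have r1 : 3 / (c * e ^+ 2 / 2) <= rad by lra.
have r2 : C / eps <= rad by lra.
have rp : 0 < rad by lra.
have q : 1 + (e * rad) ^+ 2 / 2 <= expR (e * rad).
  have := @expR_ge1Dxn _ (e * rad) 1 (mulr_ge0 (ltW e0) (ltW rp)).
  by rewrite (_ : 2`! = 2%N).
have q2 : 3 * rad <= c * expR (e * rad).
  have h3 : 3 <= rad * (c * e ^+ 2 / 2) by rewrite -ler_pdivrMr.
  have h4 : 3 * rad <= rad * (c * e ^+ 2 / 2) * rad by rewrite ler_pM2r.
  have h5 : c * (1 + (e * rad) ^+ 2 / 2) <= c * expR (e * rad) by rewrite ler_pM2l.
  have h6 : c * (1 + (e * rad) ^+ 2 / 2) = c + rad * (c * e ^+ 2 / 2) * rad by field.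
  lra.
apply: (@le_trans _ _ (C * expR (- rad))).
  rewrite -mulrA ler_pM2l// -expRD ler_expR; lra.
have q3 := expR_ge1Dx rad; have er := expR_gt0 rad.
rewrite expRN ler_pdivrMr//.
have h7 : C <= eps * rad by rewrite mulrC -ler_pdivrMr.
have h8 : eps * rad <= eps * expR rad by rewrite ler_pM2l//; lra.
lra.
Qed.

Lemma disc_radiusE (nu : R) (n : nat) : 0 < nu -> nu < n%:R ->
  0 < disc_radius nu n /\ n%:R = nu * expR (disc_radius nu n / 2).
Proof.
move=> nu0 nun; have h : 1 < n%:R / nu by rewrite ltr_pdivlMr// mul1r.
split; first by rewrite mulr_gt0// ln_gt0.
have -> : disc_radius nu n / 2 = ln (n%:R / nu) by rewrite /disc_radius; field.
by rewrite lnK ?posrE; [field; rewrite gt_eqF|lra].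
Qed.

Lemma degree_separation_event (alpha nu a a' b' b eps : R) :
  0 < alpha -> 0 < nu -> 0 < a -> a < a' -> a' < b' -> b' < b -> 0 < eps ->
  exists2 rad0 : R, 0 < rad0 & forall n : nat, nu < n%:R -> rad0 <= disc_radius nu n ->
    forall d (T : measurableType d) (P : probability T R)
      (X : 'I_n -> {RV P >-> (R * R)%type}), iid_nodes alpha nu X ->
    exists S : set T, [/\ measurable S, (P S <= eps%:E)%E &
      forall w, ~ S w -> (forall i, hdisc (disc_radius nu n) (X i w)) ->
      forall i j,
        sqnorm (X i w) <= tanh (quantile alpha (disc_radius nu n) (a / n%:R) / 2) ^+ 2 ->
        tanh (quantile alpha (disc_radius nu n) (b / n%:R) / 2) ^+ 2 <= sqnorm (X j w) ->
        (degree nu (fun i => X i w) j < degree nu (fun i => X i w) i)%N].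
Proof.
move=> al0 nu0 ap aa' ab' b'b eps0.
have a'p : 0 < a' by lra.
have b'p : 0 < b' by lra.
(* The outer pairs of levels serve only for their gaps of modulus; the middle pair supplies the gap
   of connection probabilities. *)
have [c1 [e1 [R1 [c1p _ R1p H1]]]] := conn_asymptotics al0 nu0 ap aa'.
have [c2 [e2 [R2 [c2p e2p R2p H2]]]] := conn_asymptotics al0 nu0 a'p ab'.
have [c3 [e3 [R3 [c3p _ R3p H3]]]] := conn_asymptotics al0 nu0 b'p b'b.
have [c cE] := ex_intro (fun z => z = Num.min c1 c3) _ erefl.
have cp : 0 < c by rewrite cE lt_min c1p c3p.
have cc1 : c <= c1 by rewrite cE ge_min lexx.
have cc3 : c <= c3 by rewrite cE ge_min lexx orbT.
(* The net has at most (8 / c + 2) * exp (2 * rad) points, each with a failure probability E for the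
   upper tail and 2 * E for the lower one. *)
have Cp : 0 < 3 * (8 / c + 2) by rewrite mulr_gt0// addr_gt0// divr_gt0.
have c16 : 0 < c2 / 16 by rewrite divr_gt0.
have [R4 R4p H4] := double_exponential_decay Cp c16 e2p eps0.
exists (R1 + R2 + R3 + R4); first by lra.
move=> n nun hrad d T P X [indX lawX].
have [radp nE] := disc_radiusE nu0 nun.
move: hrad radp lawX; have [rad radE] := ex_intro (fun z => z = disc_radius nu n) _ erefl.
rewrite -radE in nE *; move=> hrad radp lawX.
have nR0 : 0 < n%:R :> R by lra.
have n0 : (0 < n)%N by rewrite -(ltr_nat R).
have hR1 : R1 <= rad by clear -hrad R2p R3p R4p; lra.
have hR2 : R2 <= rad by clear -hrad R1p R3p R4p; lra.
have hR3 : R3 <= rad by clear -hrad R1p R2p R4p; lra.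
have hR4 : R4 <= rad by clear -hrad R1p R2p R3p; lra.
have [_ gap1 _] := H1 rad hR1.
have [b'n gap2 [p1 [p2 [D [p1E p2E D0 pD V]]]]] := H2 rad hR2.
have [bn gap3 _] := H3 rad hR3.
rewrite -nE in gap1 gap2 b'n p1E p2E V gap3 bn.
have {}H4 := H4 rad hR4.
clear H1 H2 H3.
set tau := fun u => tanh (quantile alpha rad (u / n%:R) / 2).
have taup u : 0 < u -> 0 < tau u.
  by move=> u0; apply: tanh_gt0; rewrite divr_gt0// quantile_gt0// divr_gt0.
have taup1 := taup _ ap.
have [h hE] := ex_intro (fun z => z = c * expR (- (2 * rad))) _ erefl.
have hp : 0 < h by rewrite hE mulr_gt0// expR_gt0.
have h1 : h <= tau a' - tau a.
  by apply: le_trans gap1; rewrite hE ler_pM2r// expR_gt0.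
have h3 : h <= tau b - tau b'.
  by apply: le_trans gap3; rewrite hE ler_pM2r// expR_gt0.
have pi0 := pi_gt0 R.
pose N := (Num.truncn (2 * pi / h)).+1.
have z0 : 0 <= 2 * pi / h by rewrite divr_ge0 ?mulr_ge0 ?(ltW hp) ?(ltW pi0).
have /andP[N1 N2] := truncn_itv z0; rewrite -/N in N2.
have N0 : (0 < N)%N by [].
have NR : 0 < N%:R :> R by rewrite ltr0n.
have Nh : 2 * pi / N%:R <= h by rewrite ler_pdivrMr// [h * _]mulrC -ler_pdivrMr// ltW.
have Nle : N.+1%:R <= (8 / c + 2) * expR (2 * rad).
  have er : 1 <= expR (2 * rad) by rewrite -[leLHS]expR0 ler_expR mulr_ge0// ltW.
  have hi : 2 * pi / h = 2 * pi / c * expR (2 * rad).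
    rewrite hE expRN; have := expR_gt0 (2 * rad); move: (expR _) => E E0.
    by field; rewrite !gt_eqF.
  have h8 : 2 * pi / c <= 8 / c.
    by rewrite ler_pM2r ?invr_gt0//; have := @pi_le4 R; clear; lra.
  have h9 : 2 * pi / c * expR (2 * rad) <= 8 / c * expR (2 * rad).
    by rewrite ler_pM2r// expR_gt0.
  have -> : N.+1%:R = (Num.truncn (2 * pi / h))%:R + 2 :> R by rewrite -natrD addn2.
  rewrite -hi in h9; move: N1 h9 er.
  by clear; move: (Num.truncn _)%:R (expR _) => x y; lra.
clearbody N.
(* The threshold exceeds n * p2 by n * D / 2 and is at least as far below n * p1. *)
have [t tE] := ex_intro (fun z => z = n%:R * (p2 + D / 2)) _ erefl.
have p20 : 0 <= p2 by rewrite -lee_fin -p2E /conn measure_ge0.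
have Dp1 : D <= p1 by clear -pD p20; lra.
have p21 : p2 <= p1 by clear -pD D0; lra.
have p10 : 0 < p1 by exact: lt_le_trans Dp1.
pose B1 (i : nat) := hball rad (net_point N i (tau a')).
pose B2 (i : nat) := hball rad (net_point N i (tau b')).
have PB i u : (i <= N)%N -> forall j, P (X j @^-1` hball rad (net_point N i (tau u))) =
    conn alpha rad (quantile alpha rad (u / n%:R)).
  move=> iN j; have mB := measurable_hball rad (net_point N i (tau u)).
  have := lawX j _ mB; rewrite /distribution /pushforward => ->.
  by rewrite /net_point node_law_hball_rotation//; exact: net_angle_itv.
have V16 : c2 / 16 * expR (e2 * rad) <= n%:R * D ^+ 2 / p1 / 16.
  have : c2 * expR (e2 * rad) <= n%:R * D ^+ 2 / p1 by rewrite ler_pdivlMr.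
  by clear; move: (_ / p1) (expR _) => x y; lra.
have e14 : expR (1 / 4) <= 2 :> R.
  have : expR (1 / 4) - 1 <= 1 / 4 + (1 / 4) ^+ 2 :> R.
    by apply: expR_le_quadratic; rewrite ger0_norm.
  by clear; lra.
have [E EE] := ex_intro (fun z => z = expR (- (c2 / 16 * expR (e2 * rad)))) _ erefl.
have E0 : 0 < E by rewrite EE expR_gt0.
have PU (i : 'I_N.+1) : (P [set w | (t <= #|hits X (B2 i) w|%:R)%R] <= E%:E)%E.
  have mB : measurable (B2 i) by exact: measurable_hball.
  apply: (le_trans (deviation_above indX n0 mB (p := p2) _ D0 Dp1 p21 _)).
  - by move=> j; rewrite PB ?p2E// -ltnS.
  - by rewrite tE.
  - by rewrite lee_fin EE ler_expR lerN2.
have PL (i : 'I_N.+1) : (P [set w | (#|hits X (B1 i) w|%:R <= t + 1)%R] <= (2 * E)%:E)%E.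
  have mB : measurable (B1 i) by exact: measurable_hball.
  apply: (le_trans (deviation_below indX n0 mB (p := p1) _ D0 Dp1 _)).
  - by move=> j; rewrite PB ?p1E// -ltnS.
  - rewrite tE lerD2r ler_pM2l//; clear -pD; lra.
  - rewrite lee_fin expRD mulrC ler_pM ?expR_ge0//.
    by rewrite EE ler_expR lerN2.
pose S := [set w | exists i : 'I_N.+1, ([set w | (t <= #|hits X (B2 i) w|%:R)%R] `|`
  [set w | (#|hits X (B1 i) w|%:R <= t + 1)%R]) w].
have mU (i : 'I_N.+1) : measurable [set w | (t <= #|hits X (B2 i) w|%:R)%R].
  have mB : measurable (B2 i) by exact: measurable_hball.
  exact: (measurable_hits X mB [set J : {set 'I_n} | t <= #|J|%:R]).
have mL (i : 'I_N.+1) : measurable [set w | (#|hits X (B1 i) w|%:R <= t + 1)%R].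
  have mB : measurable (B1 i) by exact: measurable_hball.
  exact: (measurable_hits X mB [set J : {set 'I_n} | #|J|%:R <= t + 1]).
exists S; split.
- by apply: measurable_fin_exists => i; exact: measurableU.
- have hb (i : 'I_N.+1) : (P ([set w | (t <= #|hits X (B2 i) w|%:R)%R] `|`
      [set w | (#|hits X (B1 i) w|%:R <= t + 1)%R]) <= (E + 2 * E)%:E)%E.
    exact: probability_setU_le.
  have mb (i : 'I_N.+1) : measurable ([set w | (t <= #|hits X (B2 i) w|%:R)%R] `|`
      [set w | (#|hits X (B1 i) w|%:R <= t + 1)%R]) by exact: measurableU.
  apply: (le_trans (union_bound mb hb)).
  rewrite lee_fin sumr_const card_ord -[leLHS]mulr_natl.
  apply: le_trans H4; rewrite -EE.
  have : N.+1%:R * (3 * E) <= (8 / c + 2) * expR (2 * rad) * (3 * E).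
    by rewrite ler_pM2r// mulr_gt0.
  by clear; move: (8 / c) (expR _) (N.+1%:R) => x y z; nra.
- move=> w Sw wdisc i j xi xj.
  have rad_ge0 : 0 <= disc_radius nu n by rewrite -radE ltW.
  have wd : forall i, hdisc (disc_radius nu n) (X i w) by move=> l; rewrite -radE.
  have hL (l : 'I_N.+1) : t + 1 <= (ball_count nu (fun i => X i w) (net_point N l (tau a')))%:R.
    rewrite leNgt; apply/negP => hl; apply: Sw; exists l; right => /=.
    by apply: ltW; move: hl; rewrite /ball_count -radE.
  have hU (l : 'I_N.+1) : (ball_count nu (fun i => X i w) (net_point N l (tau b')))%:R < t.
    rewrite ltNge; apply/negP => hl; apply: Sw; exists l; left => /=.
    by move: hl; rewrite /ball_count -radE.
  exact: (degree_separation rad_ge0 wd N0 (ltW taup1) (le_trans Nh h1)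
    (ltW (taup _ b'p)) (le_trans Nh h3) hL hU xi xj).
Qed.

Lemma eventually_all (Q : nat -> R -> Prop) (M : nat) :
  (forall m, exists2 r, 0 < r & forall rad, r <= rad -> Q m rad) ->
  exists2 r, 0 < r & forall rad, r <= rad -> forall m, (m < M)%N -> Q m rad.
Proof.
move=> HQ; elim: M => [|M [r r0 IH]]; first by exists 1.
have [r' r'0 H] := HQ M; exists (r + r'); first exact: addr_gt0.
move=> rad hrad m; rewrite ltnS leq_eqVlt => /orP[/eqP->|mM].
  by apply: H; lra.
by apply: IH => //; lra.
Qed.

Lemma top_degrees_ordered_probability (alpha nu eps : R) (k : nat) :
  0 < alpha -> 0 < nu -> 0 < eps ->
  exists2 n0 : R, nu < n0 & forall n : nat, n0 <= n%:R ->
    forall d (T : measurableType d) (P : probability T R)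
      (X : 'I_n -> {RV P >-> (R * R)%type}), iid_nodes alpha nu X ->
    ((1 - 3 * eps)%:E <= P [set w | top_degrees_ordered nu k (fun i => X i w)])%E.
Proof.
move=> al0 nu0 eps0.
(* Chosen so that 3 * K / 16 - k / 4 = 1 / eps: the lower tail with l = - 1 / 4 is then at most exp
   (- 1 / eps) <= eps. *)
have [K KE] := ex_intro (fun z => z = 16 / 3 * (k%:R / 4 + 1 / eps)) _ erefl.
have ie0 : 0 < 1 / eps by rewrite divr_gt0.
have kR : 0 <= k%:R :> R by [].
have K0 : 0 < K by rewrite KE; clear -ie0 kR; lra.
have z0 : 0 <= 4 * K ^+ 2 / eps by rewrite divr_ge0 ?mulr_ge0 ?sqr_ge0// ltW.
have /andP[_ hM] := truncn_itv z0.
(* A window of two cells has expected count 2 * K / M, so the M windows fail with total probability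
   at most 4 * K^2 / M <= eps. *)
have [M ME] := ex_intro (fun z => z = (Num.truncn (4 * K ^+ 2 / eps)).+1) _ erefl.
rewrite -ME in hM; have M0 : (0 < M)%N by rewrite ME.
have MR : 0 < M%:R :> R by rewrite ltr0n.
have [de deE] := ex_intro (fun z => z = K / M%:R) _ erefl.
have de0 : 0 < de by rewrite deE divr_gt0.
have Mde : M%:R * de = K by rewrite deE; field; rewrite gt_eqF.
pose Q (m : nat) (rad : R) := forall n : nat, nu < n%:R -> rad = disc_radius nu n ->
    forall d (T : measurableType d) (P : probability T R)
      (X : 'I_n -> {RV P >-> (R * R)%type}), iid_nodes alpha nu X ->
    exists S : set T, [/\ measurable S, (P S <= (eps / M%:R)%:E)%E &
      forall w, ~ S w -> (forall i, hdisc rad (X i w)) ->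
      forall i j,
        sqnorm (X i w) <= tanh (quantile alpha rad (m.+1%:R * de / n%:R) / 2) ^+ 2 ->
        tanh (quantile alpha rad (m.+2%:R * de / n%:R) / 2) ^+ 2 <= sqnorm (X j w) ->
        (degree nu (fun i => X i w) j < degree nu (fun i => X i w) i)%N].
have HQ m : exists2 r, 0 < r & forall rad, r <= rad -> Q m rad.
  have m0 : 0 < m.+1%:R * de by rewrite mulr_gt0.
  have h1 : m.+1%:R * de < m.+1%:R * de + de / 3 by rewrite ltrDl divr_gt0.
  have h2 : m.+1%:R * de + de / 3 < m.+1%:R * de + 2 * de / 3.
    by rewrite ltrD2l ltr_pM2r//; clear -de0; lra.
  have h3 : m.+1%:R * de + 2 * de / 3 < m.+2%:R * de.
    have -> : m.+2%:R = m.+1%:R + 1 :> R by rewrite natr1.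
    by move: (m.+1%:R) => y; clear -de0; lra.
  have eM : 0 < eps / M%:R by rewrite divr_gt0.
  have [r r0 H] := degree_separation_event al0 nu0 m0 h1 h2 h3 eM.
  exists r => // rad hr n nun radE d T P X iidX.
  by have := H n nun _ d T P X iidX; rewrite -radE; apply.
have [r r0 HS] := eventually_all M HQ.
(* The first term forces [rad] beyond r. The second makes all levels up to index M + 1
   probabilities, as M + 1 <= 2 * M. *)
exists (nu * expR (r / 2) + 2 * M%:R * de).
  have : nu < nu * expR (r / 2) by rewrite ltr_pMr// expR_gt1 divr_gt0.
  have : 0 < M%:R * de by rewrite mulr_gt0.
  by clear; move: (M%:R) (expR _) => x y; lra.
move=> n hn d T P X iidX; have [indX lawX] := iidX.
have Mde0 : 0 < 2 * M%:R * de by rewrite !mulr_gt0.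
have e0 : 0 < nu * expR (r / 2) by rewrite mulr_gt0// expR_gt0.
have hn1 : nu * expR (r / 2) <= n%:R by clear -hn Mde0; lra.
have hn2 : 2 * M%:R * de <= n%:R by clear -hn e0; lra.
have nun : nu < n%:R by apply: lt_le_trans hn1; rewrite ltr_pMr// expR_gt1 divr_gt0.
have nR : 0 < n%:R :> R by exact: lt_trans nun.
have n0 : (0 < n)%N by rewrite -(ltr_nat R).
have [radp nE] := disc_radiusE nu0 nun.
have [rad radE] := ex_intro (fun z => z = disc_radius nu n) _ erefl.
rewrite -radE in radp nE lawX.
have rrad : r <= rad.
  have : expR (r / 2) <= expR (rad / 2) by rewrite -(ler_pM2l nu0) -nE.
  by rewrite ler_expR ler_pM2r ?invr_gt0.
have ev m : exists S : set T, (m < M)%N -> [/\ measurable S, (P S <= (eps / M%:R)%:E)%E &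
      forall w, ~ S w -> (forall i, hdisc rad (X i w)) ->
      forall i j,
        sqnorm (X i w) <= tanh (quantile alpha rad (m.+1%:R * de / n%:R) / 2) ^+ 2 ->
        tanh (quantile alpha rad (m.+2%:R * de / n%:R) / 2) ^+ 2 <= sqnorm (X j w) ->
        (degree nu (fun i => X i w) j < degree nu (fun i => X i w) i)%N].
  have [mM|mM] := boolP (m < M)%N; last by exists set0.
  by have [S HSm] := HS rad rrad m mM n nun radE d T P X iidX; exists S.
have [S3 HS3] := choice ev.
pose u (m : nat) : R := m%:R * de / n%:R.
have u0 m : 0 <= u m by rewrite divr_ge0 ?mulr_ge0 ?(ltW de0).
have ule i j : (i <= j)%N -> u i <= u j.
  by move=> ij; rewrite ler_pM2r ?invr_gt0// ler_pM2r// ler_nat.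
have u1 m : (m <= M.+1)%N -> u m <= 1.
  move=> mM; rewrite ler_pdivrMr// mul1r; apply: le_trans hn2; rewrite ler_pM2r//.
  rewrite -natrM ler_nat (leq_trans mM)// mul2n -addnn -addn1 leq_add2l//.
have PX (A : set (R * R)) (p : R) : measurable A -> node_law alpha rad A = p%:E ->
    forall i, P (X i @^-1` A) = p%:E.
  by move=> mA <- i; exact: lawX.
pose S0 := [set w | exists i : 'I_n, (X i @^-1` (~` hdisc rad)) w].
pose A1 := annulus alpha rad (u 0%N) (u M).
pose S1 := [set w | (#|hits X A1 w|%:R <= k%:R :> R)%R].
pose A2 (m : nat) := annulus alpha rad (u m) (u m.+2).
pose S2 := [set w | exists m : 'I_M, [set w | (1 < #|hits X (A2 m) w|)%N] w].
pose S3' := [set w | exists m : 'I_M, S3 m w].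
have mA1 : measurable A1 by exact: measurable_annulus.
have mA2 m : measurable (A2 m) by exact: measurable_annulus.
have mS0 : measurable S0.
  apply: measurable_fin_exists => i; apply: measurable_funPTI.
  by apply: measurableC; exact: measurable_hdisc.
have mS1 : measurable S1.
  exact: (measurable_hits X mA1 [set J : {set 'I_n} | #|J|%:R <= k%:R :> R]).
have mS2m m : measurable [set w | (1 < #|hits X (A2 m) w|)%N].
  exact: (measurable_hits X (mA2 m) [set J : {set 'I_n} | (1 < #|J|)%N]).
have mS2 : measurable S2 by apply: measurable_fin_exists => m.
have mS3m (m : 'I_M) : measurable (S3 m) by have [] := HS3 m (ltn_ord m).
have mS3 : measurable S3' by apply: measurable_fin_exists.
have PS0 : (P S0 <= 0%:E)%E.
  have h (i : 'I_n) : (P (X i @^-1` (~` hdisc rad)) <= 0%:E)%E.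
    rewrite (PX _ 0)//; first by apply: measurableC; exact: measurable_hdisc.
    exact: node_law_out.
  have m0 (i : 'I_n) : measurable (X i @^-1` (~` hdisc rad)).
    apply: measurable_funPTI; apply: measurableC; exact: measurable_hdisc.
  by have := union_bound m0 h; rewrite big1.
have uM : n%:R * (u M - u 0%N) = K.
  by rewrite -Mde /u; field; rewrite gt_eqF.
have PS1 : (P S1 <= eps%:E)%E.
  rewrite /S1 (_ : [set w | _] = [set w | - (1 / 4) * k%:R <= - (1 / 4) * #|hits X A1 w|%:R :> R]%R); last first.
    by apply/seteqP; split => w /=; rewrite !mulNr lerN2 ler_pM2l.
  have pA1 := PX _ _ mA1 (node_law_annulus al0 radp (u0 0%N) (ule _ _ (leq0n M)) (u1 _ (leqnSn M))).
  apply: (le_trans (hits_chernoff indX mA1 pA1 (- (1 / 4)) k%:R n0)).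
  rewrite lee_fin uM.
  have q : expR (- (1 / 4)) - 1 <= - (1 / 4) + (- (1 / 4)) ^+ 2 :> R.
    by apply: expR_le_quadratic; rewrite normrN ger0_norm.
  have q2 : K * (expR (- (1 / 4)) - 1) <= K * (- (3 / 16)).
    by rewrite ler_pM2l//; move: q; clear; lra.
  apply: (@le_trans _ _ (expR (- (1 / eps)))).
    by rewrite ler_expR; move: q2; rewrite {2}KE; clear; lra.
  rewrite expRN invf_ple ?posrE ?expR_gt0//.
  by have := expR_ge1Dx (1 / eps); rewrite div1r; clear; lra.
have PS2 : (P S2 <= eps%:E)%E.
  have h (m : 'I_M) : (P [set w | (1 < #|hits X (A2 m) w|)%N] <= (4 * de ^+ 2)%:E)%E.
    have m2 : (m.+2 <= M.+1)%N by rewrite ltnS.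
    have m3 : (m <= m.+2)%N by rewrite -addn2 leq_addr.
    have pA := PX _ _ (mA2 m) (node_law_annulus al0 radp (u0 m) (ule _ _ m3) (u1 _ m2)).
    apply: (le_trans (two_hits_prob_le indX (mA2 m) pA)).
    rewrite lee_fin -exprMn (_ : n%:R * _ = 2 * de); last first.
      rewrite /u -[in m.+2%:R]addn2 natrD; move: (m%:R : R) => y.
      by field; rewrite gt_eqF.
    by rewrite exprMn; clear; rewrite le_eqVlt; apply/orP; left; apply/eqP; ring.
  apply: (le_trans (union_bound (fun m : 'I_M => mS2m m) h)).
  rewrite lee_fin sumr_const card_ord -[leLHS]mulr_natl.
  have -> : M%:R * (4 * de ^+ 2) = 4 * K ^+ 2 / M%:R by rewrite deE; field; rewrite gt_eqF.
  by rewrite ler_pdivrMr// [eps * _]mulrC -ler_pdivrMr// ltW.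
have PS3 : (P S3' <= eps%:E)%E.
  have h (m : 'I_M) : (P (S3 m) <= (eps / M%:R)%:E)%E by have [] := HS3 m (ltn_ord m).
  apply: (le_trans (union_bound mS3m h)).
  by rewrite lee_fin sumr_const card_ord -[leLHS]mulr_natl mulrC divfK// gt_eqF.
pose S := S0 `|` (S1 `|` (S2 `|` S3')).
have mS : measurable S by do !apply: measurableU.
have PS : (P S <= (3 * eps)%:E)%E.
  have -> : 3 * eps = 0 + (eps + (eps + eps)) by ring.
  apply: probability_setU_le => //; first by do !apply: measurableU.
  apply: probability_setU_le => //; first by do !apply: measurableU.
  exact: probability_setU_le.
have Stop : ~` S `<=` [set w | top_degrees_ordered nu k (fun i => X i w)].
  move=> w Sw /=.
  have nS0 : ~ S0 w by move=> h; apply: Sw; left.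
  have nS1 : ~ S1 w by move=> h; apply: Sw; right; left.
  have nS2 : ~ S2 w by move=> h; apply: Sw; right; right; left.
  have nS3 : ~ S3' w by move=> h; apply: Sw; right; right; right.
  have wd i : hdisc rad (X i w) by apply: contrapT => h; apply: nS0; exists i.
  have wd' i : hdisc (disc_radius nu n) (X i w) by rewrite -radE.
  have rad_ge0 : 0 <= disc_radius nu n by rewrite -radE ltW.
  apply: (@top_degrees_ordered_of_levels R nu n (fun i => X i w) wd' k M
    (fun m => tanh (quantile alpha rad (u m) / 2))).
  - rewrite /u mul0r mul0r quantile0//.
    by rewrite /tanh /sinh mul0r oppr0 subrr !mul0r.
  - by move=> m; rewrite tanh_ge0// divr_ge0// quantile_ge0.
  - by move=> m; apply: ler_tanh; rewrite ler_pM2r ?invr_gt0// quantile_le// ule.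
  - move: nS1 => /negP; rewrite -ltNge ltr_nat => /ltnW h; apply: (leq_trans h).
    apply: subset_leq_card; apply/fintype.subsetP => i; rewrite !inE => hi.
    by move: hi; rewrite /A1 /annulus /= => /andP[].
  - move=> m mM; rewrite leqNgt; apply/negP => h; apply: nS2; exists (Ordinal mM) => /=.
    apply: (leq_trans h); apply: subset_leq_card; apply/fintype.subsetP => i.
    by rewrite !inE.
  - move=> [//|m] /= mM i j xi xj.
    have [_ _ H] := HS3 m mM.
    apply: (H w) => // Sm; apply: nS3; exists (Ordinal mM).
    exact: Sm.
have mtop := measurable_top_degrees_ordered nu k X.
apply: (@le_trans _ _ (P (~` S))); last by rewrite le_measure ?inE//; exact: measurableC.
rewrite probability_setC//.
have PSE : P S = (fine (P S))%:E by rewrite fineK// fin_num_measure.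
rewrite PSE -EFinB lee_fin lerD2l lerN2 -lee_fin -PSE.
exact: PS.
Qed.

End degree_separation_probability.

Theorem theorem3p1 (R : realType) (alpha nu : R) (k : nat)
    (halpha : 0 < alpha) (hnu : 0 < nu) (hk : (1 <= k)%N)
    (d : nat -> measure_display)
    (T : forall n, measurableType (d n))
    (P : forall n, probability (T n) R)
    (X : forall n, 'I_n -> {RV (P n) >-> (R * R)%type})
    (hX : forall n, nu < n%:R -> iid_nodes alpha nu (X n)) :
  P n [set omega | top_degrees_ordered nu k (fun i => X n i omega)]
    @[n --> \oo] --> 1%E.
Proof.
have mtop n := measurable_top_degrees_ordered nu k (X n).
apply/fine_cvgP; split.
  by near=> n; rewrite fin_num_measure.
apply/cvgrPdist_le => e e0.
have e3 : 0 < e / 3 by rewrite divr_gt0.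
have [n0 nun0 H] := top_degrees_ordered_probability k halpha hnu e3.
near=> n.
have hn : n0 <= n%:R by near: n; exact: nbhs_infty_ger.
have := H n hn _ _ _ (X n) (hX n (lt_le_trans nun0 hn)).
have p1 := probability_le1 (P n) (mtop n).
rewrite /= -[X in (_ <= X)%E]fineK ?fin_num_measure// lee_fin.
rewrite -[leLHS]fineK ?fin_num_measure// lee_fin in p1.
have -> : 3 * (e / 3) = e by field.
by move=> h; rewrite ler_norml; apply/andP; split; lra.
Unshelve. all: by end_near.
Qed.
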